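(* Let $p>2$ be a prime and $n\ge1$, and let $\zeta\in H^1(\mathbb{G}_n,E_0)$ be the class represented by the homomorphism $\zeta_n:\mathbb{G}_n\to\mathbb{Z}_p\subseteq E_0$. Then $$\exp(p\zeta)=t_0^{-\lambda}\det\ \in\ H^1(\mathbb{G}_n,E_0^\times),$$ where $\lambda=\lim_k p^{nk}r(n)\in\lim_k\mathbb{Z}/p^{nk}(p^n-1)=\mathfrak{Z}_n$ and $r(n)=(p^n-1)/(p-1)$.
   Context: Let $H_n$ be the Honda formal group law: the $p$-typical formal group law over $\mathbb{F}_{p^n}$ with $p$-series $[p](x)=x^{p^n}$. Let $\mathbb{S}_n=\mathrm{Aut}(H_n/\mathbb{F}_{p^n})$ and $\mathbb{G}_n=\mathrm{Aut}(H_n,\mathbb{F}_{p^n})\cong\mathbb{S}_n\rtimes\mathrm{Gal}(\mathbb{F}_{p^n}/\mathbb{F}_p)$. Let $\mathbb{W}=W(\mathbb{F}_{p^n})$ be the Witt vectors and $E_0=\mathbb{W}[[u_1,\dots,u_{n-1}]]$, a complete local ring with maximal ideal $\mathfrak{m}=(p,u_1,\dots,u_{n-1})$, carrying the universal deformation $G_n$ of $H_n$: the $p$-typical formal group law with $p$-series $px+_{G_n}u_1x^p+_{G_n}\cdots+_{G_n}u_{n-1}x^{p^{n-1}}+_{G_n}x^{p^n}$. Action of $\mathbb{G}_n$ on $E_0$ and $t_0$: for $g=g(x)\in\mathbb{S}_n$, choose a lift $h(x)\in E_0[[x]]$ of $g(x)$ and let $G_h$ be the formal group law over $E_0$ with $h:G_h\to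 G_n$ an isomorphism. There is a unique continuous $\mathbb{W}$-algebra map $\phi_g:E_0\to E_0$ and a unique isomorphism $f:(\phi_g)_*G_n\to G_h$ reducing to the identity modulo $\mathfrak{m}$. Put $\psi_g=h\circ f:(\phi_g)_*G_n\to G_n$; $\phi_g$ and $\psi_g$ are independent of the choice of $h$. The action of $\mathbb{S}_n$ on $E_0$ is $g\mapsto\phi_g$, extended to $\mathbb{G}_n$ using the Galois action on $\mathbb{W}$. Let $t_0(g)=\psi_g'(0)\in E_0^\times$ be the leading coefficient of $\psi_g$. Then $t_0(gh)=[g\,t_0(h)]\,t_0(g)$, i.e. $t_0$ is a crossed homomorphism, extended to $\mathbb{G}_n$ by $t_0(g,\phi)=t_0(g)$ for $(g,\phi)\in\mathbb{S}_n\rtimes\mathrm{Gal}$. The determinant: $\mathrm{End}(H_n/\mathbb{F}_{p^n})\cong\mathbb{W}\langle S\rangle/(S^n-p,\ Sa=a^\phi S)$, where $S=x^p$ and $a\mapsto a^\phi$ is the lift of Frobenius. The right action of $\mathbb{S}_n$ on the endomorphism ring, with $\mathbb{W}$-basis $\{S^i: 0\le i\le n-1\}$, gives $A:\mathbb{S}_n\to\mathrm{GL}_n(\mathbb{W})$, where for $g=a_0+a_1S+\cdots+a_{n-1}S^{n-1}$ the matrix $A(g)$ has first column $(a_0,a_1,\dots,a_{n-1})^T$, second column $(pa_{n-1}^{\phi},a_0^{\phi},\dots,a_{n-2}^{\phi})^T$, ..., last column $(pa_1^{\phi^{n-1}},pa_2^{\phi^{n-1}},\dots,a_0^{\phi^{n-1}})^T$.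 One has $\det A(g)\in\mathbb{Z}_p^\times$; $\det:\mathbb{G}_n\to\mathbb{Z}_p^\times$ is the homomorphism $(g,\phi)\mapsto\det A(g)$. It is regarded as a crossed homomorphism to $E_0^\times$ via $\mathbb{Z}_p^\times\subseteq E_0^\times$. The homomorphism $\zeta_n$: for $g\in\mathbb{S}_n$ with leading coefficient $g'(0)\in\mathbb{F}_{p^n}^\times$ one has $\det(g)\equiv g'(0)^{r(n)}$ modulo $p$, with $g'(0)^{r(n)}\in\mathbb{F}_p^\times$. Identifying elements of $\mathbb{F}_p^\times$ with their Teichmüller lifts in $\mathbb{Z}_p^\times$, put $\theta(g)=g'(0)^{-r(n)}\det(g)\in1+p\mathbb{Z}_p$ and $\zeta_n(g)=\frac1p\log\theta(g)\in\mathbb{Z}_p$; extend to $\mathbb{G}_n$ by $\zeta_n(g,\phi)=\zeta_n(g)$. $\mathfrak{Z}_n=\lim_k\mathbb{Z}/p^k(p^n-1)$. The group $E_0^\times$ is a continuous $\mathfrak{Z}_n$-module: for $a\in\mathfrak{Z}_n$ and $x\in E_0^\times$, $x^a=\lim_kx^{a_k}$, where $a_k$ is an integer with $a_k\equiv a$ modulo $p^k(p^n-1)$; hence $H^1(\mathbb{G}_n,E_0^\times)$ is a $\mathfrak{Z}_n$-module, written multiplicatively. Cohomology is continuous cohomology, and cohomology classes are denoted by crossed homomorphisms representing them. The map $\exp(p-):H^1(\mathbb{G}_n,E_0)\to H^1(\mathbb{G}_n,E_0^\times)$ is induced by $E_0\to E_0^\times$, $x\mapsto\exp(px)=\sum_{m\ge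 0} p^mx^m/m!$. *)

(* Defs.v *)
From HB Require Import structures.
From mathcomp Require Import all_boot all_order all_algebra.
From mathcomp Require Import boolp classical_sets.
From mathcomp Require Import mpoly.

Set Implicit Arguments.
Unset Strict Implicit.
Unset Printing Implicit Defensive.

Import GRing.Theory.
Local Open Scope ring_scope.

Record mps (k : nat) (R : Type) := MPS { pcoef : 'X_{1..k} -> R }.

HB.instance Definition _ k (R : Type) := gen_eqMixin (mps k R).
HB.instance Definition _ k (R : Type) := gen_choiceMixin (mps k R).

Lemma mpsP k (R : Type) (f g : mps k R) :
  (forall m, pcoef f m = pcoef g m) -> f = g.
Proof. by case: f g => [f] [g] /= /funext ->. Qed.

Section PowerSeriesRing.
Variables (k : nat) (R : comNzRingType).
Implicit Types f g h : mps k R.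

Definition mps_add f g := MPS (fun m => pcoef f m + pcoef g m).
Definition mps_opp f := MPS (fun m => - pcoef f m).
Definition mpsC (c : R) : mps k R := MPS (fun m => if m == 0%MM then c else 0).
Definition mps_mul f g := MPS (fun m =>
  \sum_(c : 'X_{1..k < (mdeg m).+1, (mdeg m).+1} | m == (c.1 + c.2)%MM)
    pcoef f c.1 * pcoef g c.2).
Definition mpsX (i : 'I_k) : mps k R :=
  MPS (fun m => if m == U_(i)%MM then 1 else 0).

Fact mps_addA : associative mps_add.
Proof. by move=> f g h; apply: mpsP => m /=; rewrite addrA. Qed.
Fact mps_addC : commutative mps_add.
Proof. by move=> f g; apply: mpsP => m /=; rewrite addrC. Qed.
Fact mps_add0 : left_id (MPS (fun=> 0)) mps_add.
Proof. by move=> f; apply: mpsP => m /=; rewrite add0r. Qed.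
Fact mps_addN : left_inverse (MPS (fun=> 0)) mps_opp mps_add.
Proof. by move=> f; apply: mpsP => m /=; rewrite addNr. Qed.

HB.instance Definition _ :=
  GRing.isZmodule.Build (mps k R) mps_addA mps_addC mps_add0 mps_addN.

Definition mps_trunc (N : nat) f : {mpoly R[k]} :=
  \sum_(m : 'X_{1..k < N}) (pcoef f m *: 'X_[m]).

Lemma mps_truncE N f m : (mdeg m < N)%N -> (mps_trunc N f)@_m = pcoef f m.
Proof. exact: mcoeff_mpoly. Qed.

Lemma mps_mul_trunc (P Q : {mpoly R[k]}) f g m :
    (forall a, (mdeg a <= mdeg m)%N -> P@_a = pcoef f a) ->
    (forall a, (mdeg a <= mdeg m)%N -> Q@_a = pcoef g a) ->
  (P * Q)@_m = pcoef (mps_mul f g) m.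
Proof.
move=> hP hQ; rewrite mcoeffM /=; apply: eq_bigr => c /eqP hc.
have h1 : (mdeg c.1 <= mdeg m)%N by rewrite [X in (_ <= mdeg X)%N]hc mdegD leq_addr.
have h2 : (mdeg c.2 <= mdeg m)%N by rewrite [X in (_ <= mdeg X)%N]hc mdegD leq_addl.
by rewrite hP ?hQ.
Qed.

Fact mps_mulA : associative mps_mul.
Proof.
move=> f g h; apply: mpsP => m.
pose T := mps_trunc (mdeg m).+1.
have hT e a : (mdeg a <= mdeg m)%N -> (T e)@_a = pcoef e a.
  by move=> ?; rewrite mps_truncE.
have hTT e e' a : (mdeg a <= mdeg m)%N -> (T e * T e')@_a = pcoef (mps_mul e e') a.
  by move=> ha; apply: mps_mul_trunc => b hb; apply: hT; apply: leq_trans ha.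
rewrite -(mps_mul_trunc (P := T f) (Q := T g * T h)) //; first last.
- exact: hTT.
- exact: hT.
rewrite mulrA; apply: mps_mul_trunc; [exact: hTT | exact: hT].
Qed.

Fact mps_mulC : commutative mps_mul.
Proof.
move=> f g; apply: mpsP => m.
have hT e a : (mdeg a <= mdeg m)%N ->
  (mps_trunc (mdeg m).+1 e)@_a = pcoef e a by move=> ?; rewrite mps_truncE.
rewrite -(mps_mul_trunc (hT f) (hT g)) mulrC.
exact: mps_mul_trunc (hT g) (hT f).
Qed.

Fact mps_mul1 : left_id (mpsC 1) mps_mul.
Proof.
move=> f; apply: mpsP => m.
have hT a : (mdeg a <= mdeg m)%N ->
  (mps_trunc (mdeg m).+1 f)@_a = pcoef f a by move=> ?; rewrite mps_truncE.
rewrite -(mps_mul_trunc (P := 1) _ hT) ?mul1r ?hT // => a _.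
by rewrite mcoeff1 /=; case: eqP.
Qed.

Fact mps_mulDl : left_distributive mps_mul +%R.
Proof.
move=> f g h; apply: mpsP => m /=; rewrite -big_split /=.
by apply: eq_bigr => c _; rewrite mulrDl.
Qed.

Fact mps_1neq0 : mpsC 1 != 0 :> mps k R.
Proof.
apply/eqP => /(congr1 (fun f => pcoef f 0%MM)) /= /eqP.
by rewrite eqxx oner_eq0.
Qed.

HB.instance Definition _ := GRing.Zmodule_isComNzRing.Build (mps k R)
  mps_mulA mps_mulC mps_mul1 mps_mulDl mps_1neq0.

Definition mps_unit : {pred mps k R} := [pred f | `[< exists g, g * f = 1 >]].
Definition mps_inv f : mps k R :=
  if f \in mps_unit then xget 0 [set g | g * f = 1]%classic else f.

Fact mps_mulVf : {in mps_unit, left_inverse 1 mps_inv *%R}.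
Proof.
move=> f uf; rewrite /mps_inv uf.
by move/asboolP: uf => [g hg]; case: xgetP => [e _ //|/(_ g)].
Qed.
Fact mps_unitPl f g : g * f = 1 -> f \in mps_unit.
Proof. by move=> hg; apply/asboolP; exists g. Qed.
Fact mps_inv_out : {in [predC mps_unit], mps_inv =1 id}.
Proof. by move=> f; rewrite inE /mps_inv => /negPf ->. Qed.

HB.instance Definition _ := GRing.ComNzRing_hasMulInverse.Build (mps k R)
  mps_mulVf mps_unitPl mps_inv_out.

End PowerSeriesRing.

Arguments mpsC {k R}.
Arguments mpsX {k R}.

Definition mps_map k (R S : Type) (j : R -> S) (f : mps k R) : mps k S :=
  MPS (fun m => j (pcoef f m)).

(* [f(g_0, ..., g_(k-1))]; meaningful when the [g_i] have no constant term,
   since then monomials of degree [> mdeg m] do not contribute to degree [m]. *)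
Definition mps_subst k l (R : comNzRingType) (f : mps k R) (g : 'I_k -> mps l R) :
    mps l R :=
  MPS (fun m => \sum_(a : 'X_{1..k < (mdeg m).+1})
         pcoef f a * pcoef (\prod_(i < k) g i ^+ (a : 'X_{1..k}) i) m).

Definition ps_comp l (R : comNzRingType) (f : mps 1 R) (g : mps l R) : mps l R :=
  mps_subst f (fun=> g).

Definition psX {R : comNzRingType} : mps 1 R := mpsX ord0.

Definition lead (R : Type) (f : mps 1 R) : R := pcoef f U_(ord0)%MM.

Fixpoint ideal_pow (R : comNzRingType) (I : R -> Prop) (k : nat) (x : R) : Prop :=
  if k is j.+1 then
    exists s : seq (R * R),
      (forall yz, yz \in s -> ideal_pow I j yz.1 /\ I yz.2)
      /\ x = \sum_(yz <- s) yz.1 * yz.2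
  else True.

Definition adic_cvg (R : comNzRingType) (I : R -> Prop) (u : nat -> R) (l : R) :=
  forall k, exists N, forall j, (N <= j)%N -> ideal_pow I k (u j - l).

Definition adic_lim (R : comNzRingType) (I : R -> Prop) (u : nat -> R) : R :=
  xget 0 [set l | adic_cvg I u l]%classic.

(* [a / b] in a ring where [b] is not a zero divisor and divides [a]. *)
Definition exact_quo (R : comNzRingType) (a b : R) : R :=
  xget 0 [set c | b * c = a]%classic.

Definition principal (R : comNzRingType) (a x : R) : Prop := exists y, x = a * y.

Definition fadd (R : comNzRingType) (G : mps 2 R) l (a b : mps l R) : mps l R :=
  mps_subst G (fun i : 'I_2 => if i == ord0 then a else b).

Definition fsum (R : comNzRingType) (G : mps 2 R) l (s : seq (mps l R)) : mps l R :=
  foldr (fadd G (l := l)) 0 s.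

Definition is_fgl (R : comNzRingType) (G : mps 2 R) : Prop :=
  [/\ fadd G psX 0 = psX,
      fadd G 0 psX = psX,
      (let x : mps 2 R := mpsX ord0 in let y := mpsX ord_max in
       fadd G x y = fadd G y x) &
      (let x : mps 3 R := mpsX ord0 in let y := mpsX (inord 1) in
       let z := mpsX ord_max in
       fadd G (fadd G x y) z = fadd G x (fadd G y z))].

Definition is_fgl_hom (R : comNzRingType) (G G' : mps 2 R) (f : mps 1 R) : Prop :=
  pcoef f 0%MM = 0
  /\ let x : mps 2 R := mpsX ord0 in let y := mpsX ord_max in
     ps_comp f (fadd G x y) = fadd G' (ps_comp f x) (ps_comp f y).

Definition is_fgl_iso (R : comNzRingType) (G G' : mps 2 R) (f : mps 1 R) : Prop :=
  is_fgl_hom G G' f /\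
  exists f', [/\ is_fgl_hom G' G f', ps_comp f f' = psX & ps_comp f' f = psX].

Definition p_series (R : comNzRingType) (p : nat) (G : mps 2 R) : mps 1 R :=
  fsum G (nseq p psX).

(* Cartier's definition: for every prime [q != p] the Frobenius operator [f_q]
   kills the curve [x], i.e. the formal sum of the [z^i x], [i < q], vanishes
   over [R[z]/(1 + z + ... + z^(q-1))].  That algebra is universal among the
   [R]-algebras [S] with a root [z] of [1 + z + ... + z^(q-1)]. *)
Definition p_typical (R : comNzRingType) (p : nat) (G : mps 2 R) : Prop :=
  forall q : nat, prime q -> q != p ->
  forall (S : comNzRingType) (j : {rmorphism R -> S}) (z : S),
    \sum_(i < q) z ^+ i = 0 ->
    fsum (mps_map j G) [seq mpsC (z ^+ i) * psX | i <- iota 0 q] = 0.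

(* Serre, Local Fields, II.5: [W(F)] is the strict p-ring with residue ring [F],
   i.e. [p] is not a zero divisor, [W] is separated and complete for the p-adic
   topology, and [W/pW = F]; it is unique up to unique isomorphism over [F]. *)
Definition is_witt (p : nat) (F W : comNzRingType) (res : {rmorphism W -> F}) : Prop :=
  [/\ forall x : W, p%:R * x = 0 -> x = 0,
      forall x : W, (forall k, principal (p%:R ^+ k) x) -> x = 0,
      forall w : nat -> W,
        (forall k, principal (p%:R ^+ k) (w k.+1 - w k)) ->
        exists l, forall k, principal (p%:R ^+ k) (w k - l),
      forall a : F, exists x, res x = a &
      forall x : W, res x = 0 <-> principal p%:R x].

Definition is_frobenius_lift (p : nat) (F W : comNzRingType)
    (res : {rmorphism W -> F}) (phi : W -> W) : Prop :=
  forall x, res (phi x) = res x ^+ p.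

(* A ring endomorphism of a finite field is an automorphism and fixes the prime
   field, so this type is [Gal(F/F_p)]. *)
Definition gal (F : finFieldType) := {rmorphism F -> F}.

Definition is_gal_action (F : finFieldType) (W : comNzRingType)
    (res : {rmorphism W -> F}) (galW : gal F -> {rmorphism W -> W}) : Prop :=
  forall s x, res (galW s x) = s (res x).

Definition teichmuller (F : finFieldType) (W : comNzRingType)
    (res : {rmorphism W -> F}) (a : F) : W :=
  xget 0 [set w | res w = a /\ w ^+ #|F| = w]%classic.

Definition is_honda (p n : nat) (F : comNzRingType) (H : mps 2 F) : Prop :=
  [/\ is_fgl H, p_typical p H & p_series p H = psX ^+ (p ^ n)].

(* [rho] is the restriction to [W] of the isomorphism
   [W<S>/(S^n - p, S a = a^phi S) -> End(H)], [S |-> x^p]; the Teichmueller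
   lift of [a : F] goes to [a x]. *)
Definition is_witt_mult (F : finFieldType) (W : comNzRingType)
    (res : {rmorphism W -> F}) (H : mps 2 F) (rho : W -> mps 1 F) : Prop :=
  [/\ forall a, is_fgl_hom H H (rho a),
      forall a b, rho (a + b) = fadd H (rho a) (rho b),
      forall a b, rho (a * b) = ps_comp (rho a) (rho b) &
      forall a : F, rho (teichmuller res a) = mpsC a * psX].

(* [g = a_0 + a_1 S + ... + a_(n-1) S^(n-1)] in [End(H)]. *)
Definition is_coord (p n : nat) (F W : comNzRingType) (H : mps 2 F)
    (rho : W -> mps 1 F) (g : mps 1 F) (a : 'I_n -> W) : Prop :=
  g = fsum H [seq ps_comp (rho (a i)) (psX ^+ (p ^ i)) | i <- enum 'I_n].

(* Column [j] lists the coordinates of [S^j g], computed from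
   [S^j a_k S^k = phi^j(a_k) S^(k + j)] and [S^n = p]. *)
Definition coord_matrix (p n : nat) (W : comNzRingType) (phi : W -> W)
    (a : 'I_n -> W) : 'M[W]_n :=
  \matrix_(i < n, j < n)
    \sum_(k < n | ((k + j) %% n == i)%N) p%:R ^+ ((k + j) %/ n)%N * iter j phi (a k).

Definition detW (p n : nat) (F W : comNzRingType) (phi : W -> W)
    (a : mps 1 F -> 'I_n -> W) (g : mps 1 F) : W :=
  \det (coord_matrix p phi (a g)).

Definition rexp (p n : nat) : nat := ((p ^ n).-1 %/ p.-1)%N.

Definition theta (p n : nat) (F : finFieldType) (W : comUnitRingType)
    (res : {rmorphism W -> F}) (phi : W -> W) (a : mps 1 F -> 'I_n -> W)
    (g : mps 1 F) : W :=
  (teichmuller res (lead g ^+ rexp p n))^-1 * detW p phi a g.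

(* The p-adic logarithm on [1 + pW]; its terms are divisible in [W]. *)
Definition plog (p : nat) (W : comNzRingType) (x : W) : W :=
  adic_lim (principal p%:R) (fun N =>
    \sum_(1 <= m < N) exact_quo ((-1) ^+ m.+1 * (x - 1) ^+ m) m%:R).

Definition zetaW (p n : nat) (F : finFieldType) (W : comUnitRingType)
    (res : {rmorphism W -> F}) (phi : W -> W) (a : mps 1 F -> 'I_n -> W)
    (g : mps 1 F) : W :=
  exact_quo (plog p (theta p res phi a g)) p%:R.

Notation E0 n W := (mps n.-1 W).

(* The variable [mpsX i] is [u_(i+1)]. *)
Definition maxideal (p n : nat) (W : comNzRingType) (x : E0 n W) : Prop :=
  exists y (z : 'I_(n.-1) -> E0 n W), x = p%:R * y + \sum_i mpsX i * z i.

Definition residue n (F W : comNzRingType) (res : W -> F) (x : E0 n W) : F :=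
  res (pcoef x 0%MM).

Definition is_lubin_tate (p n : nat) (W : comNzRingType) (G : mps 2 (E0 n W)) : Prop :=
  [/\ is_fgl G, p_typical p G &
      p_series p G =
        fsum G (mpsC p%:R * psX
          :: rcons [seq mpsC (mpsX i) * psX ^+ (p ^ i.+1) | i <- enum 'I_(n.-1)]
                   (psX ^+ (p ^ n)))].

Definition is_continuous_W_map (p n : nat) (W : comNzRingType)
    (f : E0 n W -> E0 n W) : Prop :=
  (forall w, f (mpsC w) = mpsC w) /\
  forall k, exists N, forall x y,
    ideal_pow (@maxideal p n W) N (x - y) ->
    ideal_pow (@maxideal p n W) k (f x - f y).

(* [phi] and [psi] are the ring map [phi_g] and the isomorphism
   [psi_g = h o f : (phi_g)_* G -> G] obtained from some lift [h] of [g]. *)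
Definition is_deformation_of (p n : nat) (F W : comNzRingType)
    (res : {rmorphism W -> F}) (G : mps 2 (E0 n W)) (g : mps 1 F)
    (phi : E0 n W -> E0 n W) (psi : mps 1 (E0 n W)) : Prop :=
  is_continuous_W_map p phi /\
  exists (h f : mps 1 (E0 n W)) (Gh : mps 2 (E0 n W)),
    [/\ mps_map (residue res) h = g,
        is_fgl Gh /\ is_fgl_iso Gh G h,
        is_fgl_iso (mps_map phi G) Gh f,
        forall m, maxideal p (pcoef f m - pcoef psX m) &
        psi = ps_comp h f].

Definition stab (F : finFieldType) : Type := mps 1 F * gal F.

Definition in_stab (F : finFieldType) (H : mps 2 F) (x : stab F) : Prop :=
  is_fgl_iso H H x.1.

Definition stab_mul (F : finFieldType) (x y : stab F) : stab F :=
  (ps_comp x.1 (mps_map x.2 y.1), x.2 \o y.2 : {rmorphism F -> F}).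

Definition stab_act n (F : finFieldType) (W : comNzRingType)
    (galW : gal F -> {rmorphism W -> W}) (phi : mps 1 F -> {rmorphism E0 n W -> E0 n W})
    (x : stab F) (e : E0 n W) : E0 n W :=
  phi x.1 (mps_map (galW x.2) e).

(* [S_n] carries the topology of coefficientwise convergence, [Gal] the discrete
   one, and [E_0] the topology defined by the powers of its maximal ideal. *)
Definition is_continuous_cochain (p n : nat) (F : finFieldType) (W : comNzRingType)
    (H : mps 2 F) (c : stab F -> E0 n W) : Prop :=
  forall k x, in_stab H x -> exists N, forall y, in_stab H y -> y.2 =1 x.2 ->
    (forall m, (mdeg m < N)%N -> pcoef y.1 m = pcoef x.1 m) ->
    ideal_pow (@maxideal p n W) k (c y - c x).

(* The coefficient group is the subset [A] of [E_0] with the law [op]: [(E_0, +)]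
   or the units with multiplication.  Classes in [H^1] are represented by
   continuous crossed homomorphisms. *)
Definition is_cocycle (p n : nat) (F : finFieldType) (W : comNzRingType)
    (H : mps 2 F) (act : stab F -> E0 n W -> E0 n W)
    (A : E0 n W -> Prop) (op : E0 n W -> E0 n W -> E0 n W)
    (c : stab F -> E0 n W) : Prop :=
  [/\ forall x, in_stab H x -> A (c x),
      is_continuous_cochain p H c &
      forall x y, in_stab H x -> in_stab H y ->
        c (stab_mul x y) = op (c x) (act x (c y))].

Definition cohomologous (p n : nat) (F : finFieldType) (W : comNzRingType)
    (H : mps 2 F) (act : stab F -> E0 n W -> E0 n W)
    (A : E0 n W -> Prop) (op : E0 n W -> E0 n W -> E0 n W)
    (c d : stab F -> E0 n W) : Prop :=
  [/\ is_cocycle p H act A op c,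
      is_cocycle p H act A op d &
      exists e, A e /\ forall x, in_stab H x -> op (c x) e = op (d x) (act x e)].

Definition is_Z1_add p n F W H act c :=
  @is_cocycle p n F W H act (fun=> True) +%R c.

Definition eq_H1_mul p n F W H act c d :=
  @cohomologous p n F W H act (fun e => e \is a GRing.unit) *%R c d.

Definition pexp (p n : nat) (W : comNzRingType) (x : E0 n W) : E0 n W :=
  adic_lim (@maxideal p n W) (fun N =>
    \sum_(m < N) exact_quo (p%:R ^+ m * x ^+ m) m`!%:R).

Definition zlim_mod (p n k : nat) : nat := (p ^ k * (p ^ n).-1)%N.

(* The inverse limit, by compatible sequences of integer representatives. *)
Record zlim (p n : nat) := ZLim {
  zlim_seq :> nat -> int;
  zlim_compat : forall k, (zlim_seq k.+1 = zlim_seq k %[mod (zlim_mod p n k)%:Z])%Z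
}.

Fact zlim_opp_compat p n (a : zlim p n) k :
  (- a k.+1 = - a k %[mod (zlim_mod p n k)%:Z])%Z.
Proof. by rewrite -modzNm zlim_compat modzNm. Qed.

Definition zlim_opp p n (a : zlim p n) : zlim p n :=
  ZLim (zlim_opp_compat a).

Definition zlim_pow (p n : nat) (W : comNzRingType) (x : E0 n W) (a : zlim p n) :
    E0 n W :=
  adic_lim (@maxideal p n W) (fun k => x ^ (a k)).

Fact lambda_compat p n k :
  ((p ^ (n * k.+1) * rexp p n)%N%:Z
    = (p ^ (n * k) * rexp p n)%N%:Z %[mod (zlim_mod p n k)%:Z])%Z.
Proof.
apply/eqP; rewrite eqz_mod_dvd; case: (posnP (p ^ n)) => [pn0|pn_gt0].
  by rewrite /rexp pn0 /= div0n !muln0 subrr dvdz0.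
have -> : (p ^ (n * k.+1) * rexp p n)%N%:Z - (p ^ (n * k) * rexp p n)%N%:Z
    = ((p ^ (n * k) * rexp p n) * (p ^ n).-1)%N%:Z.
  rewrite mulnS expnD; set a := (p ^ (n * k))%N; set r := rexp p n.
  rewrite -[in LHS](prednK pn_gt0) mulSn !mulnDl PoszD addrAC subrr add0r.
  by congr Posz; rewrite -mulnA mulnC.
rewrite dvdzE /= /zlim_mod; case: n pn_gt0 => [|n] _; first by rewrite expn0 !muln0.
by apply: dvdn_mul => //; apply: dvdn_mulr; apply: dvdn_exp2l; rewrite leq_pmull.
Qed.

(* [lambda] has the coordinate [p^(nk) r(n)] modulo [p^(nk)(p^n - 1)], hence
   also modulo the divisor [p^k(p^n - 1)]. *)
Definition lambda p n : zlim p n := ZLim (@lambda_compat p n).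

(* Main.v *)
Require Import Defs.
From HB Require Import structures.
From mathcomp Require Import all_boot all_order all_algebra.
From mathcomp Require Import mpoly.
From mathcomp Require Import boolp classical_sets.
From mathcomp Require Import zify ring closed_field finfield perm.

(** The two crossed homomorphisms agree as functions, so that the cohomology
    between them is witnessed by the unit [1].

    On the left, [log] and [exp] are inverse to each other between [1 + p W] and
    [p W] for odd [p] ([wexp_plog]), hence [exp (p zeta(g))] is [theta(g)], which
    is [tau(g'(0))^(-r(n)) det(g)] with [tau] the Teichmueller lift.  On the
    right, [psi_g = h f] with [h] a lift of [g] and [f] congruent to the
    identity, so [t_0(g)] is a lift of [g'(0)], that is, [tau(g'(0)) (1 + y)] with
    [y] in the maximal ideal.  Raising to the power [p ^ (n k)] fixes
    [tau(g'(0))] and moves [1 + y] towards [1]; in the limit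
    [t_0(g) ^ lambda = tau(g'(0)) ^ r(n)] ([zlim_pow_lambda]).

    What remains is that these functions are continuous crossed homomorphisms,
    which amounts to [det] being a continuous homomorphism on the
    group of pairs [(g, s)], with values in the units of [Z_p].
    - An endomorphism determines its coordinates, and does so continuously
      ([endo_dvdB]), since [p] acts as [x ^ (p ^ n)].  Identities between
      coordinates can therefore be checked on endomorphisms.  This makes
      [g |-> A(g)] antimultiplicative ([coord_matrix_comp]) and yields
      [A(g) A(S) = A(S) A(g)^phi] ([coord_matrix_frob]), so that [det A(g)] is
      fixed by the Frobenius and then by the whole Galois group ([frob_fixed]).
    - The Galois group acts on [S_n] only because the coefficients of [H_n] are
      fixed by it.  This is the uniqueness of the Honda formal group law
      ([honda_unique]): the lowest term in which two candidates differ is a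
      symmetric cocycle, homogeneous of some degree [m].  If a prime [q] other
      than [p] divides [m], typicality at [q] kills it; if [m] is a power of [p],
      the equality of the [p]-series kills it.
    - The logarithm is additive because [log th] is the limit of
      [(th ^ (p ^ k) - 1) / p ^ k] ([plog_lim], [plogM]). *)

Set Implicit Arguments.
Unset Strict Implicit.
Unset Printing Implicit Defensive.

Import GRing.Theory.
Local Open Scope ring_scope.

(** * Power series in several variables *)
Arguments pcoef : simpl never.

Section Coefficients.
Variables (k : nat) (R : comNzRingType).
Implicit Types f g : mps k R.

Lemma pcoefD f g m : pcoef (f + g) m = pcoef f m + pcoef g m.
Proof. by []. Qed.
Lemma pcoefN f m : pcoef (- f) m = - pcoef f m.
Proof. by []. Qed.
Lemma pcoefB f g m : pcoef (f - g) m = pcoef f m - pcoef g m.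
Proof. by []. Qed.
Lemma pcoef0 m : pcoef (0 : mps k R) m = 0.
Proof. by []. Qed.
Lemma pcoefC c m : pcoef (mpsC c : mps k R) m = if m == 0%MM then c else 0.
Proof. by []. Qed.
Lemma pcoef1 m : pcoef (1 : mps k R) m = if m == 0%MM then 1 else 0.
Proof. by []. Qed.

Lemma pcoef_mpsX i m :
  pcoef (mpsX i : mps k R) m = if m == U_(i)%MM then 1 else 0.
Proof. by []. Qed.

Lemma pcoef_sum I (r : seq I) (P : pred I) (h : I -> mps k R) m :
  pcoef (\sum_(i <- r | P i) h i) m = \sum_(i <- r | P i) pcoef (h i) m.
Proof. by elim/big_rec2: _ => // i x y _ <-. Qed.

Lemma pcoefM_mpoly (P Q : {mpoly R[k]}) f g m :
    (forall a, (mdeg a <= mdeg m)%N -> P@_a = pcoef f a) ->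
    (forall a, (mdeg a <= mdeg m)%N -> Q@_a = pcoef g a) ->
  pcoef (f * g) m = (P * Q)@_m.
Proof. by move=> hP hQ; rewrite (mps_mul_trunc hP hQ). Qed.

Lemma mps_truncE_le f N a : (mdeg a <= N)%N -> (mps_trunc N.+1 f)@_a = pcoef f a.
Proof. by move=> ?; rewrite mps_truncE. Qed.

Lemma pcoefCM c f m : pcoef (mpsC c * f) m = c * pcoef f m.
Proof.
rewrite (pcoefM_mpoly (P := c%:MP) _ (@mps_truncE_le f (mdeg m))).
  by rewrite mcoeffCM mps_truncE_le.
by move=> a _; rewrite mcoeffC pcoefC; case: eqP => _; rewrite ?mulr1 ?mulr0.
Qed.

Lemma pcoefXM i f m :
  pcoef (mpsX i * f) m = if m i is 0 then 0 else pcoef f (m - U_(i))%MM.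
Proof.
case E: (m i) => [|j].
  apply: big1 => c /eqP hc; rewrite pcoef_mpsX; case: eqP => [e|_]; last by rewrite mul0r.
  by move: (congr1 (fun a : 'X_{1..k} => a i) hc); rewrite E mnmDE e mnm1E eqxx.
rewrite (pcoefM_mpoly (P := 'X_i) _ (@mps_truncE_le f (mdeg m))); last first.
  by move=> a _; rewrite mcoeffX pcoef_mpsX eq_sym; case: eqP.
have le : (U_(i) <= m)%MM.
  by apply/mnm_lepP => l; rewrite mnm1E; case: eqP => // <-; rewrite E.
rewrite mulrC -{1}(submK le) addmC mcoeffMX mps_truncE_le //.
exact: mdegB.
Qed.

End Coefficients.

Fact mpsC_zmod_morphism k (R : comNzRingType) : zmod_morphism (@mpsC k R).
Proof.
by move=> a b; apply: mpsP => m; rewrite pcoefB !pcoefC; case: eqP; rewrite ?subr0.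
Qed.

HB.instance Definition _ k (R : comNzRingType) :=
  GRing.isZmodMorphism.Build R (mps k R) (@mpsC k R)
    (@mpsC_zmod_morphism k R).

Fact mpsC_monoid_morphism k (R : comNzRingType) :
  monoid_morphism (@mpsC k R).
Proof.
split=> // a b; apply: mpsP => m.
by rewrite pcoefCM !pcoefC; case: eqP; rewrite ?mulr0.
Qed.

HB.instance Definition _ k (R : comNzRingType) :=
  GRing.isMonoidMorphism.Build R (mps k R) (@mpsC k R)
    (@mpsC_monoid_morphism k R).

(** * Order of vanishing and congruence modulo a degree *)

Section Degree.
Variables (k : nat) (R : comNzRingType).
Implicit Types f g : mps k R.

Definition vdeg N f := forall m, (mdeg m < N)%N -> pcoef f m = 0.
Definition eqdeg N f g := forall m, (mdeg m < N)%N -> pcoef f m = pcoef g m.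

Lemma eqdegB N f g : eqdeg N f g <-> vdeg N (f - g).
Proof.
split=> h m hm; first by rewrite pcoefB h // subrr.
by apply/eqP; rewrite -subr_eq0 -pcoefB h.
Qed.

Lemma eqdeg_refl N f : eqdeg N f f. Proof. by []. Qed.
Lemma eqdeg_sym N f g : eqdeg N f g -> eqdeg N g f.
Proof. by move=> h m hm; rewrite h. Qed.
Lemma eqdeg_le N N' f g : (N' <= N)%N -> eqdeg N f g -> eqdeg N' f g.
Proof. by move=> le h m hm; apply: h; apply: leq_trans le. Qed.
Lemma eqdeg_eq f g : (forall N, eqdeg N f g) -> f = g.
Proof. by move=> h; apply: mpsP => m; apply: (h (mdeg m).+1). Qed.

Lemma vdeg_le N N' f : (N' <= N)%N -> vdeg N f -> vdeg N' f.
Proof. by move=> le h m hm; apply: h; apply: leq_trans le. Qed.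
Lemma vdeg_0 f : vdeg 0 f. Proof. by []. Qed.
Lemma vdeg0 N : vdeg N (0 : mps k R). Proof. by []. Qed.
Lemma vdegD N f g : vdeg N f -> vdeg N g -> vdeg N (f + g).
Proof. by move=> h1 h2 m hm; rewrite pcoefD h1 ?h2 ?addr0. Qed.
Lemma vdegB N f g : vdeg N f -> vdeg N g -> vdeg N (f - g).
Proof. by move=> h1 h2 m hm; rewrite pcoefB h1 ?h2 ?subr0. Qed.
Lemma vdeg_sum N I (r : seq I) (P : pred I) (h : I -> mps k R) :
  (forall i, P i -> vdeg N (h i)) -> vdeg N (\sum_(i <- r | P i) h i).
Proof.
by move=> hh; elim/big_rec: _ => [|i x Pi hx]; [exact: vdeg0|exact: vdegD (hh i Pi) hx].
Qed.

Lemma vdegM a b f g : vdeg a f -> vdeg b g -> vdeg (a + b) (f * g).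
Proof.
move=> hf hg m hm; apply: big1 => c /eqP hc.
case: (ltnP (mdeg c.1) a) => h1; first by rewrite hf ?mul0r.
case: (ltnP (mdeg c.2) b) => h2; first by rewrite hg ?mulr0.
have e : mdeg m = (mdeg c.1 + mdeg c.2)%N by rewrite -mdegD -hc.
by exfalso; lia.
Qed.
Lemma vdegMl a f g : vdeg a g -> vdeg a (f * g).
Proof. exact: (@vdegM 0). Qed.
Lemma vdegMr a f g : vdeg a f -> vdeg a (f * g).
Proof. by move=> h; rewrite mulrC; apply: vdegMl. Qed.

Lemma vdegX a n f : vdeg a f -> vdeg (a * n) (f ^+ n).
Proof.
move=> h; elim: n => [|n IH]; first by rewrite muln0.
by rewrite exprS mulnS; apply: vdegM.
Qed.

Lemma vdeg_mpsX i : vdeg 1 (mpsX i : mps k R).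
Proof.
move=> m; rewrite ltnS leqn0 mdeg_eq0 => /eqP ->.
by rewrite pcoef_mpsX eq_sym mnm1_eq0.
Qed.

Lemma vdeg1P f : vdeg 1 f <-> pcoef f 0%MM = 0.
Proof.
split=> [h|h m]; first by apply: h; rewrite mdeg0.
by rewrite ltnS leqn0 mdeg_eq0 => /eqP ->.
Qed.

Lemma eqdegD N f f' g g' :
  eqdeg N f f' -> eqdeg N g g' -> eqdeg N (f + g) (f' + g').
Proof. by move=> h1 h2 m hm; rewrite !pcoefD h1 ?h2. Qed.

Lemma eqdegM N f f' g g' :
  eqdeg N f f' -> eqdeg N g g' -> eqdeg N (f * g) (f' * g').
Proof.
move=> /eqdegB h1 /eqdegB h2; apply/eqdegB.
have -> : f * g - f' * g' = (f - f') * g + f' * (g - g').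
  by rewrite mulrBl mulrBr addrA subrK.
by apply: vdegD; [apply: vdegMr | apply: vdegMl].
Qed.

(** One degree is gained when the factors have no constant term. *)
Lemma eqdegMS N f f' g g' : vdeg 1 f' -> vdeg 1 g ->
  eqdeg N f f' -> eqdeg N g g' -> eqdeg N.+1 (f * g) (f' * g').
Proof.
move=> f0 g0 /eqdegB h1 /eqdegB h2; apply/eqdegB.
have -> : f * g - f' * g' = (f - f') * g + f' * (g - g').
  by rewrite mulrBl mulrBr addrA subrK.
apply: vdegD; first by rewrite -addn1; apply: vdegM.
by rewrite -add1n; apply: vdegM.
Qed.

Lemma eqdegX N n f f' : eqdeg N f f' -> eqdeg N (f ^+ n) (f' ^+ n).
Proof. by move=> h; elim: n => // n IH; rewrite !exprS; apply: eqdegM. Qed.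

End Degree.
Arguments eqdeg_refl {k R N f}.

(** * Substitution *)

Section Mmap1.
Variables (k l : nat) (R : comNzRingType).
Implicit Types g h : 'I_k -> mps l R.

Lemma mmap1D g (a b : 'X_{1..k}) : mmap1 g (a + b) = mmap1 g a * mmap1 g b.
Proof.
rewrite /mmap1 -big_split /=; apply: eq_bigr => i _.
by rewrite mnmDE exprD.
Qed.

Lemma vdeg_mmap1 g (a : 'X_{1..k}) :
  (forall i, vdeg 1 (g i)) -> vdeg (mdeg a) (mmap1 g a).
Proof.
move=> g0; rewrite mdegE /mmap1.
elim/big_rec2: _ => [|i x y _ h]; first exact: vdeg_0.
by rewrite addnC mulrC; apply: vdegM => //; have := @vdegX _ _ 1 (a i) _ (g0 i); rewrite mul1n.
Qed.

Lemma eqdeg_mmap1 N g h (a : 'X_{1..k}) :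
  (forall i, eqdeg N (g i) (h i)) -> eqdeg N (mmap1 g a) (mmap1 h a).
Proof.
move=> gh; rewrite /mmap1; elim/big_rec2: _ => [|i x y _ e]; first exact: eqdeg_refl.
by apply: eqdegM => //; apply: eqdegX.
Qed.

(** A monomial of degree at least two is a product of two factors without constant
    term. *)
Lemma eqdegS_mmap1 N g h (a : 'X_{1..k}) :
  (forall i, vdeg 1 (g i)) -> (forall i, vdeg 1 (h i)) ->
  (forall i, eqdeg N (g i) (h i)) -> (1 < mdeg a)%N ->
  eqdeg N.+1 (mmap1 g a) (mmap1 h a).
Proof.
move=> g0 h0 gh a1.
have [i ai] : exists i, a i != 0%N.
  apply/existsP; rewrite -negb_forall; apply/negP => /forallP e.
  by move: a1; rewrite mdegE big1 // => i _; apply/eqP.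
have le : (U_(i) <= a)%MM.
  by apply/mnm_lepP => j; rewrite mnm1E; case: eqP => // <-; rewrite lt0n.
have E := submK le; move: a1; rewrite -E mdegD mdeg1 addn1 ltnS => a1.
rewrite addmC !mmap1D !mmap1U; apply: eqdegMS => //.
  by apply: vdeg_le (vdeg_mmap1 g0).
exact: eqdeg_mmap1.
Qed.
End Mmap1.

Section Substitution.
Variables (k l : nat) (R : comNzRingType).
Implicit Types (f : mps k R) (g h : 'I_k -> mps l R).

Lemma pcoef_substE f g m : pcoef (mps_subst f g) m =
  \sum_(a : 'X_{1..k < (mdeg m).+1}) pcoef f a * pcoef (mmap1 g a) m.
Proof. by []. Qed.

Lemma pcoef_subst_trunc f g m : pcoef (mps_subst f g) m =
  pcoef (mmap mpsC g (mps_trunc (mdeg m).+1 f)) m.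
Proof.
rewrite pcoef_substE /mps_trunc raddf_sum pcoef_sum; apply: eq_bigr => a _ /=.
by rewrite mmapZ mmapX pcoefCM.
Qed.

Lemma vdeg_mmap (P : {mpoly R[k]}) g N : (forall i, vdeg 1 (g i)) ->
  (forall a, (mdeg a < N)%N -> P@_a = 0) -> vdeg N (mmap mpsC g P).
Proof.
move=> g0 h; rewrite /mmap big_seq; apply: vdeg_sum => a ha.
case: (ltnP (mdeg a) N) => e.
  by move: ha; rewrite mcoeff_msupp h ?eqxx.
by apply: vdegMl; apply: vdeg_le (vdeg_mmap1 g0).
Qed.

(** Only the monomials of degree at most [mdeg m] contribute to the coefficient
    of [m], so a substitution is computed by evaluating any polynomial that
    agrees with the series up to that degree.  All the algebraic properties of
    substitution reduce to those of polynomial evaluation. *)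
Lemma pcoef_subst (P : {mpoly R[k]}) f g m : (forall i, vdeg 1 (g i)) ->
  (forall a, (mdeg a <= mdeg m)%N -> P@_a = pcoef f a) ->
  pcoef (mps_subst f g) m = pcoef (mmap mpsC g P) m.
Proof.
move=> g0 h; rewrite pcoef_subst_trunc.
apply/eqP; rewrite -subr_eq0 -pcoefB -mmapB.
rewrite (@vdeg_mmap _ _ (mdeg m).+1) // => a ha.
by rewrite mcoeffB mps_truncE // h // subrr.
Qed.

Lemma substD f f' g : mps_subst (f + f') g = mps_subst f g + mps_subst f' g.
Proof.
apply: mpsP => m; rewrite pcoefD !pcoef_substE -big_split /=.
by apply: eq_bigr => a _; rewrite mulrDl.
Qed.

Lemma substN f g : mps_subst (- f) g = - mps_subst f g.
Proof.
apply: mpsP => m; rewrite pcoefN !pcoef_substE -sumrN.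
by apply: eq_bigr => a _; rewrite mulNr.
Qed.

Lemma substB f f' g : mps_subst (f - f') g = mps_subst f g - mps_subst f' g.
Proof. by rewrite substD substN. Qed.

Lemma subst0 g : mps_subst 0 g = 0.
Proof.
by apply: mpsP => m; rewrite pcoef_substE big1 // => a _; rewrite mul0r.
Qed.

Lemma vdeg_subst N f g : (forall i, vdeg 1 (g i)) -> vdeg N f ->
  vdeg N (mps_subst f g).
Proof.
move=> g0 hf m hm; rewrite pcoef_substE big1 // => a _.
by rewrite hf ?mul0r //; apply: leq_trans hm; apply: bmdeg.
Qed.

Lemma vdeg_substr N M f g : (forall i, vdeg M (g i)) -> vdeg N f ->
  vdeg (N * M) (mps_subst f g).
Proof.
move=> g0 hf m hm; rewrite pcoef_substE big1 // => a _.
case: (ltnP (mdeg (a : 'X_{1..k})) N) => h; first by rewrite hf ?mul0r.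
suff e : vdeg (mdeg (a : 'X_{1..k}) * M) (mmap1 g a).
  by rewrite e ?mulr0 //; apply: leq_trans hm _; rewrite leq_mul2r h orbT.
rewrite mdegE /mmap1 big_distrl /=.
elim/big_rec2: _ => [|i x y _ IH]; first exact: vdeg_0.
by rewrite addnC mulrC; apply: vdegM => //; rewrite mulnC; apply: vdegX.
Qed.

Lemma eqdeg_subst N f f' g g' : (forall i, vdeg 1 (g i)) ->
  eqdeg N f f' -> (forall i, eqdeg N (g i) (g' i)) ->
  eqdeg N (mps_subst f g) (mps_subst f' g').
Proof.
move=> g0 hf hg m hm; rewrite !pcoef_substE; apply: eq_bigr => a _.
rewrite hf; last exact: leq_trans (bmdeg a) hm.
by congr (_ * _); apply: eqdeg_mmap1 hm.
Qed.

Section Ring.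
Variable g : 'I_k -> mps l R.
Hypothesis g0 : forall i, vdeg 1 (g i).

Lemma substC c : mps_subst (mpsC c) g = mpsC c.
Proof.
apply: mpsP => m; rewrite (@pcoef_subst c%:MP) ?mmapC // => a _.
by rewrite mcoeffC pcoefC; case: eqP; rewrite ?mulr1 ?mulr0.
Qed.

Lemma subst1 : mps_subst 1 g = 1.
Proof. exact: (substC 1). Qed.

Lemma substX i : mps_subst (mpsX i) g = g i.
Proof.
apply: mpsP => m; rewrite (@pcoef_subst 'X_i) ?mmapX ?mmap1U // => a _.
by rewrite mcoeffX pcoef_mpsX eq_sym; case: eqP.
Qed.

Lemma substM f f' : mps_subst (f * f') g = mps_subst f g * mps_subst f' g.
Proof.
apply: mpsP => m; pose T (e : mps k R) := mps_trunc (mdeg m).+1 e.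
have TE e a : (mdeg a <= mdeg m)%N -> (T e)@_a = pcoef e a.
  exact: mps_truncE_le.
rewrite (@pcoef_subst (T f * T f')) //; last first.
  by move=> a ha; rewrite (pcoefM_mpoly (P := T f) (Q := T f')) // => b hb;
    apply: TE; apply: leq_trans ha.
rewrite rmorphM /=.
have h e : eqdeg (mdeg m).+1 (mmap mpsC g (T e)) (mps_subst e g).
  move=> a ha; rewrite (@pcoef_subst (T e)) // => b hb.
  by apply: TE; apply: leq_trans hb _.
exact: (eqdegM (h f) (h f')).
Qed.

Lemma substXn f n : mps_subst (f ^+ n) g = mps_subst f g ^+ n.
Proof. by elim: n => [|n IH]; rewrite ?expr0 ?subst1 // !exprS substM IH. Qed.

Lemma subst_sum I (r : seq I) (P : pred I) (F : I -> mps k R) :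
  mps_subst (\sum_(i <- r | P i) F i) g = \sum_(i <- r | P i) mps_subst (F i) g.
Proof. by elim/big_rec2: _ => [|i x y _ <-]; rewrite ?subst0 ?substD. Qed.

Lemma subst_prod I (r : seq I) (P : pred I) (F : I -> mps k R) :
  mps_subst (\prod_(i <- r | P i) F i) g = \prod_(i <- r | P i) mps_subst (F i) g.
Proof. by elim/big_rec2: _ => [|i x y _ <-]; rewrite ?subst1 ?substM. Qed.

End Ring.
End Substitution.

Lemma eq_subst k l (R : comNzRingType) (f : mps k R) (g g' : 'I_k -> mps l R) :
  g =1 g' -> mps_subst f g = mps_subst f g'.
Proof. by move=> /funext ->. Qed.

(** By the multiplicativity of the substitution of [h], the claim holds for a
    polynomial [f]; truncate [f] above the degree under consideration. *)
Lemma subst_comp k l l' (R : comNzRingType) (f : mps k R) (g : 'I_k -> mps l R)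
    (h : 'I_l -> mps l' R) :
  (forall i, vdeg 1 (g i)) -> (forall i, vdeg 1 (h i)) ->
  mps_subst (mps_subst f g) h = mps_subst f (fun i => mps_subst (g i) h).
Proof.
move=> g0 h0; apply: mpsP => m; pose P := mps_trunc (mdeg m).+1 f.
have gh0 i : vdeg 1 (mps_subst (g i) h) by apply: vdeg_subst.
have PE a : (mdeg a <= mdeg m)%N -> P@_a = pcoef f a by apply: mps_truncE_le.
rewrite (pcoef_subst gh0 PE).
have e : eqdeg (mdeg m).+1 (mps_subst f g) (mmap mpsC g P).
  by move=> a ha; rewrite (@pcoef_subst _ _ _ P) // => b hb; apply: PE;
    apply: leq_trans hb _.
rewrite (@eqdeg_subst _ _ _ _ _ _ h h h0 e (fun i => eqdeg_refl)) //.
rewrite /mmap subst_sum; congr (pcoef _ m); apply: eq_bigr => a _.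
rewrite substM // substC // /mmap1 subst_prod //; congr (_ * _).
by apply: eq_bigr => i _; rewrite substXn.
Qed.

Section Map.
Variables (R S : comNzRingType) (j : {rmorphism R -> S}).

Lemma pcoef_map k (f : mps k R) m : pcoef (mps_map j f) m = j (pcoef f m).
Proof. by []. Qed.

Lemma mps_mapD k (f g : mps k R) : mps_map j (f + g) = mps_map j f + mps_map j g.
Proof. by apply: mpsP => m; rewrite pcoefD !pcoef_map rmorphD. Qed.
Lemma mps_mapB k (f g : mps k R) : mps_map j (f - g) = mps_map j f - mps_map j g.
Proof. by apply: mpsP => m; rewrite pcoefB !pcoef_map rmorphB. Qed.
Lemma mps_map0 k : mps_map j (0 : mps k R) = 0.
Proof. by apply: mpsP => m; rewrite pcoef_map rmorph0. Qed.
Lemma mps_mapC k c : mps_map j (mpsC c : mps k R) = mpsC (j c).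
Proof. by apply: mpsP => m; rewrite pcoef_map !pcoefC; case: eqP; rewrite ?rmorph0. Qed.
Lemma mps_map_mpsX k i : mps_map j (mpsX i : mps k R) = mpsX i.
Proof. by apply: mpsP => m; rewrite pcoef_map !pcoef_mpsX; case: eqP; rewrite ?rmorph0 ?rmorph1. Qed.
Lemma mps_map1 k : mps_map j (1 : mps k R) = 1.
Proof. by rewrite -(rmorph1 mpsC) mps_mapC !rmorph1. Qed.
Lemma mps_mapM k (f g : mps k R) : mps_map j (f * g) = mps_map j f * mps_map j g.
Proof.
apply: mpsP => m; rewrite pcoef_map [LHS]rmorph_sum.
by apply: eq_bigr => c _; rewrite rmorphM.
Qed.
Lemma mps_mapXn k (f : mps k R) n : mps_map j (f ^+ n) = mps_map j f ^+ n.
Proof.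
by elim: n => [|n IH]; rewrite ?expr0 ?mps_map1 // !exprS mps_mapM IH.
Qed.
Lemma mps_map_subst k l (f : mps k R) (g : 'I_k -> mps l R) :
  mps_map j (mps_subst f g) = mps_subst (mps_map j f) (fun i => mps_map j (g i)).
Proof.
apply: mpsP => m; rewrite pcoef_map !pcoef_substE rmorph_sum.
apply: eq_bigr => a _; rewrite rmorphM /= -!pcoef_map; congr (_ * pcoef _ m).
rewrite /mmap1; elim/big_rec2: _ => [|i x y _ <-]; first exact: mps_map1.
by rewrite mps_mapM mps_mapXn.
Qed.
Lemma vdeg_map k N (f : mps k R) : vdeg N f -> vdeg N (mps_map j f).
Proof. by move=> h m hm; rewrite pcoef_map h ?rmorph0. Qed.
End Map.

(** * Series in one variable *)

Section OneVariable.
Variable R : comNzRingType.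
Implicit Types f g : mps 1 R.

Definition cf f i : R := pcoef f (U_(ord0) *+ i)%MM.

Lemma mnm1_mdeg (a : 'X_{1..1}) : a = (U_(ord0) *+ mdeg a)%MM.
Proof.
by apply/mnmP => i; rewrite mulmnE mnm1E !ord1 eqxx mdegE big_ord1 mul1n.
Qed.

Lemma pcoef_cf f a : pcoef f a = cf f (mdeg a).
Proof. by rewrite /cf -mnm1_mdeg. Qed.

Lemma leadE f : lead f = cf f 1.
Proof. by rewrite /lead /cf mulm1n. Qed.

Lemma vdegP N f : vdeg N f <-> forall i, (i < N)%N -> cf f i = 0.
Proof.
split=> h; first by move=> i hi; apply: h; rewrite mdegMn mdeg1 mul1n.
by move=> a ha; rewrite pcoef_cf h.
Qed.

Lemma eqdegP N f g : eqdeg N f g <-> forall i, (i < N)%N -> cf f i = cf g i.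
Proof.
split=> h; first by move=> i hi; apply: h; rewrite mdegMn mdeg1 mul1n.
by move=> a ha; rewrite !pcoef_cf h.
Qed.

Lemma cfD f g i : cf (f + g) i = cf f i + cf g i. Proof. by []. Qed.
Lemma cfB f g i : cf (f - g) i = cf f i - cf g i. Proof. by []. Qed.
Lemma cfCM c f i : cf (mpsC c * f) i = c * cf f i.
Proof. exact: pcoefCM. Qed.
Lemma cfC c i : cf (mpsC c) i = if i == 0%N then c else 0.
Proof. by rewrite /cf pcoefC -mdeg_eq0 mdegMn mdeg1 mul1n. Qed.

Lemma cfXM f i : cf (psX * f) i = if i is j.+1 then cf f j else 0.
Proof.
rewrite /cf pcoefXM mulmnE mnm1E eqxx mul1n; case: i => //= i.
by congr (pcoef f _); apply/mnmP => j; rewrite mnmBE !mulmnE mnm1E; lia.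
Qed.

Lemma cfXnM n f i : cf (psX ^+ n * f) (n + i) = cf f i.
Proof.
elim: n f i => [|n IH] f i; first by rewrite mul1r.
by rewrite exprS -mulrA addSn cfXM IH.
Qed.

Lemma cfXn n i : cf (psX ^+ n) i = (i == n)%:R.
Proof.
elim: n i => [|n IH] i; first by rewrite expr0 (cfC 1); case: eqP.
by rewrite exprS cfXM; case: i.
Qed.

Lemma vdeg_psX : vdeg 1 (psX : mps 1 R). Proof. exact: vdeg_mpsX. Qed.
Lemma vdeg_psXn n : vdeg n (psX ^+ n : mps 1 R).
Proof. by have := @vdegX _ _ _ n _ vdeg_psX; rewrite mul1n. Qed.

(** The quotient of [f - f(0)] by the variable. *)
Definition shift f : mps 1 R := MPS (fun m => pcoef f (m + U_(ord0))%MM).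

Lemma cf_shift f i : cf (shift f) i = cf f i.+1.
Proof. by rewrite /cf mulmS addmC. Qed.

Lemma shiftE f : f = mpsC (cf f 0) + psX * shift f.
Proof.
apply: eqdeg_eq => N; apply/eqdegP => i _.
by rewrite cfD cfC cfXM; case: i => [|i]; rewrite ?addr0 // cf_shift add0r.
Qed.

Fixpoint shiftn n f := if n is n'.+1 then shift (shiftn n' f) else f.

Lemma cf_shiftn n f i : cf (shiftn n f) i = cf f (n + i).
Proof. by elim: n i => // n IH i; rewrite cf_shift IH addnS. Qed.

Lemma vdeg_shiftn n f : vdeg n f -> f = psX ^+ n * shiftn n f.
Proof.
move=> /vdegP h; apply: eqdeg_eq => N; apply/eqdegP => i _.
case: (leqP n i) => hi.
  by rewrite -(subnKC hi) cfXnM cf_shiftn.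
have /vdegP h' : vdeg n (shiftn n f * psX ^+ n) by apply: vdegMl; apply: vdeg_psXn.
by rewrite h // mulrC h'.
Qed.

End OneVariable.

Lemma pcoef0M k (R : comNzRingType) (f g : mps k R) :
  pcoef (f * g) 0%MM = pcoef f 0%MM * pcoef g 0%MM.
Proof.
have e h : eqdeg 1 h (mpsC (pcoef h 0%MM) : mps k R).
  by move=> m; rewrite ltnS leqn0 mdeg_eq0 => /eqP ->; rewrite pcoefC eqxx.
have -> : pcoef (f * g) 0%MM
    = pcoef (mpsC (pcoef f 0%MM) * mpsC (pcoef g 0%MM) : mps k R) 0%MM.
  by apply: (eqdegM (e f) (e g)); rewrite mdeg0.
by rewrite pcoefCM pcoefC eqxx.
Qed.

Section OneVariable2.
Variable R : comNzRingType.
Implicit Types f g : mps 1 R.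

Lemma cf_low i j f g : vdeg i f -> vdeg j g ->
  cf (f * g) (i + j) = cf f i * cf g j.
Proof.
move=> hf hg; rewrite (vdeg_shiftn hf) (vdeg_shiftn hg).
have cE n h : cf (psX ^+ n * h) n = cf h 0 :> R by rewrite -{2}[n]addn0 cfXnM.
rewrite mulrACA -exprD !cE.
exact: pcoef0M.
Qed.

Lemma cf_lowX i n f : vdeg i f -> cf (f ^+ n) (i * n) = cf f i ^+ n.
Proof.
move=> hf; elim: n => [|n IH]; first by rewrite muln0 !expr0 (cfC 1).
by rewrite !exprS mulnS cf_low // ?IH //; apply: vdegX.
Qed.

Lemma eqdeg2_lin f : eqdeg 2 f (mpsC (cf f 0) + mpsC (lead f) * psX).
Proof.
apply/eqdegP => i; rewrite cfD cfC cfCM -[psX]expr1 cfXn leadE.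
by case: i => [|[|]] // _; rewrite ?mulr0 ?addr0 // mulr1 add0r.
Qed.

Lemma lead_comp f g : vdeg 1 g -> lead (ps_comp f g) = lead f * lead g.
Proof.
move=> g0; rewrite !leadE /ps_comp.
have g0' : forall i : 'I_1, vdeg 1 g by [].
have /eqdegP -> // := @eqdeg_subst _ _ _ 2 _ _ (fun=> g) (fun=> g) g0'
  (eqdeg2_lin f) (fun=> eqdeg_refl).
by rewrite substD substM // !substC // substX // cfD cfC cfCM add0r leadE.
Qed.

Lemma psX_comp l (f : mps l R) : vdeg 1 f -> ps_comp psX f = f.
Proof. by move=> h; rewrite /ps_comp substX. Qed.

Lemma psXn_comp l (f : mps l R) n : vdeg 1 f -> ps_comp (psX ^+ n) f = f ^+ n.
Proof. by move=> h; rewrite /ps_comp substXn // substX. Qed.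

Lemma ps_compA l f g (h : mps l R) : vdeg 1 g -> vdeg 1 h ->
  ps_comp (ps_comp f g) h = ps_comp f (ps_comp g h).
Proof. by move=> g0 h0; rewrite /ps_comp subst_comp. Qed.

Lemma vdeg_comp l f (g : mps l R) : vdeg 1 f -> vdeg 1 g -> vdeg 1 (ps_comp f g).
Proof. by move=> f0 g0; apply: vdeg_subst. Qed.

Lemma cf_compXn f N i : (0 < N)%N -> cf (ps_comp f (psX ^+ N)) (N * i) = cf f i.
Proof.
move=> N0.
have X0 : forall i : 'I_1, vdeg 1 (psX ^+ N : mps 1 R).
  by move=> _; apply: vdeg_le (@vdeg_psXn _ N).
elim: i f => [|i IH] f; rewrite [in LHS](shiftE f) /ps_comp substD substC //
  substM // substX // cfD cfC.
  rewrite muln0 [cf (_ * _) _](_ : _ = 0) ?addr0 //.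
  by apply: (proj1 (vdegP N _)) => //; apply: vdegMr; apply: vdeg_psXn.
by rewrite mulnS cfXnM IH cf_shift addn_eq0 (gtn_eqF N0) add0r.
Qed.

End OneVariable2.

Lemma mps_map_comp1 (R S : comNzRingType) (j : {rmorphism R -> S}) l (f : mps 1 R)
    (g : mps l R) :
  mps_map j (ps_comp f g) = ps_comp (mps_map j f) (mps_map j g).
Proof. exact: mps_map_subst. Qed.

Lemma mps_map_psX (R S : comNzRingType) (j : {rmorphism R -> S}) :
  mps_map j psX = psX.
Proof. exact: mps_map_mpsX. Qed.

Lemma lead_map (R S : comNzRingType) (j : {rmorphism R -> S}) (f : mps 1 R) :
  lead (mps_map j f) = j (lead f).
Proof. by []. Qed.

(** * Formal group laws *)

Lemma ord2_cases (P : 'I_2 -> Prop) : P ord0 -> P ord_max -> forall i, P i.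
Proof.
by move=> h0 h1 [[|[|]] // h]; [move: h0|move: h1]; congr P; apply: val_inj.
Qed.

Section Fadd.
Variables (R : comNzRingType) (G : mps 2 R).

Lemma fadd_subst l l' (a b : mps l R) (h : 'I_l -> mps l' R) :
  vdeg 1 a -> vdeg 1 b -> (forall i, vdeg 1 (h i)) ->
  mps_subst (fadd G a b) h = fadd G (mps_subst a h) (mps_subst b h).
Proof.
move=> a0 b0 h0; rewrite /fadd subst_comp //; last by move=> i; case: eqP.
by apply: eq_subst => i; case: eqP.
Qed.

Lemma fadd_map (S : comNzRingType) (j : {rmorphism R -> S}) l (a b : mps l R) :
  mps_map j (fadd G a b) = fadd (mps_map j G) (mps_map j a) (mps_map j b).
Proof. by rewrite /fadd mps_map_subst; apply: eq_subst => i; case: eqP. Qed.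

Lemma fsum_map (S : comNzRingType) (j : {rmorphism R -> S}) l (s : seq (mps l R)) :
  mps_map j (fsum G s) = fsum (mps_map j G) (map (mps_map j) s).
Proof. by elim: s => [|a s IH] /=; rewrite ?mps_map0 // fadd_map IH. Qed.

Lemma eqdeg_fadd N l (a b a' b' : mps l R) : vdeg 1 a -> vdeg 1 b ->
  eqdeg N a a' -> eqdeg N b b' -> eqdeg N (fadd G a b) (fadd G a' b').
Proof.
move=> a0 b0 ea eb; apply: eqdeg_subst => [i||i]; try by case: eqP.
exact: eqdeg_refl.
Qed.

Hypothesis fglG : is_fgl G.

Lemma fgl_coef0 : pcoef G 0%MM = 0.
Proof.
have [e _ _ _] := fglG.
have G1 : eqdeg 1 G (mpsC (pcoef G 0%MM)).
  by move=> m; rewrite ltnS leqn0 mdeg_eq0 => /eqP ->; rewrite pcoefC eqxx.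
have h0 (i : 'I_2) : vdeg 1 (if i == ord0 then psX else 0 : mps 1 R).
  by case: eqP => _; [apply: vdeg_psX | apply: vdeg0].
have := eqdeg_subst h0 G1 (fun i => eqdeg_refl) (m := 0%MM).
rewrite mdeg0 => /(_ isT); rewrite substC // pcoefC eqxx => <-.
rewrite (_ : mps_subst G _ = psX) //.
by have /vdeg1P := vdeg_psX R.
Qed.

Lemma vdeg_fgl : vdeg 1 G. Proof. by apply/vdeg1P; exact: fgl_coef0. Qed.

Lemma vdeg_fadd l (a b : mps l R) : vdeg 1 a -> vdeg 1 b -> vdeg 1 (fadd G a b).
Proof. by move=> a0 b0; apply: vdeg_subst vdeg_fgl => i; case: eqP. Qed.

Lemma faddr0 l (a : mps l R) : vdeg 1 a -> fadd G a 0 = a.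
Proof.
have [e _ _ _] := fglG => a0.
have := congr1 (fun f => mps_subst f (fun=> a)) e.
by rewrite fadd_subst ?substX ?subst0 //; apply: vdeg_psX.
Qed.

Lemma fadd0r l (a : mps l R) : vdeg 1 a -> fadd G 0 a = a.
Proof.
have [_ e _ _] := fglG => a0.
have := congr1 (fun f => mps_subst f (fun=> a)) e.
by rewrite fadd_subst ?substX ?subst0 //; apply: vdeg_psX.
Qed.

Lemma faddC l (a b : mps l R) : vdeg 1 a -> vdeg 1 b -> fadd G a b = fadd G b a.
Proof.
have [_ _ e _] := fglG => a0 b0.
pose h (i : 'I_2) := if i == ord0 then a else b.
have h0 i : vdeg 1 (h i) by rewrite /h; case: eqP.
have := congr1 (fun f => mps_subst f h) e.
by rewrite /= !fadd_subst ?substX //; apply: vdeg_mpsX.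
Qed.

Lemma faddA l (a b c : mps l R) : vdeg 1 a -> vdeg 1 b -> vdeg 1 c ->
  fadd G (fadd G a b) c = fadd G a (fadd G b c).
Proof.
have [_ _ _ e] := fglG => a0 b0 c0.
pose h (i : 'I_3) := if i == ord0 then a else if i == ord_max then c else b.
have h0 i : vdeg 1 (h i) by rewrite /h; case: eqP => // _; case: eqP.
have := congr1 (fun f => mps_subst f h) e.
have X0 (i : 'I_3) : vdeg 1 (mpsX i : mps 3 R) by apply: vdeg_mpsX.
rewrite /= !fadd_subst ?substX //; try exact: vdeg_fadd.
by rewrite /h -!val_eqE /= !inordK.
Qed.

Lemma fsum_vdeg l (s : seq (mps l R)) :
  (forall a, a \in s -> vdeg 1 a) -> vdeg 1 (fsum G s).
Proof.
elim: s => [|a s IH] h /=; first exact: vdeg0.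
apply: vdeg_fadd; first by apply: h; rewrite mem_head.
by apply: IH => b hb; apply: h; rewrite in_cons hb orbT.
Qed.

Lemma fsum_vdegF l I (s : seq I) (f : I -> mps l R) :
  (forall i, vdeg 1 (f i)) -> vdeg 1 (fsum G (map f s)).
Proof. by move=> h; elim: s => [|a s IH] /=; [exact: vdeg0|exact: vdeg_fadd]. Qed.

Lemma fsum_fadd l I (s : seq I) (f g : I -> mps l R) :
  (forall i, vdeg 1 (f i)) -> (forall i, vdeg 1 (g i)) ->
  fsum G [seq fadd G (f i) (g i) | i <- s]
    = fadd G (fsum G (map f s)) (fsum G (map g s)).
Proof.
move=> f0 g0; elim: s => [|i s IH] /=; first by rewrite faddr0 //; exact: vdeg0.
have Sf := @fsum_vdegF l _ s _ f0; have Sg := @fsum_vdegF l _ s _ g0.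
rewrite IH !faddA //; try exact: vdeg_fadd.
congr fadd; rewrite -!faddA //; congr fadd; exact: faddC.
Qed.

Lemma fsum_subst l l' I (s : seq I) (f : I -> mps l R) (h : 'I_l -> mps l' R) :
  (forall i, vdeg 1 (f i)) -> (forall i, vdeg 1 (h i)) ->
  mps_subst (fsum G (map f s)) h = fsum G [seq mps_subst (f i) h | i <- s].
Proof.
move=> f0 h0; elim: s => [|i s IH] /=; first exact: subst0.
by rewrite fadd_subst ?IH //; apply: fsum_vdegF.
Qed.

Lemma fsum_cat l (s t : seq (mps l R)) :
  (forall a, a \in s -> vdeg 1 a) -> (forall a, a \in t -> vdeg 1 a) ->
  fsum G (s ++ t) = fadd G (fsum G s) (fsum G t).
Proof.
move=> h h'; have t0 := fsum_vdeg h'.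
elim: s h => [|a s IH] h /=; first by rewrite fadd0r.
have hs b : b \in s -> vdeg 1 b by move=> hb; apply: h; rewrite in_cons hb orbT.
by rewrite IH // faddA //; [apply: h; rewrite mem_head | apply: fsum_vdeg].
Qed.

Lemma fgl_lin : vdeg 2 (G - (mpsX ord0 + mpsX ord_max)).
Proof.
have [e0 e1 _ _] := fglG.
pose L := mpsC (pcoef G U_(ord0)%MM) * mpsX ord0
        + mpsC (pcoef G U_(ord_max)%MM) * mpsX ord_max : mps 2 R.
have GL : eqdeg 2 G L.
  move=> m; rewrite ltnS leq_eqVlt => /orP [/mdeg1P [i /eqP ->]|]; last first.
    rewrite ltnS leqn0 mdeg_eq0 => /eqP ->; rewrite fgl_coef0.
    by rewrite pcoefD !pcoefCM !pcoef_mpsX !(eq_sym 0%MM) !mnm1_eq0 !mulr0 addr0.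
  rewrite pcoefD !pcoefCM !pcoef_mpsX !eq_mnm1.
  by move: i; apply: ord2_cases; rewrite ?eqxx /= ?mulr1 ?mulr0 ?addr0 ?add0r.
have c i (a b : mps 1 R) : (forall i : 'I_2, vdeg 1 (if i == ord0 then a else b)) ->
   (i < 2)%N -> cf (fadd G a b) i = cf (mpsC (pcoef G U_(ord0)%MM) * a
        + mpsC (pcoef G U_(ord_max)%MM) * b) i.
  move=> h0 hi; have /eqdegP := eqdeg_subst h0 GL (fun i => eqdeg_refl).
  by move/(_ _ hi); rewrite /fadd => ->; rewrite substD !substM // !substC // !substX.
have X0 := vdeg_psX R; have Z0 := @vdeg0 1 R 1.
have c0 : pcoef G U_(ord0)%MM = 1.
  have := c 1%N psX 0 (fun i => ltac:(by case: eqP)) isT.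
  rewrite e0 mulr0 addr0 cfCM -[psX]expr1 cfXn mulr1 => <- //.
have c1 : pcoef G U_(ord_max)%MM = 1.
  have := c 1%N 0 psX (fun i => ltac:(by case: eqP)) isT.
  rewrite e1 mulr0 add0r cfCM -[psX]expr1 cfXn mulr1 => <- //.
by apply/eqdegB; move: GL; rewrite /L c0 c1 !(rmorph1 mpsC) !mul1r.
Qed.

(** A formal group law is addition up to terms of degree two; if the summands
    change only from degree [M] on, these terms change only from degree [M + 1]
    on. *)
Lemma fadd_lin M l (a b a' b' : mps l R) :
  vdeg 1 a -> vdeg 1 b -> vdeg 1 a' -> vdeg 1 b' ->
  eqdeg M a a' -> eqdeg M b b' ->
  eqdeg M.+1 (fadd G a' b' - fadd G a b) ((a' - a) + (b' - b)).
Proof.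
move=> a0 b0 a0' b0' ea eb.
pose h i := if i == ord0 :> 'I_2 then a else b.
pose h' i := if i == ord0 :> 'I_2 then a' else b'.
have h0 i : vdeg 1 (h i) by rewrite /h; case: eqP.
have h0' i : vdeg 1 (h' i) by rewrite /h'; case: eqP.
pose Q := G - (mpsX ord0 + mpsX ord_max).
have E : G = (mpsX ord0 + mpsX ord_max) + Q by rewrite addrC subrK.
have fE (g : 'I_2 -> mps l R) : (forall i, vdeg 1 (g i)) ->
    mps_subst G g = g ord0 + g ord_max + mps_subst Q g.
  by move=> g0; rewrite {1}E !substD !substX.
apply/eqdegB.
have -> : fadd G a' b' - fadd G a b - (a' - a + (b' - b))
   = mps_subst Q h' - mps_subst Q h.
  rewrite /fadd (fE h') // (fE h) // /h /h' /=.
  by ring.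
apply/eqdegB => m hm; rewrite !pcoef_substE; apply: eq_bigr => c _.
case: (ltnP (mdeg (c : 'X_{1..2})) 2) => hc; first by rewrite fgl_lin // !mul0r.
congr (_ * _); apply: eqdegS_mmap1 hm => // i.
by rewrite /h /h'; case: eqP => _; apply: eqdeg_sym.
Qed.

Lemma fadd_low M l (a b : mps l R) : (0 < M)%N -> vdeg M a -> vdeg M b ->
  eqdeg M.+1 (fadd G a b) (a + b).
Proof.
move=> M0 ha hb; have Z0 := @vdeg0 l R 1.
have := @fadd_lin M l 0 0 a b Z0 Z0.
rewrite faddr0 // !subr0; apply; try exact: vdeg_le M0 _.
  by apply: eqdeg_sym; apply/eqdegB; rewrite subr0.
by apply: eqdeg_sym; apply/eqdegB; rewrite subr0.
Qed.

Lemma vdegN_fadd M l (a b : mps l R) : (0 < M)%N -> vdeg M a -> vdeg M b ->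
  vdeg M (fadd G a b).
Proof.
move=> M0 ha hb m hm; rewrite (fadd_low M0 ha hb (m := m)) ?(vdegD ha hb) //.
exact: ltnW.
Qed.

Lemma fgl_map (S : comNzRingType) (j : {rmorphism R -> S}) : is_fgl (mps_map j G).
Proof.
have [e0 e1 e2 e3] := fglG.
split=> [|||x y z].
- by rewrite -(mps_map_psX j) -(mps_map0 j) -fadd_map e0.
- by rewrite -(mps_map_psX j) -(mps_map0 j) -fadd_map e1.
- by rewrite /= -!(mps_map_mpsX j) -!fadd_map e2.
by rewrite /x /y /z -!(mps_map_mpsX j) -!fadd_map e3.
Qed.

End Fadd.
(** * Symmetric cocycles *)

Section Cocycle.
Variables (S : comNzRingType) (Gam : S -> S -> S) (m : nat).
Hypothesis GamC : forall x y, Gam x y = Gam y x.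
Hypothesis Gam0 : forall x, Gam x 0 = 0.
Hypothesis GamA : forall x y z, Gam x y + Gam (x + y) z = Gam y z + Gam x (y + z).
Hypothesis GamM : forall c x y, Gam (c * x) (c * y) = c ^+ m * Gam x y.

(** The defect of additivity that the cocycle produces on a whole list. *)
Fixpoint defect (s : seq S) : S :=
  if s is x :: s' then Gam x (\sum_(y <- s') y) + defect s' else 0.

Lemma defectM c s : defect (map ( *%R c) s) = c ^+ m * defect s.
Proof.
elim: s => [|x s IH] /=; first by rewrite mulr0.
by rewrite IH mulrDr big_map -mulr_sumr GamM.
Qed.

(** The two ways of bracketing [a + b + A + B] as a sum of two pairs. *)
Lemma cocycle4 a b A B :
  Gam (a + b) (A + B) + Gam a b + Gam A B = Gam a A + Gam b B + Gam (a + A) (b + B).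
Proof.
have h1 := GamA a b (A + B); have h2 := GamA b A B.
have h3 := GamA a A (b + B); have h4 := GamA A b B.
rewrite (addrCA A) in h3; rewrite (addrC A b) (GamC A b) in h4.
transitivity (Gam b A + Gam (b + A) B + Gam a (b + (A + B))).
  by rewrite (addrC (Gam (a + b) _)) h1 h2; ring.
by rewrite h4 [RHS]addrAC h3; ring.
Qed.

(** The defect of the list of sums [f i + g i] is computed in two ways: summing
    the pairs first, or the [f i] and the [g i] first. *)
Lemma defect_interleave I (s : seq I) (f g : I -> S) :
  defect [seq f i + g i | i <- s] + \sum_(i <- s) Gam (f i) (g i)
  = defect (map f s) + defect (map g s)
    + Gam (\sum_(i <- s) f i) (\sum_(i <- s) g i).
Proof.
elim: s => [|i s IH] /=; first by rewrite !big_nil Gam0 !addr0.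
rewrite !big_cons !big_map big_split /=.
set A := \sum_(j <- s) f j; set B := \sum_(j <- s) g j.
move: IH; rewrite -/A -/B; set D1 := defect _; set D2 := defect _.
set D3 := defect _; set SG := \sum_(_ <- _) _ => IH.
have h := cocycle4 (f i) (g i) A B.
have -> : Gam (f i + g i) (A + B) + D1 + (Gam (f i) (g i) + SG)
   = (D1 + SG) + (Gam (f i + g i) (A + B) + Gam (f i) (g i) + Gam A B) - Gam A B.
  by ring.
by rewrite IH h; ring.
Qed.

End Cocycle.

(** * Symmetric cocycles of degree a power of the characteristic *)

Section PrimePower.
Variables (p : nat) (F : fieldType).
Hypothesis chF : p \in [pchar F].

Let p_prime : prime p. Proof. exact: pcharf_prime chF. Qed.

Lemma coef_XDC (R : comNzRingType) (q : R) l i :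
  (('X + q%:P) ^+ l)`_i = q ^+ (l - i) *+ 'C(l, i).
Proof.
rewrite addrC exprDn coef_sum.
have E (k : 'I_l.+1) : (q%:P ^+ (l - k) * 'X ^+ k *+ 'C(l, k))`_i
     = if k == i :> nat then q ^+ (l - i) *+ 'C(l, i) else 0.
  rewrite coefMn -rmorphXn coefCM coefXn eq_sym.
  by case: eqP => [->|_]; rewrite ?mulr1 // mulr0 mul0rn.
rewrite (eq_bigr _ (fun k _ => E k)) -big_mkcond /=.
case: (leqP i l) => hi; last first.
  rewrite bin_small // mulr0n big1_eq //.
by rewrite (big_pred1 (Ordinal (hi : (i < l.+1)%N))) // => k; rewrite -val_eqE.
Qed.

(** Both sides are coefficients of [(X + 1) ^ (p a) = (X ^ p + 1) ^ a]. *)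
Lemma bin_pmul a b : 'C(p * a, p * b)%:R = 'C(a, b)%:R :> F.
Proof.
have := coef_XDC (1 : F) (p * a) (p * b); rewrite expr1n => <-.
have chP : p \in [pchar {poly F}].
  by rewrite inE p_prime -polyC_natr (pcharf0 chF) polyC0 eqxx.
rewrite exprM -[(_ + _) ^+ p](pFrobenius_autE chP) pFrobenius_autD_comm; last exact: mulrC.
rewrite !pFrobenius_autE -rmorphXn expr1n addrC exprDn coef_sum.
have E (k : 'I_a.+1) : (1%:P ^+ (a - k) * ('X ^+ p) ^+ k *+ 'C(a, k) : {poly F})`_(p * b)
     = if k == b :> nat then 'C(a, b)%:R else 0.
  rewrite coefMn expr1n mul1r -exprM coefXn eqn_pmul2l ?prime_gt0 // eq_sym.
  by case: eqP => [->|_]; rewrite ?mul0rn.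
rewrite (eq_bigr _ (fun k _ => E k)) -big_mkcond /=.
case: (leqP b a) => hb; last by rewrite bin_small // big1_eq.
by rewrite (big_pred1 (Ordinal (hb : (b < a.+1)%N))) // => k; rewrite -val_eqE.
Qed.

Lemma bin_pmulMn (x : F) a b : x *+ 'C(p * a, p * b) = x *+ 'C(a, b).
Proof. by rewrite -mulr_natr bin_pmul mulr_natr. Qed.

Lemma bin_ppow e k : (0 < k < p ^ e)%N -> 'C(p ^ e, k)%:R = 0 :> F.
Proof.
move=> /andP[k0 ke]; have := coef_XDC (1 : F) (p ^ e) k; rewrite expr1n => <-.
have chP : p \in [pchar {poly F}].
  by rewrite inE p_prime -polyC_natr (pcharf0 chF) polyC0 eqxx.
rewrite exprDn_pchar; last by rewrite pnatX pnatE // chP.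
rewrite -rmorphXn expr1n coefD coefXn coefC (gtn_eqF k0) (ltn_eqF ke).
by rewrite addr0.
Qed.

Lemma bin_pred_ppow e k : (k < p ^ e)%N -> 'C((p ^ e).-1, k)%:R = (-1) ^+ k :> F.
Proof.
elim: k => [|k IH] hk; first by rewrite bin0.
have E : (p ^ e)%N = (p ^ e).-1.+1 by rewrite prednK // expn_gt0 prime_gt0.
have := @bin_ppow e k.+1; rewrite hk => /(_ isT).
rewrite [in X in X -> _]E binS natrD IH; last exact: ltnW.
by rewrite exprS mulN1r => /eqP; rewrite addr_eq0 => /eqP.
Qed.

Lemma natr_exp_p i : i%:R ^+ p = i%:R :> F.
Proof. by rewrite -(pFrobenius_autE chF) pFrobenius_aut_nat. Qed.

(** Comparison of the coefficients of [x ^ i y ^ j z ^ (m - i - j)] in the cocycle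
    identity for the form [sum_l (g l) x ^ l y ^ (m - l)]. *)
Definition cocycle_coefs m (g : nat -> F) := forall i j,
  (0 < i)%N -> (0 < j)%N -> (i + j < m)%N ->
  g (i + j)%N *+ 'C(i + j, i) = g i *+ 'C(m - i, j).

Lemma natr_neq0 i : (0 < i < p)%N -> i%:R != 0 :> F.
Proof.
by move=> /andP[i0 ip]; rewrite -(dvdn_pcharf chF) gtnNdvd.
Qed.

(** The relations make [g l] the multiple [g 1 * (C(p, l) / p)] of an integer; the
    double sum is then [g 1 * (p ^ (p - 1) - 1)], by telescoping
    [(k + 1) ^ p - k ^ p]. *)
Lemma cocycle_coefs_p g : cocycle_coefs p g -> g 0%N = 0 ->
  \sum_(i < p) \sum_(l < p) g l * i%:R ^+ l = 0 ->
  forall l, (l < p)%N -> g l = 0.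
Proof.
move=> hg g0 hs; pose b l := ('C(p, l) %/ p)%N.
have p0 := prime_gt0 p_prime; have p1 := prime_gt1 p_prime.
have bE l : (0 < l < p)%N -> 'C(p, l) = (p * b l)%N.
  by move=> hl; rewrite mulnC divnK // prime_dvd_bin.
have lb l : (0 < l < p)%N -> (l * b l)%N = 'C(p.-1, l.-1).
  move=> hl; apply/eqP; rewrite -(eqn_pmul2l p0) mulnCA -bE //.
  have := mul_bin_diag p l.-1; rewrite prednK; last by case/andP: hl.
  by move=> ->; rewrite mulnC.
have gE l : (0 < l < p)%N -> g l = g 1%N *+ b l.
  move=> hl; case: (ltnP 1 l) => h1; last first.
    have -> : l = 1%N by move: hl h1; lia.
    by rewrite /b bin1 divnn p0.
  have := hg 1%N l.-1 isT _ _; rewrite -subn1 subnKC; last by lia.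
  rewrite bin1 !subn1 => /(_ _ _) h; apply: (mulIf (natr_neq0 hl)).
  rewrite mulr_natr h; try lia.
  by rewrite -lb // mulrnA mulr_natr mulrnAC.
pose B k := (\sum_(i < k) \sum_(1 <= l < p) b l * i ^ l)%N.
have BE k : (k ^ p = k + p * B k)%N.
  elim: k => [|k IH]; first by rewrite /B big_ord0 muln0 exp0n.
  rewrite /B big_ord_recr /= -/(B k) mulnDr addnA -addn1 expnDn.
  rewrite -(big_mkord xpredT (fun i => 'C(p, i) * (k ^ (p - i) * 1 ^ i))%N).
  rewrite big_ltn // big_nat_recr //= bin0 binn subn0 !mul1n muln1 ?subnn ?expn0 ?mul1n.
  rewrite exp1n IH.
  have -> : (\sum_(1 <= i < p) 'C(p, i) * (k ^ (p - i) * 1 ^ i)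
     = p * \sum_(1 <= l < p) b l * k ^ l)%N.
    rewrite big_nat_rev big_distrr /=; apply: eq_big_nat => i hi.
    rewrite exp1n muln1 mulnA -bE //.
    have -> : (p - (1 + p - i.+1) = i)%N by lia.
    by rewrite -bin_sub; [congr ('C(_, _) * _)%N; lia | lia].
  lia.
have BF : (B p)%:R = -1 :> F.
  have e : (p ^ p.-1 = 1 + B p)%N.
    by apply/eqP; rewrite -(eqn_pmul2l p0) -expnS prednK // BE mulnDr muln1.
  have := congr1 (fun n => n%:R : F) e.
  rewrite natrX (pcharf0 chF) expr0n natrD.
  have -> : (p.-1 == 0)%N = false by lia.
  by move/esym/eqP; rewrite addrC addr_eq0 => /eqP.
have g1 : g 1%N = 0.
  have : \sum_(i < p) \sum_(l < p) g l * i%:R ^+ l = g 1%N * (B p)%:R.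
    rewrite natr_sum mulr_sumr; apply: eq_bigr => i _.
    rewrite -(big_mkord xpredT (fun l => g l * i%:R ^+ l)) big_ltn // g0 mul0r add0r.
    rewrite natr_sum mulr_sumr; apply: eq_big_nat => l hl.
    by rewrite gE // natrM natrX -[g 1%N *+ _]mulr_natr mulrA.
  by rewrite hs BF mulrN1 => /esym/eqP; rewrite oppr_eq0 => /eqP.
move=> l hl; case: (posnP l) => [->//|l0].
by rewrite gE ?l0 // g1 mul0rn.
Qed.

Lemma sum_multiples M (f : nat -> F) :
  (forall l, ~~ (p %| l)%N -> f l = 0) ->
  \sum_(l < p * M) f l = \sum_(k < M) f (p * k)%N.
Proof.
move=> hf; have p0 := prime_gt0 p_prime.
elim: M => [|M IH]; first by rewrite muln0 !big_ord0.
rewrite mulnSr big_split_ord /= IH big_ord_recr /=; congr (_ + _).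
rewrite -(big_mkord xpredT (fun i => f (p * M + i)%N)) big_ltn // addn0.
rewrite big_nat big1 ?addr0 // => i /andP[i0 ip].
by apply: hf; rewrite dvdn_addr ?dvdn_mulr // gtnNdvd.
Qed.

(** In characteristic [p] the relations force the coefficients of a cocycle of
    degree [p ^ e] to be supported on the multiples of [p ^ (e - 1)], by descent
    along the Frobenius; a cocycle of degree [p] is a multiple of
    [((x + y) ^ p - x ^ p - y ^ p) / p], and the multiple is detected by the sum
    over the prime field. *)
Lemma cocycle_coefs_ppow e g : cocycle_coefs (p ^ e.+1) g -> g 0%N = 0 ->
  \sum_(i < p) \sum_(l < p ^ e.+1) g l * i%:R ^+ l = 0 ->
  forall l, (l < p ^ e.+1)%N -> g l = 0.
Proof.
have p0 := prime_gt0 p_prime; have p1 := prime_gt1 p_prime.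
elim: e g => [|e IH] g; first by rewrite expn1; apply: cocycle_coefs_p.
set m := (p ^ e.+2)%N => hg g0 hs.
have pm : (p < m)%N by rewrite /m -{1}[p]expn1 ltn_exp2l.
have g1 : g 1%N = 0.
  have := hg 1%N p.-1 isT; rewrite add1n prednK // bin1 => /(_ _ pm) h.
  have {h} := h ltac:(lia).
  rewrite -mulr_natr (pcharf0 chF) mulr0 subn1 -mulr_natr bin_pred_ppow; last by lia.
  by move/esym/eqP; rewrite mulf_eq0 signr_eq0 orbF => /eqP.
have gp l : (l < m)%N -> ~~ (p %| l)%N -> g l = 0.
  move=> lm npl; have l0 : (0 < l)%N by case: l npl {lm}; rewrite ?dvdn0.
  case: (ltnP 1 l) => h1; last by have -> : l = 1%N by lia.
  have := hg 1%N l.-1 isT; rewrite add1n prednK // bin1 g1 mul0rn => h.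
  have {h} /eqP := h ltac:(lia) lm.
  by rewrite -mulr_natr mulf_eq0 -(dvdn_pcharf chF) (negPf npl) orbF => /eqP.
have mE : m = (p * p ^ e.+1)%N by rewrite /m expnS.
have hg' : forall l, (l < p ^ e.+1)%N -> g (p * l)%N = 0.
  apply: (IH (fun l => g (p * l)%N)); rewrite ?muln0 //.
    move=> i j i0 j0 hij; have := hg (p * i)%N (p * j)%N.
    rewrite !muln_gt0 p0 i0 j0 -mulnDr mE ltn_pmul2l // => /(_ isT isT hij).
    by rewrite -mulnBr !bin_pmulMn.
  rewrite -[RHS]hs; apply: eq_bigr => i _.
  pose f l := if (l < m)%N then g l * i%:R ^+ l else 0 : F.
  transitivity (\sum_(l < m) f l); last by apply: eq_bigr => l _; rewrite /f ltn_ord.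
  rewrite mE sum_multiples; last first.
    by move=> l hl; rewrite /f; case: ifP => // hlm; rewrite gp ?mul0r.
  apply: eq_bigr => l _; rewrite /f mE ltn_pmul2l // ltn_ord.
  by rewrite exprM natr_exp_p.
move=> l hl; case: (boolP (p %| l)%N) => [/dvdnP [k E]|]; last exact: gp.
by rewrite E mulnC hg' // -(ltn_pmul2l p0) -mE mulnC -E.
Qed.

End PrimePower.
(** * Uniqueness of the Honda formal group law *)

Section Comparison.
Variables (R : comNzRingType) (H H' : mps 2 R) (m : nat).
Hypotheses (fH : is_fgl H) (fH' : is_fgl H').
Hypothesis HH' : eqdeg m H H'.

Definition mon2 i : 'X_{1..2} := (U_(ord0) *+ i + U_(ord_max) *+ (m - i))%MM.
(** The part of degree [m] of [H' - H], by its coefficients and as a form. *)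
Definition dcoef i : R := pcoef (H' - H) (mon2 i).

Section Values.
Variables (S : comNzRingType) (j : {rmorphism R -> S}).
Local Notation HS := (mps_map j H).
Local Notation HS' := (mps_map j H').

Definition dform (x y : S) : S := \sum_(i < m.+1) j (dcoef i) * (x ^+ i * y ^+ (m - i)).

Lemma mon2_deg i : (i <= m)%N -> mdeg (mon2 i) = m.
Proof. by move=> hi; rewrite /mon2 mdegD !mdegMn !mdeg1 !mul1n subnKC. Qed.

Lemma mon2E (a : 'X_{1..2}) : mdeg a = m -> a = mon2 (a ord0).
Proof.
rewrite mdegE !big_ord_recl big_ord0 addn0 => h.
have {}h : (a ord0 + a ord_max = m)%N.
  by rewrite -h; congr (_ + a _)%N; apply: val_inj.
apply/mnmP; apply: ord2_cases.
  by rewrite mnmDE !mulmnE !mnm1E /= !mul1n mul0n addn0.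
by rewrite mnmDE !mulmnE !mnm1E /= mul0n mul1n -h addKn.
Qed.

Lemma mmap1_mon2 l (f : 'I_2 -> mps l S) i :
  mmap1 f (mon2 i) = f ord0 ^+ i * f ord_max ^+ (m - i).
Proof.
rewrite /mmap1 !big_ord_recl big_ord0 mulr1.
have -> : lift ord0 ord0 = ord_max :> 'I_2 by apply: val_inj.
by rewrite !mnmDE !mulmnE !mnm1E /= !mul1n !mul0n addn0 add0n.
Qed.

Lemma cf_dform (a b : mps 1 S) : vdeg 1 a -> vdeg 1 b ->
  cf (fadd HS' a b) m - cf (fadd HS a b) m = dform (lead a) (lead b).
Proof.
move=> a0 b0; rewrite -cfB /fadd -substB -mps_mapB.
set h := fun i : 'I_2 => _.
have h0 i : vdeg 1 (h i) by rewrite /h; case: eqP.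
pose P : {mpoly S[2]} := \sum_(i < m.+1) j (dcoef i) *: 'X_[mon2 i].
have degm : mdeg (U_(ord0 : 'I_1) *+ m)%MM = m by rewrite mdegMn mdeg1 mul1n.
rewrite /cf (@pcoef_subst _ _ _ P) //; last first.
  move=> c; rewrite degm => hc; rewrite /P raddf_sum /=.
  under eq_bigr => i _ do rewrite mcoeffZ mcoeffX.
  move: hc; rewrite leq_eqVlt => /orP[/eqP hc|hc]; last first.
    rewrite big1 => [|i _]; last first.
      case: eqP => [e|_]; last by rewrite mulr0.
      by move: hc; rewrite -e mon2_deg ?ltnn // -ltnS.
    by rewrite pcoef_map pcoefB HH' ?subrr ?rmorph0.
  have c0 : (c ord0 < m.+1)%N.
    by rewrite ltnS -hc mdegE big_ord_recl leq_addr.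
  rewrite (bigD1 (Ordinal c0)) //= -(mon2E hc) eqxx mulr1 big1 ?addr0.
    by rewrite pcoef_map /dcoef -(mon2E hc).
  move=> i ne; case: eqP => [e|_]; last by rewrite mulr0.
  case/eqP: ne; apply: val_inj; rewrite /= -e /mon2 mnmDE !mulmnE !mnm1E /=.
  by rewrite mul1n mul0n addn0.
rewrite /P raddf_sum pcoef_sum; apply: eq_bigr => i _ /=.
rewrite mmapZ mmapX pcoefCM mmap1_mon2 /h /=; congr (_ * _).
rewrite !leadE -(cf_lowX i a0) -(cf_lowX (m - i) b0) -cf_low; try exact: vdegX.
by rewrite !mul1n subnKC // -ltnS.
Qed.

Lemma eqdeg_map N k (f g : mps k R) :
  eqdeg N f g -> eqdeg N (mps_map j f) (mps_map j g).
Proof. by move=> h a ha; rewrite !pcoef_map h. Qed.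

Lemma eqdeg_fadd2 (a b a' b' : mps 1 S) : vdeg 1 a -> vdeg 1 b ->
  eqdeg m a a' -> eqdeg m b b' -> eqdeg m (fadd HS a b) (fadd HS' a' b').
Proof.
move=> a0 b0 ea eb; apply: eqdeg_subst => [i||i]; try by case: eqP.
exact: eqdeg_map.
Qed.

(** In degree [m] the two laws differ by the form at the leading coefficients, and
    a change of the summands in degree [m] passes through unaltered. *)
Lemma cf_fadd2 (a b a' b' : mps 1 S) :
  vdeg 1 a -> vdeg 1 b -> vdeg 1 a' -> vdeg 1 b' ->
  eqdeg m a a' -> eqdeg m b b' ->
  cf (fadd HS' a' b') m - cf (fadd HS a b) m
    = dform (lead a') (lead b') + ((cf a' m - cf a m) + (cf b' m - cf b m)).
Proof.
move=> a0 b0 a0' b0' ea eb; rewrite -cf_dform //.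
have /eqdegP/(_ m (ltnSn _)) := fadd_lin (fgl_map fH j) a0 b0 a0' b0' ea eb.
by rewrite !(cfB, cfD) => <-; rewrite addrA subrK.
Qed.

Lemma lead_fadd (G : mps 2 S) (a b : mps 1 S) : is_fgl G -> vdeg 1 a -> vdeg 1 b ->
  lead (fadd G a b) = lead a + lead b.
Proof.
move=> fG a0 b0; rewrite !leadE.
by have /eqdegP/(_ 1%N isT) := @fadd_low _ G fG 1 _ a b isT a0 b0.
Qed.

Definition line (x : S) : mps 1 S := mpsC x * psX.

Lemma vdeg_line x : vdeg 1 (line x).
Proof. by apply: vdegMl; apply: vdeg_psX. Qed.
Lemma lead_line x : lead (line x) = x.
Proof. by rewrite leadE cfCM -[psX]expr1 cfXn mulr1. Qed.

Let fHS : is_fgl HS. Proof. exact: fgl_map. Qed.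
Let fHS' : is_fgl HS'. Proof. exact: fgl_map. Qed.

Lemma dformC x y : dform x y = dform y x.
Proof.
rewrite -(lead_line x) -(lead_line y) -!cf_dform; try exact: vdeg_line.
rewrite (faddC fHS (vdeg_line x) (vdeg_line y)).
by rewrite (faddC fHS' (vdeg_line x) (vdeg_line y)).
Qed.

Lemma dform0 x : dform x 0 = 0.
Proof.
have e : lead (0 : mps 1 S) = 0 by [].
rewrite -{1}(lead_line x) -e -cf_dform //; try exact: vdeg_line.
by rewrite !faddr0 ?subrr //; apply: vdeg_line.
Qed.

(** The part of degree [m] of the associativity of [H'], minus that of [H], on
    three multiples of the coordinate. *)
Lemma dformA x y z :
  dform x y + dform (x + y) z = dform y z + dform x (y + z).
Proof.
have X0 := vdeg_line x; have Y0 := vdeg_line y; have Z0 := vdeg_line z.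
have := congr2 (fun u v => cf u m - cf v m)
  (faddA fHS' X0 Y0 Z0) (faddA fHS X0 Y0 Z0).
have vf G a b : is_fgl G -> vdeg 1 a -> vdeg 1 b -> vdeg 1 (fadd G a b : mps 1 S).
  by move=> *; apply: vdeg_fadd.
rewrite /= !cf_fadd2 ?subrr ?addr0 ?add0r ?cf_dform ?lead_fadd ?lead_line //;
  try exact: vf; try exact: eqdeg_fadd2.
by rewrite addrC [RHS]addrC.
Qed.

Lemma dformM c x y : dform (c * x) (c * y) = c ^+ m * dform x y.
Proof.
rewrite /dform mulr_sumr; apply: eq_bigr => i _.
have -> : c ^+ m = c ^+ i * c ^+ (m - i) by rewrite -exprD subnKC // -ltnS.
by rewrite !exprMn; ring.
Qed.

Lemma cf_fsum2 (s : seq (mps 1 S)) : (forall a, a \in s -> vdeg 1 a) ->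
  eqdeg m (fsum HS s) (fsum HS' s) /\
  cf (fsum HS' s) m - cf (fsum HS s) m = defect dform (map (@lead S) s).
Proof.
elim: s => [|a s IH] h; first by split; rewrite ?subrr.
have a0 : vdeg 1 a by apply: h; rewrite mem_head.
have hs b : b \in s -> vdeg 1 b by move=> hb; apply: h; rewrite in_cons hb orbT.
have [e d] := IH hs; have s0 := fsum_vdeg fHS hs; have s0' := fsum_vdeg fHS' hs.
split; first exact: eqdeg_fadd2.
rewrite /= cf_fadd2 // subrr add0r d; congr (dform _ _ + _).
elim: s {IH h e d s0 s0'} hs => [|b s IH] hs; first by rewrite big_nil.
have b0 : vdeg 1 b by apply: hs; rewrite mem_head.
have hs' c : c \in s -> vdeg 1 c by move=> hb; apply: hs; rewrite in_cons hb orbT.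
by rewrite /= big_cons lead_fadd // ?IH //; apply: fsum_vdeg.
Qed.

End Values.
End Comparison.

Section Uniqueness.
Variables (p : nat) (F : finFieldType).
Hypothesis chF : p \in [pchar F].
Variables H H' : mps 2 F.
Hypotheses (fH : is_fgl H) (fH' : is_fgl H').

Lemma dcoef_poly m (K : comNzRingType) (j : {rmorphism F -> K}) i :
  (i <= m)%N ->
  (dform H H' m (polyC \o j : {rmorphism F -> {poly K}}) 'X 1)`_i
    = j (dcoef H H' m i).
Proof.
move=> hi; rewrite /dform coef_sum (bigD1 (Ordinal (hi : (i < m.+1)%N))) //=.
rewrite expr1n mulr1 coefCM coefXn eqxx mulr1 big1 ?addr0 // => l hl.
rewrite expr1n mulr1 coefCM coefXn; case: eqP => [e|_]; last by rewrite mulr0.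
by case/eqP: hl; apply: val_inj.
Qed.

Lemma dcoef_eqdeg m : eqdeg m H H' ->
  (forall i, (i <= m)%N -> dcoef H H' m i = 0) -> eqdeg m.+1 H H'.
Proof.
move=> e h a; rewrite ltnS leq_eqVlt => /orP[/eqP ha|]; last exact: e.
apply/esym/eqP; rewrite -subr_eq0 -pcoefB (mon2E ha).
by rewrite -/(dcoef H H' m _) h // -ha mdegE big_ord_recl leq_addr.
Qed.

Lemma root_of_unity_sum q : prime q ->
  exists (K : fieldType) (j : {rmorphism F -> K}) (z : K),
    \sum_(i < q) z ^+ i = 0.
Proof.
move=> q_prime; have q1 := prime_gt1 q_prime.
pose P : {poly F} := \poly_(i < q) 1.
have sP : (1 < size P)%N by rewrite size_poly_eq ?oner_eq0.
have [K [j [z /rootP hz _]]] := countable_field_extension sP.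
have PE : map_poly j P = \poly_(i < q) 1.
  apply/polyP => i; rewrite coef_map !coef_poly; case: ifP => _.
    exact: (rmorph1 j).
  exact: (rmorph0 j).
exists K, j, z; rewrite -[RHS]hz PE horner_poly.
by apply: eq_bigr => i _; rewrite mul1r.
Qed.

(** If a prime [q] other than [p] divides [m], rotating both [x] and [y] by the
    powers of a root of unity of order [q] leaves the cocycle unchanged, whereas
    typicality makes the defects of the two orbits and of their sum vanish; so
    the cocycle is killed by [q]. *)
Lemma eqdeg_step_coprime m q : eqdeg m H H' ->
  p_typical p H -> p_typical p H' -> prime q -> q != p -> (q %| m)%N ->
  eqdeg m.+1 H H'.
Proof.
move=> e tH tH' q_prime qp qm.
have [K [j [z hz]]] := root_of_unity_sum q_prime.
pose jS : {rmorphism F -> {poly K}} := polyC \o j.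
pose Z : {poly K} := z%:P.
have hZ : \sum_(i < q) Z ^+ i = 0.
  transitivity ((\sum_(i < q) z ^+ i)%:P); last by rewrite hz.
  by rewrite rmorph_sum; apply: eq_bigr => i _; rewrite rmorphXn.
pose D := dform H H' m jS.
have DC := dformC fH fH' e jS; have D0 := dform0 fH fH' e jS.
have DA := dformA fH fH' e jS; have DM := dformM H H' m jS.
have Zm : Z ^+ m = 1.
  have Zq : Z ^+ q = 1.
    by apply/eqP; rewrite -subr_eq0 subrX1 hZ mulr0.
  by have /dvdnP [k ->] := qm; rewrite mulnC exprM Zq expr1n.
have orbit : defect D [seq Z ^+ i | i <- iota 0 q] = 0.
  have [|_] := @cf_fsum2 _ _ _ m fH fH' e _ jS
    [seq mpsC (Z ^+ i) * psX | i <- iota 0 q].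
    by move=> a /mapP [i _ ->]; apply: vdeg_line.
  rewrite (tH q q_prime qp _ jS Z hZ) (tH' q q_prime qp _ jS Z hZ) subrr -map_comp => h.
  by rewrite [LHS](_ : _ = defect D [seq (@lead _ \o (fun i => mpsC (Z ^+ i) * psX)) i
    | i <- iota 0 q]) ?h //; congr (defect D _); apply: eq_map => i /=;
    rewrite -[LHS]lead_line.
have orbitM c : defect D [seq Z ^+ i * c | i <- iota 0 q] = 0.
  have -> : [seq Z ^+ i * c | i <- iota 0 q] = map ( *%R c) [seq Z ^+ i | i <- iota 0 q].
    by rewrite -map_comp; apply: eq_map => i /=; rewrite mulrC.
  by rewrite (defectM DM) orbit mulr0.
have sumZ c : \sum_(i <- iota 0 q) Z ^+ i * c = 0.
  rewrite -mulr_suml; have := hZ.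
  by rewrite -(big_mkord xpredT (fun i => Z ^+ i)) /index_iota subn0 => ->; rewrite mul0r.
have := defect_interleave DC D0 DA (iota 0 q) (fun i => Z ^+ i * 'X) (fun i => Z ^+ i * 1).
rewrite !orbitM !sumZ D0 !addr0.
under eq_map => i do rewrite -mulrDr.
rewrite orbitM add0r.
under eq_bigr => i _ do rewrite DM exprAC Zm expr1n mul1r.
rewrite big_const_seq count_predT size_iota iter_addr addr0 => hq.
apply: dcoef_eqdeg => // i hi; apply/eqP; rewrite -(fmorph_eq0 j) -(dcoef_poly j hi).
have qF : q%:R != 0 :> K.
  rewrite -(rmorph_nat j) fmorph_eq0 -(dvdn_pcharf chF).
  by rewrite dvdn_prime2 ?(pcharf_prime chF) // eq_sym.
apply/eqP; apply: (mulIf qF); rewrite mul0r mulr_natr -coefMn.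
by rewrite [_ *+ q]hq coef0.
Qed.

(** The cocycle identity over [F[Y][X]] at [X], [Y] and [1]. *)
Lemma dcoef_cocycle m : eqdeg m H H' -> cocycle_coefs m (dcoef H H' m).
Proof.
move=> e i j i0 j0 ijm; pose g := dcoef H H' m.
pose jS : {rmorphism F -> {poly {poly F}}} := polyC \o polyC.
have coefE (q : {poly {poly F}}) (v : {poly F}) :
    dform H H' m jS q v%:P
      = \sum_(l < m.+1) (g l)%:P%:P * (q ^+ l * (v ^+ (m - l))%:P).
  by apply: eq_bigr => l _; rewrite rmorphXn.
have := congr1 (fun q : {poly {poly F}} => (q`_i)`_j) (dformA fH fH' e jS 'X 'X%:P 1).
rewrite !coefD.
have -> : ((dform H H' m jS 'X 'X%:P)`_i)`_j = 0.
  rewrite coefE !coef_sum big1 // => l _.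
  rewrite coefCM coefMC coefXn coefCM; case: eqP => [<-|_]; last first.
    by rewrite mul0r coef0 mulr0.
  by rewrite mul1r coefXn; case: eqP => [E|_]; rewrite ?mulr0 //; move: ijm; lia.
have -> : ((dform H H' m jS 'X%:P 1)`_i)`_j = 0.
  rewrite -(rmorph1 polyC) coefE !coef_sum big1 // => l _.
  rewrite -rmorphXn -!rmorphM coefC (gtn_eqF i0) coef0 //.
rewrite !add0r.
have -> : ((dform H H' m jS ('X + 'X%:P) 1)`_i)`_j = g (i + j)%N *+ 'C(i + j, i).
  rewrite -(rmorph1 polyC) coefE !coef_sum.
  have ij : (i + j < m.+1)%N by rewrite ltnW.
  rewrite (bigD1 (Ordinal ij)) //= big1 ?addr0 => [|l hl]; rewrite expr1n mulr1 coefCM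
    coef_XDC coefCM coefMn coefXn.
    by rewrite addKn eqxx mulr_natr.
  case: (ltnP l i) => hli; first by rewrite bin_small // mulr0n mulr0.
  case: eqP => [E|_]; last by rewrite mul0rn mulr0.
  by case/eqP: hl; apply: val_inj => /=; rewrite E subnKC.
have -> : ((dform H H' m jS 'X ('X%:P + 1))`_i)`_j = g i *+ 'C(m - i, j).
  have im : (i < m.+1)%N by lia.
  have -> : 'X%:P + 1 = ('X + 1)%:P :> {poly {poly F}} by rewrite rmorphD.
  rewrite coefE !coef_sum.
  rewrite (bigD1 (Ordinal im)) //= big1 ?addr0 => [|l hl]; rewrite coefCM coefMC
    coefXn coefCM.
    by rewrite eqxx mul1r -(rmorph1 polyC) coef_XDC expr1n mulr_natr.
  case: eqP => [E|_]; last by rewrite mul0r coef0 mulr0.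
  by case/eqP: hl; apply: val_inj.
by [].
Qed.

Lemma defect_nseq (S : comNzRingType) (D : S -> S -> S) k :
  defect D (nseq k 1) = \sum_(i < k) D 1 i%:R.
Proof.
elim: k => [|k IH]; first by rewrite big_ord0.
rewrite /= IH big_ord_recr /= addrC; congr (_ + _).
by rewrite big_nseq iter_addr addr0.
Qed.

(** The difference of the two [p]-series in degree [m] is the sum of the values of
    the form at [(1, i)] for [i < p], so the coefficients satisfy all the
    hypotheses of [cocycle_coefs_ppow]. *)
Lemma eqdeg_step_ppow e : eqdeg (p ^ e.+1) H H' ->
  p_series p H = p_series p H' -> eqdeg (p ^ e.+1).+1 H H'.
Proof.
set m := (p ^ e.+1)%N => eHH' hp.
pose j : {rmorphism F -> F} := idfun.
have jE G : mps_map j G = G :> mps 2 F by apply: mpsP.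
pose g := dcoef H H' m; pose D := dform H H' m j.
have m0 : (0 < m)%N by rewrite expn_gt0 prime_gt0 ?(pcharf_prime chF).
have D0 : D 1 0 = 0 by apply: dform0.
have gm : g m = 0.
  move: D0; rewrite /D /dform big_ord_recr /= subnn big1 => [|i _].
    by rewrite add0r expr1n !mulr1.
  by rewrite expr0n subn_eq0 leqNgt ltn_ord /= !mulr0.
have g0 : g 0%N = 0.
  move: D0; rewrite /D dformC // /dform big_ord_recl /= expr1n !mulr1.
  by rewrite big1 ?addr0 // => i _; rewrite expr0n /= mul0r mulr0.
have hs : \sum_(i < p) \sum_(l < m) g l * i%:R ^+ l = 0.
  have [|_] := @cf_fsum2 _ _ _ m fH fH' eHH' _ j (nseq p psX).
    by move=> a /nseqP [-> _]; apply: vdeg_psX.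
  rewrite !jE -/(p_series p H) -/(p_series p H') hp subrr map_nseq.
  rewrite leadE -[psX]expr1 cfXn defect_nseq => hd.
  rewrite [RHS]hd; apply: eq_bigr => i _.
  rewrite -/D /D dformC // /dform big_ord_recr /= -/(g m) gm mul0r addr0.
  by apply: eq_bigr => l _; rewrite expr1n mulr1.
apply: dcoef_eqdeg => // i; rewrite leq_eqVlt => /orP [/eqP -> //|hi].
by apply: (cocycle_coefs_ppow chF (dcoef_cocycle eHH') g0 hs).
Qed.

Theorem honda_unique n : is_honda p n H -> is_honda p n H' -> H = H'.
Proof.
move=> [_ tH sH] [_ tH' sH']; apply: eqdeg_eq.
have p_prime := pcharf_prime chF.
elim=> [|m IH] //; case: (ltnP 1 m) => m1; last first.
  apply: (@eqdeg_le _ _ 2) => //; apply/eqdegB.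
  by have := vdegB (fgl_lin fH) (fgl_lin fH'); rewrite opprB addrA subrK.
case: (boolP (all (pred1 p) (primes m))) => [/allP hm|/allPn [q]]; last first.
  rewrite mem_primes => /and3P [q_prime _ qm] /= qp.
  exact: eqdeg_step_coprime qm.
have m0 : (0 < m)%N by apply: ltnW.
have E : m = (p ^ logn p m)%N.
  have : p.-nat m.
    by apply/pnatP => // q q_prime qm; apply: (hm q); rewrite mem_primes q_prime m0.
  by move/part_pnat_id => {1}<-; rewrite p_part.
case El : (logn p m) E => [|l] E; first by move: m1; rewrite E.
by rewrite E; apply: eqdeg_step_ppow; rewrite -?E // sH sH'.
Qed.

End Uniqueness.
(** * Witt vectors *)

Section Divisibility.
Variables (W : comNzRingType) (a : W).

Definition pdvd k x := principal (a ^+ k) x.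

Lemma pdvd_0 x : pdvd 0 x. Proof. by exists x; rewrite expr0 mul1r. Qed.
Lemma pdvd0 k : pdvd k 0. Proof. by exists 0; rewrite mulr0. Qed.
Lemma pdvd_self k : pdvd k (a ^+ k). Proof. by exists 1; rewrite mulr1. Qed.
Lemma pdvdD k x y : pdvd k x -> pdvd k y -> pdvd k (x + y).
Proof. by move=> [u ->] [v ->]; exists (u + v); rewrite mulrDr. Qed.
Lemma pdvdN k x : pdvd k x -> pdvd k (- x).
Proof. by move=> [u ->]; exists (- u); rewrite mulrN. Qed.
Lemma pdvdB k x y : pdvd k x -> pdvd k y -> pdvd k (x - y).
Proof. by move=> hx hy; apply: pdvdD => //; apply: pdvdN. Qed.
Lemma pdvdM k l x y : pdvd k x -> pdvd l y -> pdvd (k + l) (x * y).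
Proof. by move=> [u ->] [v ->]; exists (u * v); rewrite exprD mulrACA. Qed.
Lemma pdvd_le k l x : (l <= k)%N -> pdvd k x -> pdvd l x.
Proof.
by move=> h [u ->]; exists (a ^+ (k - l) * u); rewrite mulrA -exprD subnKC.
Qed.
Lemma pdvdMl k x y : pdvd k y -> pdvd k (x * y).
Proof. by move=> [u ->]; exists (x * u); rewrite mulrCA. Qed.
Lemma pdvdMr k x y : pdvd k x -> pdvd k (x * y).
Proof. by rewrite mulrC; apply: pdvdMl. Qed.
Lemma pdvdX k x n : pdvd k x -> pdvd (k * n) (x ^+ n).
Proof.
move=> h; elim: n => [|n IH]; first by rewrite muln0; apply: pdvd_0.
by rewrite exprS mulnS; apply: pdvdM.
Qed.
Lemma pdvd_sum k I (r : seq I) (P : pred I) (f : I -> W) :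
  (forall i, P i -> pdvd k (f i)) -> pdvd k (\sum_(i <- r | P i) f i).
Proof.
by move=> h; elim/big_rec: _ => [|i x Pi hx]; [exact: pdvd0|apply: pdvdD (h i Pi) hx].
Qed.
Lemma pdvdBC k x y : pdvd k (x - y) -> pdvd k (y - x).
Proof. by move/pdvdN; rewrite opprB. Qed.
Lemma pdvdB_trans k x y z : pdvd k (x - y) -> pdvd k (y - z) -> pdvd k (x - z).
Proof. by move=> h1 /(pdvdD h1); rewrite addrA subrK. Qed.
Lemma pdvdXB k x y n : pdvd k (x - y) -> pdvd k (x ^+ n - y ^+ n).
Proof. by move=> h; rewrite subrXX; apply: pdvdMr. Qed.
End Divisibility.

Section Witt.
Variables (p : nat) (F : finFieldType) (W : comUnitRingType).
Variable res : {rmorphism W -> F}.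
Hypotheses (p_prime : prime p) (witt : is_witt p res).
Local Notation dvd := (pdvd (p%:R : W)).
Local Notation T := (teichmuller res).

Lemma charF : p \in [pchar F].
Proof.
have [_ _ _ _ h] := witt; rewrite inE p_prime -(rmorph_nat res) /=.
by apply/eqP; apply/h; exists 1; rewrite mulr1.
Qed.

Lemma res0P x : res x = 0 <-> dvd 1 x.
Proof. by have [_ _ _ _ h] := witt; rewrite h /pdvd expr1. Qed.

Lemma res_eqP x y : res x = res y <-> dvd 1 (x - y).
Proof.
by rewrite -res0P rmorphB; split=> [->|/eqP]; rewrite ?subrr // subr_eq0 => /eqP.
Qed.

Lemma mulpI k (x y : W) : p%:R ^+ k * x = p%:R ^+ k * y -> x = y.
Proof.
have [h _ _ _ _] := witt.
move=> /eqP; rewrite -subr_eq0 -mulrBr => /eqP e; apply/eqP; rewrite -subr_eq0.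
elim: k e => [|k IH]; first by rewrite expr0 mul1r => ->.
by rewrite exprS -mulrA => /h/IH.
Qed.

Lemma pdvd_cancel k l x : dvd (k + l) (p%:R ^+ k * x) -> dvd l x.
Proof. by move=> [y]; rewrite exprD -mulrA => /mulpI ->; exists y. Qed.

Lemma witt_sep x : (forall k, dvd k x) -> x = 0.
Proof. by have [_ h _ _ _] := witt; apply: h. Qed.

Lemma witt_sep_eq x y : (forall k, dvd k (x - y)) -> x = y.
Proof. by move/witt_sep/eqP; rewrite subr_eq0 => /eqP. Qed.

Lemma witt_complete (w : nat -> W) : (forall k, dvd k (w k.+1 - w k)) ->
  exists l, forall k, dvd k (w k - l).
Proof. by have [_ _ h _ _] := witt; apply: h. Qed.

(** The inverse is the geometric series. *)
Lemma unit_1p x : dvd 1 x -> 1 + x \is a GRing.unit.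
Proof.
move=> hx; have [l hl] : exists l, forall k, dvd k (\sum_(i < k) (- x) ^+ i - l).
  apply: witt_complete => k; rewrite big_ord_recr /= addrAC subrr add0r.
  by have := pdvdX k (pdvdN hx); rewrite mul1n.
apply/unitrPr; exists l; apply/esym/witt_sep_eq => k.
have -> : 1 - (1 + x) * l = (- x) ^+ k + (1 + x) * (\sum_(i < k) (- x) ^+ i - l).
  rewrite mulrBr addrA; congr (_ - _).
  have -> : 1 + x = - (- x - 1) by rewrite opprB opprK addrC.
  by rewrite mulNr -subrX1 opprB addrC subrK.
by apply: pdvdD; [have := pdvdX k (pdvdN hx); rewrite mul1n | apply: pdvdMl].
Qed.

Lemma unit_res x : res x != 0 -> x \is a GRing.unit.
Proof.
move=> h; have [_ _ _ sur _] := witt; have [y hy] := sur (res x)^-1.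
have : x * y \is a GRing.unit.
  rewrite -[x * y](subrK 1) addrC; apply: unit_1p; apply/res_eqP.
  by rewrite rmorphM hy divff ?rmorph1.
by rewrite unitrM => /andP [].
Qed.

Lemma unit_natr m : coprime p m -> (m%:R : W) \is a GRing.unit.
Proof.
move=> cop; apply: unit_res; rewrite rmorph_nat -(dvdn_pcharf charF).
by rewrite -prime_coprime.
Qed.

Lemma mulrnI_witt m (x y : W) : (0 < m)%N -> m%:R * x = m%:R * y -> x = y.
Proof.
move=> m0; have [k [l ndvd ->]] : exists k, exists2 l, coprime p l & m = (p ^ k * l)%N.
  exists (logn p m), (m`_p^')%N.
    by rewrite prime_coprime // -p'natE // part_pnat.
  by rewrite -p_part partnC.
rewrite natrM natrX -!mulrA => /mulpI; apply: mulrI; exact: unit_natr.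
Qed.

(** The cofactor of [x - y] in [x ^ p - y ^ p] is a sum of [p] terms that are
    congruent to each other. *)
Lemma pdvd_expp k x y : (0 < k)%N -> dvd k (x - y) -> dvd k.+1 (x ^+ p - y ^+ p).
Proof.
move=> k0 h; rewrite subrXX -addn1; apply: pdvdM => //; apply/res0P.
have e : res x = res y by apply/res_eqP; apply: (pdvd_le _ h).
rewrite rmorph_sum (eq_bigr (fun _ => res y ^+ p.-1)) => [|i _]; last first.
  rewrite rmorphM !rmorphXn e -exprD; congr (_ ^+ _).
  by have := ltn_ord i; lia.
by rewrite sumr_const card_ord -mulr_natr (pcharf0 charF) mulr0.
Qed.

Lemma pdvd_expppow k j x y : (0 < k)%N -> dvd k (x - y) ->
  dvd (k + j) (x ^+ (p ^ j) - y ^+ (p ^ j)).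
Proof.
move=> k0 h; elim: j => [|j IH]; first by rewrite addn0 !expr1.
by rewrite addnS expnSr !exprM; apply: pdvd_expp => //; rewrite addn_gt0 k0.
Qed.

Section Teichmuller.
Variable n : nat.
Hypotheses (n_gt0 : (0 < n)%N) (cardF : #|F| = (p ^ n)%N).

Lemma teich_unique x y : res x = res y -> x ^+ #|F| = x -> y ^+ #|F| = y -> x = y.
Proof.
move=> /res_eqP e hx hy; apply: witt_sep_eq => k.
have fixX (z : W) j : z ^+ #|F| = z -> z ^+ (p ^ (n * j)) = z.
  by move=> hz; elim: j => [|j IH]; rewrite ?muln0 ?expr1 // mulnS expnD exprM -cardF hz.
rewrite -(fixX x k) // -(fixX y k) //.
apply: (pdvd_le _ (@pdvd_expppow 1 (n * k) _ _ isT e)).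
by rewrite add1n leqW // leq_pmull.
Qed.

(** The representative is the limit of [x ^ (p ^ (n k))] for any lift [x]. *)
Lemma teichP a : res (T a) = a /\ T a ^+ #|F| = T a.
Proof.
have [_ _ _ sur _] := witt; have [x hx] := sur a.
have e1 : dvd 1 (x ^+ (p ^ n) - x).
  by apply/res_eqP; rewrite rmorphXn -cardF expf_card.
have [l hl] : exists l, forall k, dvd k (x ^+ (p ^ (n * k)) - l).
  apply: witt_complete => k; rewrite mulnS expnD exprM.
  apply: (pdvd_le _ (@pdvd_expppow 1 (n * k) _ _ isT e1)).
  by rewrite add1n leqW // leq_pmull.
have hres : res l = a.
  have /res_eqP <- := hl 1%N.
  by rewrite muln1 rmorphXn -cardF expf_card.
have hfix : l ^+ #|F| = l.
  apply: witt_sep_eq => k.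
  apply: (@pdvdB_trans _ _ _ _ (x ^+ (p ^ (n * k.+1)))).
    by rewrite mulnSr expnD exprM -cardF; apply: pdvdXB; apply: pdvdBC.
  by apply: (pdvd_le _ (hl k.+1)).
rewrite /teichmuller; case: xgetP => [y _ hy|/(_ l)] //.
by case.
Qed.

Lemma res_teich a : res (T a) = a. Proof. by have [] := teichP a. Qed.

Lemma teichE a x : res x = a -> x ^+ #|F| = x -> T a = x.
Proof.
by move=> ha h; have [h1 h2] := teichP a; apply: teich_unique; rewrite ?h1 ?ha.
Qed.

Lemma teichM a b : T (a * b) = T a * T b.
Proof.
have [ra fa] := teichP a; have [rb fb] := teichP b.
by apply: teichE; rewrite ?rmorphM ?ra ?rb // exprMn fa fb.
Qed.

Lemma teich1 : T 1 = 1.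
Proof. by apply: teichE; rewrite ?rmorph1 ?expr1n. Qed.

Lemma teich0 : T 0 = 0.
Proof.
apply: teichE; rewrite ?rmorph0 // expr0n.
by rewrite cardF expn_eq0 eqn0Ngt prime_gt0.
Qed.

Lemma teich_unit a : a != 0 -> T a \is a GRing.unit.
Proof. by move=> h; apply: unit_res; rewrite res_teich. Qed.

Lemma teich_lift (s : F -> F) (g : {rmorphism W -> W}) a :
  (forall x, res (g x) = s (res x)) -> g (T a) = T (s a).
Proof.
move=> h; apply/esym; apply: teichE; first by rewrite h res_teich.
by rewrite -rmorphXn; have [_ ->] := teichP a.
Qed.

Lemma witt_decomp x : exists y, x = T (res x) + p%:R * y.
Proof.
have /res_eqP [y] : res x = res (T (res x)) by rewrite res_teich.
by rewrite expr1 => e; exists y; rewrite -e addrC subrK.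
Qed.

(** A ring endomorphism is determined by the map it induces on the residue
    field, because it is determined on Teichmueller representatives. *)
Lemma lift_unique (s : F -> F) (g h : {rmorphism W -> W}) :
  (forall x, res (g x) = s (res x)) -> (forall x, res (h x) = s (res x)) ->
  g =1 h.
Proof.
move=> hg hh x; apply: witt_sep_eq => k.
elim: k x => [|k IH] x; first exact: pdvd_0.
have [y ->] := witt_decomp x; rewrite !rmorphD !rmorphM !rmorph_nat.
rewrite (teich_lift _ hg) (teich_lift _ hh) opprD addrACA subrr add0r -mulrBr.
rewrite -add1n; apply: pdvdM; last exact: IH.
by have := pdvd_self (p%:R : W) 1; rewrite expr1.
Qed.

Lemma frob_fixed_nat (a : F) : a ^+ p = a -> exists i : nat, a = i%:R.
Proof.
move=> ha; have chF := charF.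
case: (pselect (exists i : nat, a = i%:R)) => // h; exfalso.
pose P : {poly F} := 'X^p - 'X.
have szP : size P = p.+1.
  by rewrite size_polyDl size_polyXn // size_polyN size_polyX ltnS prime_gt1.
have P0 : P != 0 by rewrite -size_poly_eq0 szP.
pose rs : seq F := a :: [seq i%:R | i <- iota 0 p].
have : (size rs < size P)%N.
  apply: max_poly_roots => //.
    apply/allP => x; rewrite inE => /orP [/eqP ->|/mapP [i _ ->]]; rewrite rootE !hornerE.
      by rewrite ha subrr.
    by rewrite natr_exp_p // subrr.
  rewrite /rs /=; apply/andP; split.
    by apply/negP => /mapP [i _ e]; apply: h; exists i.
  rewrite map_inj_in_uniq ?iota_uniq // => i j; rewrite !mem_iota !add0n /= => hi hj.
  move/eqP; wlog hij : i j hi hj / (i <= j)%N.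
    by move=> H; case: (leqP i j) => h' e; [|apply/esym]; apply: H => //;
      rewrite ?(ltnW h') // eq_sym.
  rewrite eq_sym -subr_eq0 -natrB // -(dvdn_pcharf chF) => hd.
  case: (posnP (j - i)) => [|h0]; first by lia.
  by have := dvdn_leq h0 hd; lia.
by rewrite szP /= size_map size_iota ltnn.
Qed.

(** An element fixed by the Frobenius lift is congruent to an integer modulo [p],
    the difference being [p] times another fixed element; iterating, it is a limit
    of integers. *)
Lemma frob_fixed (s : {rmorphism F -> F}) (g frob : {rmorphism W -> W}) x :
  is_frobenius_lift p res frob -> (forall x, res (g x) = s (res x)) ->
  frob x = x -> g x = x.
Proof.
move=> hf hg hx; apply: witt_sep_eq => k.
elim: k x hx => [|k IH] x hx; first exact: pdvd_0.
have [i hi] : exists i : nat, res x = i%:R.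
  by apply: frob_fixed_nat; rewrite -hf hx.
have /res_eqP [y hy] : res x = res i%:R by rewrite rmorph_nat.
have E : x = i%:R + p%:R * y by rewrite -[p%:R]expr1 -hy addrC subrK.
have hy' : frob y = y.
  move: hx; rewrite E rmorphD rmorphM !rmorph_nat => /addrI.
  by rewrite -[p%:R]expr1 => /mulpI.
rewrite E rmorphD rmorphM !rmorph_nat opprD addrACA subrr add0r -mulrBr.
rewrite -add1n; apply: pdvdM; last exact: IH.
by have := pdvd_self (p%:R : W) 1; rewrite expr1.
Qed.

End Teichmuller.
End Witt.
(** * Endomorphisms of the Honda formal group law *)

Section Homs.
Variables (R : comNzRingType) (G G' : mps 2 R).
Hypothesis fG : is_fgl G.

Lemma hom_vdeg f : is_fgl_hom G G' f -> vdeg 1 f.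
Proof. by move=> [/vdeg1P]. Qed.

Lemma hom_fadd f l (a b : mps l R) : is_fgl_hom G G' f -> vdeg 1 a -> vdeg 1 b ->
  ps_comp f (fadd G a b) = fadd G' (ps_comp f a) (ps_comp f b).
Proof.
move=> hf a0 b0; have f0 := hom_vdeg hf; case: hf => _ e.
pose h (i : 'I_2) := if i == ord0 then a else b.
have h0 i : vdeg 1 (h i) by rewrite /h; case: eqP.
have X0 (i : 'I_2) : vdeg 1 (mpsX i : mps 2 R) by apply: vdeg_mpsX.
have compX i : mps_subst (ps_comp f (mpsX i)) h = ps_comp f (h i).
  by rewrite /ps_comp subst_comp //; apply: eq_subst => _; rewrite substX.
have -> : ps_comp f (fadd G a b) = mps_subst (ps_comp f (fadd G (mpsX ord0) (mpsX ord_max))) h.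
  rewrite /ps_comp subst_comp //; last by move=> _; apply: vdeg_fadd.
  by apply: eq_subst => _; rewrite fadd_subst // !substX.
by rewrite e fadd_subst ?compX //; apply: vdeg_comp.
Qed.

Lemma hom_fsum f l I (s : seq I) (a : I -> mps l R) : is_fgl_hom G G' f ->
  (forall i, vdeg 1 (a i)) ->
  ps_comp f (fsum G (map a s)) = fsum G' [seq ps_comp f (a i) | i <- s].
Proof.
move=> hf a0; have f0 := hom_vdeg hf.
elim: s => [|i s IH] /=; last by rewrite hom_fadd ?IH //; apply: fsum_vdegF.
have e : eqdeg 1 f 0 by move=> m /f0 ->.
apply: eqdeg_eq => N m _; rewrite pcoef0 /ps_comp pcoef_substE big1 // => c _.
case: (posnP (mdeg (c : 'X_{1..1}))) => [|c0].
  by move/eqP; rewrite mdeg_eq0 => /eqP ->; case: hf => -> _; rewrite mul0r.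
have : vdeg (mdeg m).+1 (mmap1 (fun=> (0 : mps l R)) (c : 'X_{1..1})).
  rewrite /mmap1 big_ord1 -[mdeg _]/(mdeg _) (_ : 0 ^+ _ = 0) //.
  by rewrite expr0n; move: c0; rewrite mdegE big_ord1 => /gtn_eqF ->.
by move=> ->; rewrite ?mulr0.
Qed.
End Homs.

Lemma fsum_single (R : comNzRingType) (G : mps 2 R) l (I : eqType) (s : seq I)
    (f : I -> mps l R) j :
  is_fgl G -> vdeg 1 (f j) -> uniq s -> j \in s -> (forall i, i != j -> f i = 0) ->
  fsum G (map f s) = f j.
Proof.
move=> fG fj us js h.
have Z (t : seq I) : j \notin t -> fsum G (map f t) = 0.
  elim: t => //= i t IH; rewrite in_cons negb_or eq_sym => /andP [/h -> /IH ->].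
  exact: faddr0.
elim: s us js => // i s IH /= /andP [nis us]; rewrite in_cons.
case: (eqVneq j i) => [e _|ne /= js]; first by rewrite -e Z ?faddr0 // e.
by rewrite IH // h ?fadd0r // eq_sym.
Qed.

Lemma cf_fsum_low (R : comNzRingType) (G : mps 2 R) M (s : seq (mps 1 R)) :
  is_fgl G -> (0 < M)%N -> (forall a, a \in s -> vdeg M a) ->
  vdeg M (fsum G s) /\ cf (fsum G s) M = \sum_(a <- s) cf a M.
Proof.
move=> fG M0; elim: s => [|a s IH] h; first by rewrite big_nil.
have a0 : vdeg M a by apply: h; rewrite mem_head.
have hs b : b \in s -> vdeg M b by move=> hb; apply: h; rewrite in_cons hb orbT.
have [v e] := IH hs; split; first exact: vdegN_fadd.
have /eqdegP/(_ M (ltnSn _)) := fadd_low fG M0 a0 v.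
by rewrite /= => ->; rewrite cfD e big_cons.
Qed.

(** The conjugate of a Honda formal group law is again one, and there is only one. *)
Lemma gal_honda p n (F : finFieldType) (H : mps 2 F) (s : {rmorphism F -> F}) :
  p \in [pchar F] -> is_honda p n H -> mps_map s H = H.
Proof.
move=> chF hH; have [fH tH sH] := hH.
apply: (honda_unique chF (fgl_map fH s) fH _ hH); split.
- exact: fgl_map.
- move=> q q_prime qp S j z hz.
  exact: (tH q q_prime qp S (j \o s : {rmorphism F -> S}) z hz).
rewrite /p_series -(mps_map_psX s) -map_nseq -fsum_map -/(p_series p H) sH.
by rewrite mps_mapXn.
Qed.

(** In characteristic [p] the [p]-th power of a series is obtained by raising the
    coefficients and the variable to the power [p]. *)
Lemma comp_frob p (F : fieldType) (chF : p \in [pchar F]) (f : mps 1 F) :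
  f ^+ p = ps_comp (mps_map (pFrobenius_aut chF) f) (psX ^+ p).
Proof.
have p0 := prime_gt0 (pcharf_prime chF).
have chP : p \in [pchar (mps 1 F)].
  by rewrite inE (pcharf_prime chF) -(rmorph_nat mpsC) (pcharf0 chF) rmorph0 eqxx.
have X0 (i : 'I_1) : vdeg 1 (psX ^+ p : mps 1 F).
  exact: (vdeg_le p0 (@vdeg_psXn _ p)).
apply: eqdeg_eq => N; elim: N f => [|N IH] f //.
rewrite (shiftE f) mps_mapD mps_mapM mps_mapC mps_map_psX.
rewrite /ps_comp substD substM // substC // substX //.
rewrite -(pFrobenius_autE chP) pFrobenius_autD_comm; last exact: mulrC.
rewrite !pFrobenius_autE -rmorphXn exprMn.
apply: eqdegD; first exact: eqdeg_refl.
apply/eqdegB; rewrite -mulrBr -[N.+1]add1n; apply: vdegM; first exact: (X0 ord0).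
by apply/eqdegB; apply: IH.
Qed.

(** * Coordinates and determinant *)

Section Coordinates.
Variables (p m : nat) (F : finFieldType) (W : comUnitRingType).
Local Notation n := m.+1.
Variable res : {rmorphism W -> F}.
Hypotheses (p_prime : prime p) (cardF : #|F| = (p ^ n)%N) (witt : is_witt p res).
Variable H : mps 2 F.
Hypothesis honda : is_honda p n H.
Variable rho : W -> mps 1 F.
Hypothesis rhoP : is_witt_mult res H rho.
Local Notation dvd := (pdvd (p%:R : W)).

Let fH : is_fgl H. Proof. by have [] := honda. Qed.
Let chF : p \in [pchar F]. Proof. exact: charF p_prime witt. Qed.
Let p0 : (0 < p)%N. Proof. exact: prime_gt0. Qed.
Let p1 : (1 < p)%N. Proof. exact: prime_gt1. Qed.
Let pk0 k : (0 < p ^ k)%N. Proof. by rewrite expn_gt0 p0. Qed.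

Let X0 k : vdeg 1 (psX ^+ (p ^ k) : mps 1 F).
Proof. exact: (vdeg_le (pk0 k) (@vdeg_psXn _ _)). Qed.

Lemma rho_hom w : is_fgl_hom H H (rho w).
Proof. by have [] := rhoP. Qed.

Lemma rho_vdeg w : vdeg 1 (rho w).
Proof. exact: hom_vdeg (rho_hom w). Qed.

Lemma rhoD a b : rho (a + b) = fadd H (rho a) (rho b).
Proof. by have [] := rhoP. Qed.

Lemma rhoM a b : rho (a * b) = ps_comp (rho a) (rho b).
Proof. by have [] := rhoP. Qed.

Lemma rho_teich a : rho (teichmuller res a) = mpsC a * psX.
Proof. by have [] := rhoP. Qed.

Lemma rho0 : rho 0 = 0.
Proof. by rewrite -(teich0 p_prime witt (ltn0Sn m) cardF) rho_teich rmorph0 mul0r. Qed.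

Lemma rho1 : rho 1 = psX.
Proof. by rewrite -(teich1 p_prime witt (ltn0Sn m) cardF) rho_teich rmorph1 mul1r. Qed.

Lemma rho_p : rho p%:R = psX ^+ (p ^ n).
Proof.
have [_ _ <-] := honda; rewrite /p_series.
elim: p => [|k IH]; first exact: rho0.
by rewrite mulrS rhoD IH rho1.
Qed.

Lemma rho_pM w : rho (p%:R * w) = ps_comp (rho w) (psX ^+ (p ^ n)).
Proof. by rewrite mulrC rhoM rho_p. Qed.

Lemma lead_rho w : lead (rho w) = res w.
Proof.
have [y e] := witt_decomp p_prime witt (ltn0Sn m) cardF w; rewrite {1}e rhoD rho_pM.
rewrite (lead_fadd fH (rho_vdeg _)); last by apply: vdeg_comp => //; apply: rho_vdeg.
rewrite rho_teich lead_comp // [lead (psX ^+ _)]leadE cfXn.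
have -> : (1 == p ^ n)%N = false by rewrite ltn_eqF // -{1}(expn0 p) ltn_exp2l.
by rewrite mulr0 addr0 leadE cfCM -[psX]expr1 cfXn mulr1.
Qed.

(** Both sides are additive and agree on Teichmueller representatives.  Each
    further [p]-adic digit only changes them in degrees [p ^ n] times higher,
    because [p] acts as [x ^ (p ^ n)]. *)
Lemma rho_gal (s : {rmorphism F -> F}) (g : {rmorphism W -> W}) w :
  (forall x, res (g x) = s (res x)) -> mps_map s (rho w) = rho (g w).
Proof.
move=> hg; apply: eqdeg_eq => N.
apply: (@eqdeg_le _ _ (p ^ (n * N))).
  by apply: leq_trans (ltnW (ltn_expl N p1)) _; rewrite leq_exp2l // leq_pmull.
elim: N w => [|N IH] w.
  rewrite muln0; apply/eqdegB; apply: vdegB; last exact: rho_vdeg.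
  by apply: vdeg_map; apply: rho_vdeg.
have [y ->] := witt_decomp p_prime witt (ltn0Sn m) cardF w.
rewrite rmorphD rmorphM rmorph_nat (teich_lift p_prime witt (ltn0Sn m) cardF _ hg).
rewrite !rhoD !rho_pM !rho_teich fadd_map (gal_honda s chF honda).
rewrite mps_mapM mps_mapC mps_map_psX mps_map_comp1 mps_mapXn mps_map_psX.
apply: eqdeg_fadd; [exact: vdeg_line| | exact: eqdeg_refl|].
  by apply: vdeg_comp => //; apply: vdeg_map; apply: rho_vdeg.
apply/eqdegB; rewrite /ps_comp -substB mulnS addnC expnD.
by apply: vdeg_substr => [_|]; [exact: vdeg_psXn | apply/eqdegB].
Qed.

(** ** Coordinates *)

(** The endomorphism [sum_i c_i S ^ i] and its terms [c_i S ^ i]. *)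
Definition term (w : W) i : mps 1 F := ps_comp (rho w) (psX ^+ (p ^ i)).
Definition endo (c : 'I_n -> W) : mps 1 F :=
  fsum H [seq term (c i) i | i : 'I_n <- enum 'I_n].

Lemma term_vdeg w i : vdeg 1 (term w i).
Proof. by apply: vdeg_comp => //; apply: rho_vdeg. Qed.

Lemma term_vdegX w i : vdeg (p ^ i) (term w i).
Proof.
rewrite -[(p ^ i)%N]mul1n; apply: vdeg_substr (rho_vdeg w) => _.
exact: vdeg_psXn.
Qed.

Lemma termD a b i : term (a + b) i = fadd H (term a i) (term b i).
Proof. by rewrite /term rhoD /ps_comp fadd_subst //; apply: rho_vdeg. Qed.

Lemma term0 i : term 0 i = 0.
Proof. by rewrite /term rho0 /ps_comp subst0. Qed.

Lemma term_comp w i k : ps_comp (term w i) (psX ^+ (p ^ k)) = term w (i + k).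
Proof. by rewrite /term ps_compA // psXn_comp // -exprM mulnC -expnD. Qed.

Lemma term_p w i : term (p%:R * w) i = term w (n + i).
Proof. by rewrite {1}/term rho_pM -/(term w n) term_comp. Qed.

Lemma endo_vdeg c : vdeg 1 (endo c).
Proof. by apply: fsum_vdegF => // i; apply: term_vdeg. Qed.

Lemma endoD c d : endo (fun i => c i + d i) = fadd H (endo c) (endo d).
Proof.
rewrite -fsum_fadd //; try by move=> i; apply: term_vdeg.
by congr (fsum H _); apply: eq_map => i; rewrite termD.
Qed.

Lemma endo_delta (j : 'I_n) : endo (fun i => (i == j)%:R) = psX ^+ (p ^ j).
Proof.
rewrite /endo (@fsum_single _ _ _ _ _ _ j) ?mem_enum ?enum_uniq //.
- by rewrite eqxx /term rho1 psX_comp.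
- exact: term_vdeg.
by move=> i /negPf ->; rewrite term0.
Qed.

Lemma endo0 : endo (fun=> 0) = 0.
Proof.
rewrite /endo (@fsum_single _ _ _ _ _ _ ord0) ?mem_enum ?enum_uniq //.
- exact: term0.
- exact: term_vdeg.
by move=> i _; apply: term0.
Qed.

Lemma rho_comp_endo w c : ps_comp (rho w) (endo c) = endo (fun i => w * c i).
Proof.
rewrite /endo (hom_fsum fH (enum _) (rho_hom w)) => [|i]; last exact: term_vdeg.
congr (fsum H _); apply: eq_map => i; rewrite /term rhoM ps_compA //.
exact: rho_vdeg.
Qed.

Lemma fsum_endo I (s : seq I) (f : I -> 'I_n -> W) :
  fsum H [seq endo (f i) | i <- s] = endo (fun l => \sum_(i <- s) f i l).
Proof.
elim: s => [|i s IH] /=.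
  by rewrite -endo0; congr endo; apply/funext => l; rewrite big_nil.
by rewrite IH -endoD; congr endo; apply/funext => l; rewrite big_cons.
Qed.

Lemma endo_p c : endo (fun i => p%:R * c i) = ps_comp (endo c) (psX ^+ (p ^ n)).
Proof.
rewrite /endo /ps_comp fsum_subst //; last by move=> i; apply: term_vdeg.
congr (fsum H _); apply: eq_map => i.
by rewrite -/(ps_comp _ _) term_comp term_p addnC.
Qed.

(** If [c_l] is divisible by [p], its term starts in degree at least [p ^ n]; the
    terms after the [i]-th start beyond degree [p ^ i]. *)
Lemma cf_endo c (i : 'I_n) : (forall l : 'I_n, (l < i)%N -> res (c l) = 0) ->
  cf (endo c) (p ^ i) = res (c i).
Proof.
move=> h.
have low (l : 'I_n) : (l < i)%N -> vdeg (p ^ i).+1 (term (c l) l).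
  move=> li; have /(res0P witt) [y ->] := h l li; rewrite expr1 term_p.
  apply: (vdeg_le _ (@term_vdegX _ _)); rewrite ltn_exp2l //.
  by apply: leq_trans (ltn_ord i) _; rewrite leq_addr.
have [|_] := @cf_fsum_low _ H (p ^ i) [seq term (c l) l | l : 'I_n <- enum 'I_n] fH (pk0 i).
  move=> a /mapP [l _ ->]; case: (leqP i l) => il.
    by apply: (vdeg_le _ (@term_vdegX _ _)); rewrite leq_exp2l.
  by apply: (vdeg_le _ (low l il)).
rewrite -/(endo c) => ->; rewrite big_map big_enum /= (bigD1 i) //= big1 => [|l li].
  by rewrite addr0 /term -[X in cf _ X]muln1 cf_compXn // -leadE lead_rho.
case: (ltngtP i l) => [il|il|/val_inj e]; last by rewrite e eqxx in li.
  by apply: (proj1 (vdegP _ _) (@term_vdegX (c l) l)); rewrite ltn_exp2l.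
by apply: (proj1 (vdegP _ _) (low l il)).
Qed.

Lemma lead_endo c : lead (endo c) = res (c ord0).
Proof. by rewrite leadE -(expn0 p) -[0%N]/(val (ord0 : 'I_n)) cf_endo. Qed.

(** The coordinates of an endomorphism depend [p]-adically continuously on its
    coefficients: the coordinates of an endomorphism that vanishes below degree
    [p ^ n] are divisible by [p], and dividing them by [p] undoes the
    substitution of [x ^ (p ^ n)]. *)
Lemma endo_dvd k c : vdeg (p ^ (n * k)) (endo c) -> forall i, dvd k (c i).
Proof.
elim: k c => [|k IH] c hc i; first exact: pdvd_0.
have r l : res (c l) = 0.
  have [N] := ubnP l; elim: N l => // N IHN l lN.
  rewrite -cf_endo => [|l' hl']; last by apply: IHN; apply: leq_trans hl' _.
  apply: (proj1 (vdegP _ _) hc); rewrite ltn_exp2l //.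
  by apply: leq_trans (ltn_ord l) _; rewrite leq_pmulr.
have /choice [d hd] : forall l, exists y, c l = p%:R * y.
  by move=> l; have /(res0P witt) [y ->] := r l; exists y; rewrite expr1.
have hcd : endo c = ps_comp (endo d) (psX ^+ (p ^ n)).
  by rewrite -endo_p; congr endo; apply/funext => l.
rewrite hd -add1n; apply: pdvdM; first by exists 1; rewrite mulr1 expr1.
apply: IH; apply/vdegP => l hl; rewrite -(cf_compXn _ _ (pk0 n)) -hcd.
by apply: (proj1 (vdegP _ _) hc); rewrite mulnS expnD ltn_pmul2l.
Qed.

Lemma endo_dvdB k c d : eqdeg (p ^ (n * k)) (endo c) (endo d) ->
  forall i, dvd k (c i - d i).
Proof.
move=> h; apply: endo_dvd; rewrite (endoD c (fun i => - d i)).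
have e : fadd H (endo d) (endo (fun i => - d i)) = 0.
  by rewrite -endoD -endo0; congr endo; apply/funext => l; rewrite subrr.
have := @eqdeg_fadd _ H _ _ _ _ _ _ (endo_vdeg c) (endo_vdeg (fun i => - d i)) h eqdeg_refl.
by rewrite e.
Qed.

Lemma endo_inj c d : endo c = endo d -> c = d.
Proof.
move=> e; apply/funext => i; apply: (witt_sep_eq witt) => k.
by apply: endo_dvdB; rewrite e; apply: eqdeg_refl.
Qed.

Lemma endo_gal (s : {rmorphism F -> F}) (g : {rmorphism W -> W}) c :
  (forall x, res (g x) = s (res x)) -> mps_map s (endo c) = endo (fun i => g (c i)).
Proof.
move=> hg; rewrite /endo fsum_map (gal_honda s chF honda) -map_comp.
congr (fsum H _); apply: eq_map => i /=.
by rewrite /term mps_map_comp1 (rho_gal _ hg) mps_mapXn mps_map_psX.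
Qed.


(** ** The matrix of an endomorphism *)
Variable frob : {rmorphism W -> W}.
Hypothesis frobP : is_frobenius_lift p res frob.
Local Notation M := (coord_matrix p frob).
Implicit Types c d : 'I_n -> W.

(** The coordinates of [S g], computed from [S a = a^phi S] and [S ^ n = p]. *)
Definition twist c : 'I_n -> W := fun i =>
  \sum_(k < n | (k.+1 %% n == i)%N) p%:R ^+ (k.+1 %/ n)%N * frob (c k).

Lemma twistE c (i : 'I_n) : twist c i =
  \sum_(k < n | (k.+1 %% n == i)%N) p%:R ^+ (k.+1 %/ n)%N * frob (c k).
Proof. by []. Qed.

Lemma twist0 c : twist c ord0 = p%:R * frob (c ord_max).
Proof.
rewrite /twist (big_pred1 ord_max) => [|k]; first by rewrite /= divnn expr1.
rewrite /= -val_eqE /=; have := ltn_ord k; rewrite leq_eqVlt => /orP [/eqP h|h].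
  by rewrite h modnn; apply/esym/eqP; case: h.
by rewrite modn_small //; apply/esym/negbTE; lia.
Qed.

Lemma twistS c (k : 'I_m) : twist c (lift ord0 k) = frob (c (widen_ord (leqnSn m) k)).
Proof.
rewrite /twist (big_pred1 (widen_ord (leqnSn m) k)) => [|l].
  by rewrite /= divn_small ?mul1r // ltnS.
rewrite /= -val_eqE /= /bump /= add1n; have := ltn_ord l; rewrite leq_eqVlt => /orP [/eqP [h]|h].
  by rewrite h modnn; have := ltn_ord k; lia.
by rewrite modn_small // eqSS.
Qed.

Lemma endo_twist c : endo (twist c) = endo c ^+ p.
Proof.
rewrite (comp_frob chF) (endo_gal (g := frob)) //.
pose t (w : W) i := term w i.
have tv w i : vdeg 1 (t w i) by apply: (term_vdeg).
rewrite /endo /ps_comp fsum_subst //; last first.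
  by move=> _; have := X0 1; rewrite expn1.
have -> : [seq mps_subst (term (frob (c i)) i) (fun=> psX ^+ p) | i : 'I_n <- enum 'I_n]
  = [seq t (frob (c i)) i.+1 | i : 'I_n <- enum 'I_n].
  apply: eq_map => i; rewrite -/(ps_comp _ _) -[in LHS](expn1 p).
  by rewrite (term_comp) addn1.
rewrite [in RHS]enum_ordSr [in LHS]enum_ordSl map_rcons -cats1 /= -!map_comp.
rewrite fsum_cat //; last 2 first.
- by move=> a /mapP [i _ ->]; apply: tv.
- by move=> a; rewrite inE => /eqP ->; apply: tv.
have -> : fsum H [:: t (frob (c ord_max)) m.+1] = term (twist c ord0) 0.
  by rewrite /= faddr0 // twist0 (term_p) addn0.
rewrite faddC //; last by apply: fsum_vdegF => // i; apply: tv.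
by congr (fadd H (fsum H _) _); apply: eq_map => i /=; rewrite twistS.
Qed.

Lemma endo_iter_twist k c : endo (iter k twist c) = endo c ^+ (p ^ k).
Proof. by elim: k => //= k IH; rewrite endo_twist IH -exprM expnSr. Qed.

Lemma iter_twistE j c i : iter j twist c i =
  \sum_(k < n | ((k + j) %% n == i)%N) p%:R ^+ ((k + j) %/ n)%N * iter j frob (c k).
Proof.
elim: j i => [|j IH] i /=.
  rewrite (big_pred1 i) => [|k]; rewrite addn0 ?modn_small ?val_eqE //.
  by rewrite divn_small // mul1r.
have modP (l : nat) : (l %% n < n)%N by rewrite ltn_mod.
rewrite twistE.
transitivity (\sum_(l < n | (l.+1 %% n == i)%N) \sum_(k < n | ((k + j) %% n == l)%N)
    p%:R ^+ (l.+1 %/ n)%N * frob (p%:R ^+ ((k + j) %/ n)%N * iter j frob (c k))).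
  by apply: eq_bigr => l _; rewrite IH rmorph_sum mulr_sumr.
rewrite (exchange_big_dep xpredT) //= [RHS]big_mkcond /=; apply: eq_bigr => k _.
rewrite addnS -[(k + j).+1]addn1.
case: eqP => h; last first.
  rewrite big1 // => l /andP [/eqP e1 /eqP e2]; case: h.
  by rewrite -e1 -e2 -[((k + j) %% n).+1%N]addn1 modnDml.
rewrite (big_pred1 (Ordinal (modP (k + j)%N))) /= => [|l]; last first.
  rewrite /= -val_eqE /= [in RHS]eq_sym; apply/andP/idP => [[_]|/eqP e] //.
  by rewrite -e eqxx -[((k + j) %% n).+1%N]addn1 modnDml h.
rewrite rmorphM rmorphXn rmorph_nat mulrA -exprD; congr (_ ^+ _ * _).
by rewrite -addn1 [in RHS](divn_eq (k + j)%N n) -addnA divnMDl // addnC.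
Qed.

Lemma coord_matrixE c i j : M c i j = iter j twist c i.
Proof. by rewrite mxE iter_twistE. Qed.

(** Expand the left factor and move the powers of [S] through the right one. *)
Lemma endo_comp c d : ps_comp (endo c) (endo d) = endo (fun l => \sum_i c i * iter i twist d l).
Proof.
rewrite {1}/endo /ps_comp fsum_subst //; try by move=> i; first [exact: term_vdeg | exact: endo_vdeg].
have -> : (fun l => \sum_i c i * iter i twist d l)
   = fun l => \sum_(i <- enum 'I_n) c i * iter i twist d l.
  by apply/funext => l; rewrite big_enum.
rewrite -(fsum_endo); congr (fsum H _); apply: eq_map => i.
rewrite -(rho_comp_endo) endo_iter_twist.
rewrite -/(ps_comp _ _) /term ps_compA ?psXn_comp //; exact: endo_vdeg.
Qed.

(** Both sides are the coordinates of [S ^ j f g]. *)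
Lemma iter_twist_comb j c d :
  iter j twist (fun l => \sum_i c i * iter i twist d l)
    = fun l => \sum_i iter j twist c i * iter i twist d l.
Proof.
apply: endo_inj; rewrite endo_iter_twist -!endo_comp endo_iter_twist.
by rewrite /ps_comp substXn // => _; apply: endo_vdeg.
Qed.

(** Column [j] lists the coordinates of [S ^ j f g]; expanding [S ^ j f] in the
    powers [S ^ i] and then each [S ^ i g] gives the matrix of [g] on the left. *)
Lemma coord_matrix_comp c d e : endo e = ps_comp (endo c) (endo d) -> M e = M d *m M c.
Proof.
rewrite endo_comp => /endo_inj ->; apply/matrixP => l j.
rewrite coord_matrixE iter_twist_comb mxE; apply: eq_bigr => i _.
by rewrite !coord_matrixE mulrC.
Qed.

Definition delta0 : 'I_n -> W := fun i => (i == ord0)%:R.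

Lemma endo_delta0 : endo delta0 = psX.
Proof. by rewrite (endo_delta) expn0 expr1. Qed.

Lemma coord_matrix1 : M delta0 = 1%:M.
Proof.
apply/matrixP => l j; rewrite coord_matrixE !mxE.
suff -> : iter j twist delta0 = (fun i => (i == j)%:R) by [].
apply: endo_inj; rewrite endo_iter_twist endo_delta0.
by rewrite (endo_delta).
Qed.

Lemma twist_pow c : iter n twist c = fun i => p%:R * c i.
Proof.
apply: endo_inj; rewrite endo_iter_twist.
rewrite -(rho_comp_endo) (rho_p).
by rewrite psXn_comp //; apply: endo_vdeg.
Qed.

Definition twist_mx : 'M[W]_n := M (twist delta0).

(** The determinant of the matrix of [S] is not a zero divisor, because
    [S ^ n = p]. *)
Lemma det_twist_mx : exists q, \det twist_mx * q = p%:R ^+ n.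
Proof.
exists (\det (M (iter m twist delta0))); rewrite -det_mulmx.
rewrite -(coord_matrix_comp (e := iter n twist delta0)); last first.
  rewrite !endo_iter_twist endo_twist endo_delta0 psXn_comp; first by rewrite -exprM -expnS.
  by have := X0 1; rewrite expn1.
rewrite twist_pow (_ : M _ = p%:R *: M delta0).
  by rewrite coord_matrix1 detZ det1 mulr1.
apply/matrixP => i j; rewrite !mxE mulr_sumr; apply: eq_bigr => k _.
rewrite mulrCA; congr (_ * _); elim: (nat_of_ord j) => //= l ->.
by rewrite rmorphM rmorph_nat.
Qed.

(** The matrices of [S] and [g] satisfy [A(g) A(S) = A(S) A(g)^phi], because both
    sides describe [S g]; taking determinants, [det A(g)] is fixed by [phi]. *)
Lemma coord_matrix_frob c : M c *m twist_mx = twist_mx *m map_mx frob (M c).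
Proof.
rewrite -(coord_matrix_comp (e := twist c)); last first.
  by rewrite !endo_twist endo_delta0 psXn_comp //; apply: endo_vdeg.
have mxtwist d i : twist d i = \sum_k twist_mx i k * frob (d k).
  rewrite twistE big_mkcond /=; apply: eq_bigr => k _.
  rewrite /twist_mx coord_matrixE -iterSr iter_twistE big_mkcond (bigD1 ord0) //=.
  have fr (b : bool) t : iter t frob (b%:R : W) = b%:R.
    by elim: t => //= t ->; rewrite rmorph_nat.
  rewrite big1 => [|l /negPf l0]; last first.
    by rewrite /delta0 l0 -iterS fr mulr0; case: ifP.
  rewrite addr0 add0n /delta0 -iterS fr mulr1.
  by case: ifP => _; rewrite ?mul0r.
apply/matrixP => i j; rewrite coord_matrixE -iterSr /= mxtwist mxE.
by apply: eq_bigr => k _; rewrite [map_mx _ _ _ _]mxE; congr (_ * frob _); rewrite coord_matrixE.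
Qed.

Lemma det_frob c : frob (\det (M c)) = \det (M c).
Proof.
have := congr1 determinant (coord_matrix_frob c); rewrite !det_mulmx -det_map_mx => h.
have [q hq] := det_twist_mx; apply/esym; apply: (mulpI witt (k := n)).
by rewrite -hq ![_ * q]mulrC -!mulrA -h [\det twist_mx * _]mulrC.
Qed.

(** Lifts of commuting maps of the residue field commute. *)
Lemma coord_matrix_gal (s : {rmorphism F -> F}) (g : {rmorphism W -> W}) c :
  (forall x, res (g x) = s (res x)) -> M (fun i => g (c i)) = map_mx g (M c).
Proof.
move=> hg; apply/matrixP => i j; rewrite !mxE rmorph_sum; apply: eq_bigr => k _.
rewrite rmorphM rmorphXn rmorph_nat; congr (_ * _).
elim: (nat_of_ord j) => //= l ->.
apply: (lift_unique p_prime witt (ltn0Sn m) cardF (s := fun x => s x ^+ p)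
  (g := frob \o g) (h := g \o frob)) => x /=; first by rewrite frobP hg.
by rewrite hg frobP rmorphXn.
Qed.

(** Modulo [p] the matrix is lower triangular, with the conjugates of [a_0] on
    the diagonal. *)
Lemma res_det c : res (\det (M c)) = res (c ord0) ^+ rexp p n.
Proof.
have iter_res j x : res (iter j frob x) = res x ^+ (p ^ j).
  by elim: j => [|j IH]; rewrite ?expr1 //= frobP IH -exprM expnSr.
have resp : res p%:R = 0 by rewrite rmorph_nat (pcharf0 chF).
rewrite -det_map_mx det_trig.
  have -> : rexp p n = (\sum_(i < n) p ^ i)%N.
    by rewrite /rexp predn_exp mulKn // -ltnS prednK // prime_gt1.
  rewrite expr_sum; apply: eq_bigr => i _; rewrite !mxE rmorph_sum (bigD1 ord0) /=; last first.
    by rewrite add0n modn_small.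
  rewrite add0n divn_small // mul1r iter_res big1 ?addr0 // => k /andP [/eqP h k0].
  rewrite rmorphM rmorphXn resp.
  case: (leqP n (k + i)) => hn.
    have : (0 < (k + i) %/ n)%N by rewrite divn_gt0.
    by case: ((k + i) %/ n)%N => // l _; rewrite expr0n mul0r.
  move: h; rewrite modn_small // => h; case/eqP: k0; apply: val_inj => /=; lia.
apply/is_trig_mxP => i j ij; rewrite !mxE rmorph_sum big1 // => k /eqP h.
rewrite rmorphM rmorphXn resp.
case: (leqP n (k + j)) => hn.
  have : (0 < (k + j) %/ n)%N by rewrite divn_gt0.
  by case: ((k + j) %/ n)%N => // l _; rewrite expr0n mul0r.
by move: h; rewrite modn_small // => h; lia.
Qed.

Lemma det_cong k c d : (forall i, pdvd (p%:R : W) k (c i - d i)) ->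
  pdvd (p%:R : W) k (\det (M c) - \det (M d)).
Proof.
move=> h.
have hM i j : pdvd (p%:R : W) k (M c i j - M d i j).
  rewrite !mxE -sumrB; apply: pdvd_sum => l _; rewrite -mulrBr; apply: pdvdMl.
  elim: (nat_of_ord j) => [|t [y e]] //=; exists (frob y).
  by rewrite -rmorphB e rmorphM rmorphXn rmorph_nat.
rewrite /determinant -sumrB; apply: pdvd_sum => s _; rewrite -mulrBr; apply: pdvdMl.
elim/big_rec2: _ => [|i x y _ IH]; first by rewrite subrr; apply: pdvd0.
have -> : M c i (s i) * y - M d i (s i) * x
  = (M c i (s i) - M d i (s i)) * y + M d i (s i) * (y - x) by ring.
by apply: pdvdD; [apply: pdvdMr | apply: pdvdMl].
Qed.

End Coordinates.
(** * The p-adic logarithm and exponential *)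

Lemma xget_unique (T : choiceType) (P : set T) x0 x :
  P x -> (forall y, P y -> y = x) -> xget x0 P = x.
Proof. by move=> Px h; case: xgetP => [y _ /h|/(_ x)]. Qed.

Lemma ideal_pow_principal (W : comNzRingType) (a : W) k x :
  ideal_pow (principal a) k x <-> pdvd a k x.
Proof.
elim: k x => [|k IH] x; first by split=> // _; apply: pdvd_0.
split=> [[s [hs ->]]|[y ->]].
  rewrite big_seq; apply: pdvd_sum => yz /hs [/IH h1 h2].
  by rewrite -addn1; apply: pdvdM => //; rewrite /pdvd expr1.
exists [:: (a ^+ k, a * y)]; split.
  move=> yz; rewrite inE => /eqP -> /=; split; last by exists y.
  by apply/IH; apply: pdvd_self.
by rewrite big_seq1 exprSr mulrA.
Qed.

Lemma logn_bound p m : (2 < p)%N -> (1 < m)%N -> (logn p m + 2 <= m)%N.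
Proof.
move=> p2 m1; have := dvdn_leq (ltnW m1) (pfactor_dvdnn p m).
have h v : (0 < v)%N -> (v + 2 <= 3 ^ v)%N.
  by case: v => // v _; elim: v => // v IH; rewrite expnS; lia.
case: (posnP (logn p m)) => [->|v0] //; apply: leq_trans.
by apply: leq_trans (h _ v0) _; rewrite leq_exp2r.
Qed.

Lemma logn_half p m : (2 < p)%N -> (logn p m <= m./2)%N.
Proof.
move=> p2; case: (posnP m) => [->|m0]; first by rewrite logn0.
have := dvdn_leq m0 (pfactor_dvdnn p m).
have h v : (v.*2 <= 3 ^ v)%N by elim: v => // v IH; have := expn_gt0 3 v; rewrite expnS; lia.
have := h (logn p m); have : (3 ^ logn p m <= p ^ logn p m)%N.
  by case: (posnP (logn p m)) => [->|v0] //; rewrite leq_exp2r.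
move=> h1 h2 h3; rewrite geq_half_double; apply: leq_trans h2 _.
exact: leq_trans h1 h3.
Qed.

Lemma logn_fact_half p m : prime p -> (2 < p)%N -> (logn p m`! <= m./2)%N.
Proof.
move=> pp p2; rewrite logn_fact // big_add1 /=.
have h K : ((\sum_(0 <= k < K) m %/ p ^ k.+1).*2 + m %/ p ^ K <= m)%N.
  elim: K => [|K IH]; first by rewrite big_geq // expn0 divn1.
  rewrite big_nat_recr //= expnSr divnMA; set q := (m %/ p ^ K)%N in IH *.
  have h3 : (3 * (q %/ p) <= q)%N.
    by apply: leq_trans (leq_trunc_div q p); rewrite mulnC leq_mul2l p2 orbT.
  by move: IH; rewrite doubleD; lia.
by rewrite geq_half_double; apply: leq_trans (h m); apply: leq_addr.
Qed.

Section PadicAnalysis.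
Variables (p : nat) (F : finFieldType) (W : comUnitRingType).
Variable res : {rmorphism W -> F}.
Hypotheses (p_prime : prime p) (p_gt2 : (2 < p)%N) (witt : is_witt p res).
Local Notation dvd := (pdvd (p%:R : W)).

Lemma dvd1p : dvd 1 p%:R. Proof. by exists 1; rewrite mulr1 expr1. Qed.

Lemma natr_split d : (0 < d)%N ->
  exists2 l : W, l \is a GRing.unit & d%:R = p%:R ^+ logn p d * l.
Proof.
move=> d0; exists (d`_p^')%:R.
  by apply: (unit_natr p_prime witt); rewrite prime_coprime // -p'natE // part_pnat.
by rewrite -natrX -natrM -p_part partnC.
Qed.

Lemma div_natr d k (x : W) : (0 < d)%N -> (logn p d <= k)%N -> dvd k x ->
  exists2 c, d%:R * c = x & dvd (k - logn p d) c.
Proof.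
move=> d0 dk [u ->]; have [l ul ->] := natr_split d0.
exists (p%:R ^+ (k - logn p d) * (u / l)); last by exists (u / l).
by rewrite mulrACA -exprD subnKC // [l * _]mulrCA divrr // mulr1.
Qed.

Lemma dvd_natrM d k (x : W) : (0 < d)%N -> dvd k (d%:R * x) -> dvd (k - logn p d) x.
Proof.
move=> d0 [u e]; have [l ul el] := natr_split d0.
case: (leqP k (logn p d)) => h.
  by rewrite (eqP (h : (k - logn p d == 0)%N)); apply: pdvd_0.
exists (u / l); apply: (mulIr ul); apply: (mulpI witt (k := logn p d)).
transitivity (d%:R * x); first by rewrite el; ring.
by rewrite e -[_ * _ * l]mulrA divrK // mulrA -exprD subnKC // ltnW.
Qed.

Lemma exact_quoE d (a c : W) : (0 < d)%N -> d%:R * c = a -> exact_quo a d%:R = c.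
Proof.
by move=> d0 h; apply: xget_unique => // y /=; rewrite -h => /(mulrnI_witt p_prime witt d0).
Qed.

Lemma adic_limE (u : nat -> W) l :
  (forall k, exists N, forall j, (N <= j)%N -> dvd k (u j - l)) ->
  adic_lim (principal p%:R) u = l.
Proof.
move=> h; apply: xget_unique => [k|y hy].
  by have [N hN] := h k; exists N => j /hN ?; apply/ideal_pow_principal.
apply: (witt_sep_eq witt) => k; have [N hN] := h k; have [N' hN'] := hy k.
apply: (@pdvdB_trans _ _ _ _ (u (maxn N N'))).
  by apply: pdvdBC; apply/ideal_pow_principal; apply: hN'; apply: leq_maxr.
by apply: hN; apply: leq_maxl.
Qed.

(** The exponents [i./2] are a common lower bound for the valuations of the terms
    of both series below. *)
Lemma series_cvg (t : nat -> W) : (forall i, dvd i./2 (t i)) ->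
  exists l, forall k j, (k.*2 <= j)%N -> dvd k (\sum_(i < j) t i - l).
Proof.
move=> ht.
have ht' k i : (k.*2 <= i)%N -> dvd k (t i).
  by move=> h; apply: (pdvd_le _ (ht i)); lia.
have [l hl] : exists l, forall k, dvd k (\sum_(i < k.*2) t i - l).
  apply: (witt_complete witt) => k; rewrite doubleS !big_ord_recr /=.
  rewrite -addrA addrAC subrr add0r; apply: pdvdD; apply: ht' => //; exact: leqnSn.
exists l => k j kj; apply: (@pdvdB_trans _ _ _ _ (\sum_(i < k.*2) t i)); last exact: hl.
rewrite -!(big_mkord xpredT) (big_cat_nat (n := k.*2)) //= addrAC subrr add0r.
rewrite big_nat; apply: pdvd_sum => i /andP [h _]; exact: ht'.
Qed.

(** ** The logarithm *)

Definition lterm (x : W) m : W := exact_quo ((-1) ^+ m.+1 * x ^+ m) m%:R.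

Lemma ltermP k x m : (0 < m)%N -> dvd k x -> (0 < k)%N ->
  m%:R * lterm x m = (-1) ^+ m.+1 * x ^+ m /\ dvd (k * m - logn p m) (lterm x m).
Proof.
move=> m0 hx k0.
have h : dvd (k * m) ((-1) ^+ m.+1 * x ^+ m) by apply: pdvdMl; apply: pdvdX.
have [|c hc hd] := div_natr m0 _ h.
  by apply: leq_trans (logn_half m p_gt2) _; have := leq_pmull m k0; lia.
by rewrite /lterm (exact_quoE m0 hc).
Qed.

Lemma lterm1 x : lterm x 1 = x.
Proof. by apply: exact_quoE; rewrite // mul1r expr1 expr2 mulrNN !mul1r. Qed.

Lemma plogP th : dvd 1 (th - 1) -> forall k j, (k.*2 <= j)%N ->
  dvd k (\sum_(1 <= m < j) lterm (th - 1) m - plog p th).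
Proof.
move=> hth; pose t m := if m is 0 then 0 else lterm (th - 1) m.
have tE j : \sum_(1 <= m < j) lterm (th - 1) m = \sum_(m < j) t m.
  rewrite -(big_mkord xpredT); case: j => [|j]; first by rewrite !big_geq.
  by rewrite [RHS]big_ltn // add0r; apply: eq_big_nat => -[].
have [l hl] : exists l, forall k j, (k.*2 <= j)%N -> dvd k (\sum_(i < j) t i - l).
  apply: series_cvg => -[|m]; first exact: pdvd0.
  have [_ h] := @ltermP 1 _ m.+1 isT hth isT; apply: (pdvd_le _ h).
  by have := logn_half m.+1 p_gt2; rewrite mul1n; lia.
suff -> : plog p th = l by move=> k j; rewrite tE; apply: hl.
by apply: adic_limE => k; exists k.*2 => j hj; rewrite tE; apply: hl.
Qed.

(** For odd [p] the terms of degree at least two of [log (1 + x)] are divisible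
    by a higher power of [p] than [x] is. *)
Lemma plog_near k th : (0 < k)%N -> dvd k (th - 1) ->
  dvd k.+1 (plog p th - (th - 1)).
Proof.
move=> k0 hth; have hth1 : dvd 1 (th - 1) by apply: pdvd_le hth.
have := plogP hth1 (leqnn k.+1.*2); rewrite doubleS big_ltn // lterm1 => h.
apply: pdvdBC; apply: (@pdvdB_trans _ _ _ _ _ _ _ h).
rewrite opprD addrA subrr add0r; apply: pdvdN.
rewrite big_nat; apply: pdvd_sum => m /andP [m2 _].
have [_ h'] := @ltermP k _ m (ltnW m2) hth k0; apply: (pdvd_le _ h').
have := logn_bound p_gt2 m2; move: (logn p m) => v hv.
by case: k k0 {hth h h'} => // k _; rewrite mulSn; have := leq_mul (leqnn k) m2; lia.
Qed.

Lemma plog_dvd k th : (0 < k)%N -> dvd k (th - 1) -> dvd k (plog p th).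
Proof.
move=> k0 h; rewrite -[plog p th](subrK (th - 1)); apply: pdvdD => //.
by apply: (pdvd_le _ (plog_near k0 h)).
Qed.

Lemma plog_inj1 th : dvd 1 (th - 1) -> plog p th = 0 -> th = 1.
Proof.
move=> h e; apply: (witt_sep_eq witt); elim=> [|k IH]; first exact: pdvd_0.
case: (posnP k) => [->|k0] //.
by have := plog_near k0 IH; rewrite e sub0r => /pdvdN; rewrite opprK.
Qed.

Lemma bin_pred_padic M k j : (j <= M)%N -> (M < p ^ k)%N ->
  dvd (k - M) ('C((p ^ k).-1, j)%:R - (-1) ^+ j).
Proof.
move=> + Mk; elim: j => [|j IH] jM.
  by rewrite bin0 subrr; apply: pdvd0.
have P0 : (0 < p ^ k)%N by rewrite expn_gt0 prime_gt0.
have h : dvd (k - M) 'C(p ^ k, j.+1)%:R.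
  have e : dvd k (j.+1%:R * 'C(p ^ k, j.+1)%:R).
    by rewrite -natrM -mul_bin_diag natrM natrX; exists 'C((p ^ k).-1, j)%:R.
  apply: (pdvd_le _ (dvd_natrM _ e)) => //.
  by have := logn_half j.+1 p_gt2; lia.
have E : 'C(p ^ k, j.+1)%:R = 'C((p ^ k).-1, j.+1)%:R + 'C((p ^ k).-1, j)%:R :> W.
  by rewrite -{1}(prednK P0) binS natrD.
have -> : 'C((p ^ k).-1, j.+1)%:R - (-1) ^+ j.+1
   = 'C(p ^ k, j.+1)%:R - ('C((p ^ k).-1, j)%:R - (-1) ^+ j) :> W.
  by rewrite E exprS; ring.
by apply: pdvdB => //; apply: IH; apply: ltnW.
Qed.

(** The logarithm of [th] is the derivative of [s |-> th ^ s] at [0], here taken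
    along [s = p ^ k]: the quotient [C(p ^ k, m) / p ^ k = C(p ^ k - 1, m - 1) / m]
    tends to [(-1) ^ (m - 1) / m]. *)
Lemma plog_lim K th : dvd 1 (th - 1) -> exists k0, forall k, (k0 <= k)%N ->
  exists z, th ^+ (p ^ k) - 1 = p%:R ^+ k * (plog p th + p%:R ^+ K * z).
Proof.
move=> hth.
(* Modulo [p ^ K] only the terms of index below [2 K] matter, and for these the
   congruence of [bin_pred_padic] costs at most [2 K] powers of [p]. *)
exists (3 * K)%N => k hk; set x := th - 1 in hth *.
have P1 : (k < p ^ k)%N by apply: ltn_expl; apply: prime_gt1.
have P0 : (0 < p ^ k)%N by apply: leq_trans P1.
pose Q := \sum_(1 <= m < (p ^ k).+1) 'C((p ^ k).-1, m.-1)%:R * ((-1) ^+ m.+1 * lterm x m).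
have hQ : th ^+ (p ^ k) - 1 = p%:R ^+ k * Q.
  have -> : th = 1 + x by rewrite addrC subrK.
  rewrite exprDn -(big_mkord xpredT (fun i => (1 ^+ (p ^ k - i) * x ^+ i) *+ 'C(p ^ k, i))).
  rewrite big_ltn // subn0 expr1n expr0 mulr1 bin0 addrAC subrr add0r.
  rewrite /Q mulr_sumr; apply: eq_big_nat => m /andP [m0 _].
  have [h _] := @ltermP 1 _ m m0 hth isT.
  apply: (mulrnI_witt p_prime witt m0).
  have -> : m%:R * (p%:R ^+ k * ('C((p ^ k).-1, m.-1)%:R * ((-1) ^+ m.+1 * lterm x m)))
    = (p%:R ^+ k * 'C((p ^ k).-1, m.-1)%:R) * ((-1) ^+ m.+1 * (m%:R * lterm x m)) by ring.
  have -> : (-1) ^+ m.+1 * (m%:R * lterm x m) = x ^+ m.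
    by rewrite h mulrA -expr2 sqrr_sign mul1r.
  rewrite -natrX -natrM mul_bin_diag prednK // natrM expr1n mul1r -mulr_natr.
  by ring.
have [z hz] : dvd K (Q - plog p th).
  have kj : (K.*2 <= (p ^ k).+1)%N by lia.
  apply: (@pdvdB_trans _ _ _ _ _ _ _ (plogP hth kj)).
  rewrite /Q -sumrB big_nat; apply: pdvd_sum => m /andP [m0 mP].
  rewrite mulrA -{2}[lterm x m]mul1r -mulrBl.
  case: (leqP K.*2 m) => hm.
    apply: pdvdMl; have [_ h] := @ltermP 1 _ m m0 hth isT; apply: (pdvd_le _ h).
    by have := logn_half m p_gt2; rewrite mul1n; lia.
  apply: pdvdMr.
  have -> : 'C((p ^ k).-1, m.-1)%:R * (-1) ^+ m.+1 - 1
     = ('C((p ^ k).-1, m.-1)%:R - (-1) ^+ m.-1) * (-1) ^+ m.+1 :> W.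
    rewrite mulrBl -exprD; congr (_ - _).
    have -> : (m.-1 + m.+1 = m * 2)%N by lia.
    by rewrite exprM sqrr_sign.
  apply: pdvdMr; apply: (pdvd_le _ (@bin_pred_padic K.*2 k m.-1 _ _)); lia.
by exists z; rewrite hQ -hz addrC subrK.
Qed.

Lemma dvd1M th et : dvd 1 (th - 1) -> dvd 1 (et - 1) -> dvd 1 (th * et - 1).
Proof.
move=> h1 h2; have -> : th * et - 1 = (th - 1) * et + (et - 1) by ring.
by apply: pdvdD => //; apply: pdvdMr.
Qed.

(** With [th ^ P = 1 + P u] and [et ^ P = 1 + P v], the product is
    [1 + P (u + v) + P ^ 2 u v]; let [P = p ^ k] tend to [0]. *)
Lemma plogM th et : dvd 1 (th - 1) -> dvd 1 (et - 1) ->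
  plog p (th * et) = plog p th + plog p et.
Proof.
move=> h1 h2; apply: (witt_sep_eq witt) => K.
have [k1 H1] := plog_lim K h1; have [k2 H2] := plog_lim K h2.
have [k3 H3] := plog_lim K (dvd1M h1 h2).
pose k := (k1 + k2 + k3 + K)%N.
have [|z1 e1] := H1 k; first by rewrite /k; lia.
have [|z2 e2] := H2 k; first by rewrite /k; lia.
have [|z3 e3] := H3 k; first by rewrite /k; lia.
apply: (pdvd_cancel witt (k := k)).
pose P := p%:R ^+ k : W; pose L1 := plog p th + p%:R ^+ K * z1.
pose L2 := plog p et + p%:R ^+ K * z2.
have -> : p%:R ^+ k * (plog p (th * et) - (plog p th + plog p et))
  = P * (p%:R ^+ K * (z1 + z2 - z3)) + P * (P * (L1 * L2)).
  have E : (th * et) ^+ (p ^ k) - 1 = P * L1 + P * L2 + P * L1 * (P * L2).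
    by rewrite -/P in e1 e2; rewrite /L1 /L2 -e1 -e2 exprMn; ring.
  rewrite -/P in e3 *; have {}E : P * (plog p (th * et) + p%:R ^+ K * z3)
     = P * L1 + P * L2 + P * L1 * (P * L2) by rewrite -e3 E.
  have -> : P * (plog p (th * et) - (plog p th + plog p et))
    = P * (plog p (th * et) + p%:R ^+ K * z3)
      - P * (plog p th + plog p et + p%:R ^+ K * z3) by ring.
  by rewrite E /L1 /L2; ring.
apply: pdvdD; apply: pdvdM; try exact: pdvd_self.
  by exists (z1 + z2 - z3).
by apply: pdvdMr; apply: (@pdvd_le _ _ k); [rewrite /k; lia | apply: pdvd_self].
Qed.

(** ** The exponential *)

Definition eterm (z : W) m : W := exact_quo (p%:R ^+ m * z ^+ m) m`!%:R.

Lemma etermP k z m : dvd k z -> m`!%:R * eterm z m = p%:R ^+ m * z ^+ m /\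
  dvd (k * m + (m - m./2)) (eterm z m).
Proof.
move=> hz; have hm := logn_fact_half m p_prime p_gt2.
have h : dvd (m + k * m) (p%:R ^+ m * z ^+ m).
  by apply: pdvdM; [apply: pdvd_self | apply: pdvdX].
have [|c hc hd] := div_natr (fact_gt0 m) _ h; first by lia.
rewrite /eterm (exact_quoE (fact_gt0 m) hc); split=> //.
by apply: (pdvd_le _ hd); lia.
Qed.

Lemma eterm_half z m : dvd m./2 (eterm z m).
Proof.
by have [_ h] := @etermP 0 z m (pdvd_0 _ _); apply: (pdvd_le _ h); lia.
Qed.

(** The function [z |-> exp (p z)]. *)
Definition wexp (z : W) : W :=
  adic_lim (principal p%:R) (fun N => \sum_(m < N) eterm z m).

Lemma wexpP z k j : (k.*2 <= j)%N -> dvd k (\sum_(m < j) eterm z m - wexp z).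
Proof.
have [l hl] := series_cvg (eterm_half z).
suff -> : wexp z = l by apply: hl.
by apply: adic_limE => k'; exists k'.*2; apply: hl.
Qed.

Lemma eterm_add z w m : eterm (z + w) m = \sum_(i < m.+1) eterm z i * eterm w (m - i).
Proof.
have [h _] := @etermP 0 (z + w) m (pdvd_0 _ _).
apply: (mulrnI_witt p_prime witt (fact_gt0 m)).
rewrite h addrC exprDn !mulr_sumr; apply: eq_bigr => i _.
have im : (i <= m)%N by rewrite -ltnS.
have [h1 _] := @etermP 0 z i (pdvd_0 _ _); have [h2 _] := @etermP 0 w (m - i) (pdvd_0 _ _).
rewrite -(bin_fact im) !natrM.
have -> : 'C(m, i)%:R * (i`!%:R * (m - i)`!%:R) * (eterm z i * eterm w (m - i))
  = 'C(m, i)%:R * (i`!%:R * eterm z i) * ((m - i)`!%:R * eterm w (m - i)) by ring.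
have -> : p%:R ^+ m = p%:R ^+ i * p%:R ^+ (m - i) :> W by rewrite -exprD subnKC.
by rewrite h1 h2 -mulr_natr; ring.
Qed.

(** The partial sums are values at [1] of truncated polynomials, whose product has
    the terms of the series for [z + w] as its low coefficients and highly divisible
    high coefficients. *)
Lemma wexpD z w : wexp (z + w) = wexp z * wexp w.
Proof.
apply: (witt_sep_eq witt) => K.
(* With this [N], [i + j >= N] implies [i./2 + j./2 >= K]. *)
pose N := K.*2.+2.
pose A := \poly_(i < N) eterm z i; pose B := \poly_(i < N) eterm w i.
have hN : (K.*2 <= N)%N by rewrite /N; lia.
have A1 : A.[1] = \sum_(i < N) eterm z i.
  by rewrite horner_poly; apply: eq_bigr => i _; rewrite expr1n mulr1.
have B1 : B.[1] = \sum_(i < N) eterm w i.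
  by rewrite horner_poly; apply: eq_bigr => i _; rewrite expr1n mulr1.
have Ahalf i : dvd i./2 A`_i.
  by rewrite coef_poly; case: ifP => _; [apply: eterm_half | apply: pdvd0].
have Bhalf i : dvd i./2 B`_i.
  by rewrite coef_poly; case: ifP => _; [apply: eterm_half | apply: pdvd0].
have ABlow m : (m < N)%N -> (A * B)`_m = eterm (z + w) m.
  move=> hm; rewrite coefM eterm_add; apply: eq_bigr => i _.
  have := ltn_ord i; rewrite !coef_poly => hi.
  by have -> : (i < N)%N = true by [lia]; have -> : (m - i < N)%N = true by [lia].
have h : dvd K ((A * B).[1] - \sum_(m < N) eterm (z + w) m).
  rewrite (horner_coef_wide 1 (leq_addr N (size (A * B)))).
  have -> : \sum_(m < N) eterm (z + w) m = \sum_(0 <= m < N) (A * B)`_m * 1 ^+ m.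
    rewrite -(big_mkord xpredT); apply: eq_big_nat => i hi.
    by rewrite expr1n mulr1 ABlow.
  rewrite -(big_mkord xpredT (fun m => (A * B)`_m * 1 ^+ m)).
  rewrite (big_cat_nat (n := N)) ?leq_addl //= addrAC subrr add0r big_nat.
  apply: pdvd_sum => m /andP [hm _]; rewrite expr1n mulr1 coefM.
  apply: pdvd_sum => i _; have := ltn_ord i => hi.
  by apply: (pdvd_le _ (pdvdM (Ahalf i) (Bhalf (m - i)%N))); rewrite /N in hm; lia.
apply: (@pdvdB_trans _ _ _ _ (\sum_(m < N) eterm (z + w) m)).
  by apply: pdvdBC; apply: wexpP.
apply: (@pdvdB_trans _ _ _ _ (A.[1] * B.[1])).
  by apply: pdvdBC; rewrite -hornerM.
have -> : A.[1] * B.[1] - wexp z * wexp w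
  = (A.[1] - wexp z) * B.[1] + wexp z * (B.[1] - wexp w) by ring.
by rewrite A1 B1; apply: pdvdD; [apply: pdvdMr | apply: pdvdMl]; apply: wexpP.
Qed.

Lemma wexp_near k z : dvd (k.*2.+1) (wexp (p%:R ^+ k * z) - (1 + p%:R ^+ k.+1 * z)).
Proof.
set y := p%:R ^+ k * z; have hy : dvd k y by exists z.
have hw := @wexpP y k.*2.+1 k.*2.+1.*2 (leqnn _).
apply: (@pdvdB_trans _ _ _ _ (\sum_(m < k.*2.+1.*2) eterm y m)).
  exact: pdvdBC.
rewrite doubleS !big_ord_recl /=.
have -> : eterm y 0 = 1 by apply: exact_quoE; rewrite // !expr0 !mulr1.
have -> : eterm y (bump 0 0) = p%:R ^+ k.+1 * z.
  by apply: exact_quoE; rewrite // mul1r !expr1 /y mulrA -exprS.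
rewrite addrA [X in dvd _ X]addrAC subrr add0r; apply: pdvd_sum => m _.
rewrite /bump /= !add1n.
have [_ h] := @etermP k y m.+2 hy; apply: (pdvd_le _ h).
by rewrite !mulnS; lia.
Qed.

Lemma wexp_dvd1 z : dvd 1 (wexp z - 1).
Proof.
have := wexp_near 0 z; rewrite expr0 mul1r expr1 => h.
have -> : wexp z - 1 = (wexp z - (1 + p%:R * z)) + p%:R * z by ring.
by apply: pdvdD => //; exists z; rewrite expr1.
Qed.

Lemma wexp_pow z k : wexp (k.+1%:R * z) = wexp z ^+ k.+1.
Proof.
elim: k => [|k IH]; first by rewrite mul1r expr1.
by rewrite exprS -IH -wexpD; congr wexp; rewrite -[k.+2]add1n natrD mulrDl mul1r.
Qed.

(** Apply [plog_lim] to [wexp z], whose powers are [wexp (p ^ k z)], that is,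
    [1 + p ^ (k + 1) z] to first order. *)
Lemma plog_wexp z : plog p (wexp z) = p%:R * z.
Proof.
apply: (witt_sep_eq witt) => K.
have [k0 h] := plog_lim K (wexp_dvd1 z); pose k := (k0 + K)%N.
have [|w e] := h k; first by rewrite /k; lia.
have P0 : (0 < p ^ k)%N by rewrite expn_gt0 prime_gt0.
have e2 : wexp z ^+ (p ^ k) = wexp (p%:R ^+ k * z).
  by rewrite -natrX -(prednK P0) wexp_pow.
have [w' e'] := wexp_near k z.
apply: (pdvd_cancel witt (k := k)).
have -> : p%:R ^+ k * (plog p (wexp z) - p%:R * z)
   = p%:R ^+ k.*2.+1 * w' - p%:R ^+ k * (p%:R ^+ K * w).
  rewrite -e' -e2.
  have -> : p%:R ^+ k * (plog p (wexp z) - p%:R * z)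
    = p%:R ^+ k * (plog p (wexp z) + p%:R ^+ K * w) - p%:R ^+ k * (p%:R ^+ K * w)
      - p%:R ^+ k.+1 * z by rewrite exprS; ring.
  by rewrite -e; ring.
apply: pdvdB; last by rewrite mulrA -exprD; exists w.
by apply: (@pdvd_le _ _ k.*2.+1); [rewrite /k; lia | exists w'].
Qed.

(** Both sides have the same logarithm, and the logarithm is injective on
    [1 + p W]. *)
Lemma wexp_plog th : dvd 1 (th - 1) -> wexp (exact_quo (plog p th) p%:R) = th.
Proof.
move=> hth; have [y] := plog_dvd (ltn0Sn 0) hth; rewrite expr1 => hy.
rewrite (exact_quoE (prime_gt0 p_prime) (esym hy)).
have uth : th \is a GRing.unit by rewrite -[th](subrK 1) addrC; apply: (unit_1p witt).
pose et := wexp y / th.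
have E : wexp y = th * et by rewrite /et mulrCA divrr // mulr1.
have het : dvd 1 (et - 1).
  have -> : et - 1 = (wexp y - th) / th by rewrite mulrBl divrr.
  apply: pdvdMr; apply: (@pdvdB_trans _ _ _ _ 1); first exact: wexp_dvd1.
  exact: pdvdBC.
have := plog_wexp y; rewrite E plogM // hy => /eqP.
rewrite -subr_eq0 addrAC subrr add0r => /eqP h.
by rewrite (plog_inj1 het h) mulr1.
Qed.

Lemma plog_cong k th et : (0 < k)%N -> dvd 1 (th - 1) -> dvd 1 (et - 1) ->
  dvd k (th - et) -> dvd k (plog p th - plog p et).
Proof.
move=> k0 h1 h2 h.
have uet : et \is a GRing.unit by rewrite -[et](subrK 1) addrC; apply: (unit_1p witt).
have hq j : dvd j (th - et) -> dvd j (th / et - 1).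
  by move=> hj; have -> : th / et - 1 = (th - et) / et; [rewrite mulrBl divrr|apply: pdvdMr].
have h3 : dvd 1 (th / et - 1) by apply: hq; apply: (pdvd_le _ h).
have -> : plog p th = plog p (th / et) + plog p et by rewrite -plogM // divrK.
by rewrite addrK; apply: plog_dvd => //; apply: hq.
Qed.

(** The approximations of [plog_lim] are fixed. *)
Lemma plog_fixed (g : {rmorphism W -> W}) th : dvd 1 (th - 1) ->
  g th = th -> g (plog p th) = plog p th.
Proof.
move=> h hg; apply: (witt_sep_eq witt) => K; have [k0 H] := plog_lim K h.
have [z e] := H k0 (leqnn _).
have := congr1 g e; rewrite rmorphB rmorphXn rmorph1 hg e rmorphM rmorphD rmorphM !rmorphXn.
rewrite !rmorph_nat => /(mulpI witt) e2; exists (z - g z).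
by rewrite -[g (plog p th)](addrK (p%:R ^+ K * g z)) -e2; ring.
Qed.

End PadicAnalysis.
(** * The ring [E_0] *)

Section IdealPow.
Variables (R : comNzRingType) (I : R -> Prop).

Lemma ideal_powD k x y : ideal_pow I k x -> ideal_pow I k y -> ideal_pow I k (x + y).
Proof.
case: k => // k [s [hs ->]] [t [ht ->]]; exists (s ++ t); split; last by rewrite big_cat.
by move=> yz; rewrite mem_cat => /orP [/hs|/ht].
Qed.

Lemma ideal_powMl k c x : ideal_pow I k x -> ideal_pow I k (c * x).
Proof.
elim: k x => // k IH x [s [hs ->]].
exists [seq (c * yz.1, yz.2) | yz <- s]; split.
  by move=> yz /mapP [yz' /hs [h1 h2] ->]; split=> //; apply: IH.
by rewrite big_map mulr_sumr; apply: eq_bigr => yz _; rewrite mulrA.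
Qed.

Lemma ideal_powN k x : ideal_pow I k x -> ideal_pow I k (- x).
Proof. by rewrite -mulN1r; apply: ideal_powMl. Qed.

Lemma ideal_powMS k x y : ideal_pow I k x -> I y -> ideal_pow I k.+1 (x * y).
Proof.
move=> hx hy; exists [:: (x, y)]; split; last by rewrite big_seq1.
by move=> yz; rewrite inE => /eqP ->.
Qed.

Lemma ideal_pow_sum k (J : eqType) (s : seq J) (f : J -> R) :
  (forall j, j \in s -> ideal_pow I k (f j)) -> ideal_pow I k (\sum_(j <- s) f j).
Proof.
elim: s => [|j s IH] h.
  by rewrite big_nil; case: k {h} => // k; exists [::]; rewrite big_nil.
rewrite big_cons; apply: ideal_powD; first by apply: h; rewrite mem_head.
by apply: IH => i hi; apply: h; rewrite in_cons hi orbT.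
Qed.

Lemma ideal_powS k x : ideal_pow I k.+1 x -> ideal_pow I k x.
Proof.
move=> [s [hs ->]]; apply: ideal_pow_sum => yz /hs [h _].
by rewrite mulrC; apply: ideal_powMl.
Qed.

Lemma ideal_pow_le k l x : (l <= k)%N -> ideal_pow I k x -> ideal_pow I l x.
Proof. by move=> /subnK <-; elim: (k - l)%N => // j IH /ideal_powS. Qed.

End IdealPow.

Section LubinTateRing.
Variables (p m : nat) (F : finFieldType) (W : comUnitRingType).
Local Notation n := m.+1.
Variable res : {rmorphism W -> F}.
Hypotheses (p_prime : prime p) (cardF : #|F| = (p ^ n)%N) (witt : is_witt p res).
Local Notation E := (mps m W).
Local Notation I := (@maxideal p n W).
Local Notation dvd := (pdvd (p%:R : W)).
Local Notation T := (teichmuller res).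

Lemma maxideal_p : I p%:R.
Proof.
exists 1, (fun=> 0); rewrite mulr1 big1 ?addr0 // => i _; exact: mulr0.
Qed.

Lemma ideal_pow_p k (x : E) : ideal_pow I k (p%:R ^+ k * x).
Proof.
rewrite mulrC; apply: ideal_powMl; elim: k => // k IH; rewrite exprSr.
by apply: ideal_powMS => //; apply: maxideal_p.
Qed.

Lemma ideal_powC k w : dvd k w -> ideal_pow I k (mpsC w : E).
Proof.
by move=> [u ->]; rewrite rmorphM rmorphXn rmorph_nat; apply: ideal_pow_p.
Qed.

(** Each factor in the maximal ideal contributes either a factor [p] or one degree. *)
Lemma ideal_pow_coef k (x : E) a : ideal_pow I k x -> dvd (k - mdeg a) (pcoef x a).
Proof.
elim: k x a => [|k IH] x a; first by move=> _; rewrite sub0n; apply: pdvd_0.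
move=> [s [hs ->]]; rewrite pcoef_sum big_seq; apply: pdvd_sum => yz.
move=> /hs [h1 [u [v ->]]]; rewrite mulrDr pcoefD; apply: pdvdD.
  rewrite mulrCA -(rmorph_nat mpsC) pcoefCM.
  have := IH _ a (ideal_powMl u h1); rewrite mulrC => h.
  by apply: (@pdvd_le _ _ (1 + (k - mdeg a))); [lia | apply: pdvdM => //; apply: dvd1p].
rewrite mulr_sumr pcoef_sum; apply: pdvd_sum => i _.
rewrite mulrCA pcoefXM; case e : (a i) => [|j]; first exact: pdvd0.
have hd : mdeg (a - U_(i))%MM = (mdeg a).-1.
  have le : (U_(i) <= a)%MM.
    by apply/mnm_lepP => l; rewrite mnm1E; case: eqP => // <-; rewrite e.
  by rewrite -{2}(submK le) mdegD mdeg1 addn1.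
have := IH _ (a - U_(i))%MM (ideal_powMl (v i) h1); rewrite mulrC hd.
by apply: pdvd_le; have : (0 < mdeg a)%N; [rewrite mdegE (bigD1 i) //= e | lia].
Qed.

Lemma ideal_pow_sep (x : E) : (forall k, ideal_pow I k x) -> x = 0.
Proof.
move=> h; apply: mpsP => a; apply: (witt_sep witt) => k.
by have := ideal_pow_coef a (h (k + mdeg a)%N); rewrite addnK.
Qed.

Lemma E0_adic_limE (u : nat -> E) l :
  (forall k, exists N, forall j, (N <= j)%N -> ideal_pow I k (u j - l)) ->
  adic_lim I u = l.
Proof.
move=> h; apply: xget_unique => [//|y hy].
apply/eqP; rewrite -subr_eq0; apply/eqP; apply: ideal_pow_sep => k.
have [N hN] := h k; have [N' hN'] := hy k.
have -> : y - l = - (u (maxn N N') - y) + (u (maxn N N') - l) by ring.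
apply: ideal_powD; last by apply: hN; apply: leq_maxl.
by apply: ideal_powN; apply: hN'; apply: leq_maxr.
Qed.

(** A series without constant term is a combination of the variables: collect
    the monomials according to the first variable that occurs in them. *)
Lemma mps_var_decomp (x : E) : pcoef x 0%MM = 0 ->
  exists z : 'I_m -> E, x = \sum_i mpsX i * z i.
Proof.
move=> x0; pose z (i : 'I_m) : E :=
  MPS (fun a => if [forall j : 'I_m, (j < i)%N ==> (a j == 0%N)] then pcoef x (a + U_(i))%MM else 0).
exists z; apply: mpsP => a; rewrite pcoef_sum.
under eq_bigr => i _ do rewrite pcoefXM.
case: (eqVneq a 0%MM) => [->|a0].
  by rewrite x0 big1 // => i _; rewrite mnm0E.
have [i0 hi0] : exists i, a i != 0%N.
  apply/existsP; rewrite -negb_forall; apply/negP => /forallP e; case/eqP: a0.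
  by apply/mnmP => i; rewrite mnm0E; apply/eqP.
case: (@arg_minnP _ i0 (fun i => a i != 0%N) (fun i => i : nat) hi0) => i ai min.
have low (j : 'I_m) : (j < i)%N -> a j = 0%N.
  by move=> ji; apply/eqP; apply: contraTT ji => /min; rewrite -leqNgt.
have le : (U_(i) <= a)%MM.
  by apply/mnm_lepP => l; rewrite mnm1E; case: eqP => // <-; rewrite lt0n.
rewrite (bigD1 i) //= big1 => [|j ji].
  rewrite addr0; case: (a i) ai => [//|t] _; rewrite /pcoef /=.
  case: forallP => [_|[]]; first by rewrite submK.
  move=> j; apply/implyP => ji; rewrite mnmBE low //.
case e : (a j) => [//|t]; rewrite /pcoef /=; case: forallP => // /(_ i) /implyP.
have ij : (i < j)%N.
  by rewrite ltn_neqAle val_eqE eq_sym ji min // e.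
move/(_ ij); rewrite mnmBE mnm1E (negPf ji) subn0 => /eqP h.
by rewrite h eqxx in ai.
Qed.

Lemma maxidealP (x : E) : res (pcoef x 0%MM) = 0 -> I x.
Proof.
move=> /(res0P witt) [y]; rewrite expr1 => hy.
have [|z hz] := @mps_var_decomp (x - mpsC (pcoef x 0%MM)).
  by rewrite pcoefB pcoefC eqxx subrr.
exists (mpsC y), z; rewrite -hz hy rmorphM rmorph_nat; ring.
Qed.

(** The quotient of [w ^ p - 1] by [w - 1] is a sum of [p] elements congruent to
    [1], hence in the maximal ideal. *)
Lemma expr_ppow_1 (y : E) j : I y -> ideal_pow I j.+1 ((1 + y) ^+ (p ^ j) - 1).
Proof.
move=> hy; elim: j => [|j IH].
  by rewrite expn0 expr1 [1 + y]addrC addrK -[y]mul1r; apply: ideal_powMS.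
rewrite expnSr exprM; set w := (1 + y) ^+ (p ^ j) in IH *.
rewrite subrX1; apply: ideal_powMS => //.
apply: maxidealP.
have w1 : res (pcoef w 0%MM) = 1.
  have := ideal_pow_coef 0%MM IH; rewrite mdeg0 subn0 => h.
  have /(res0P witt) : dvd 1 (pcoef (w - 1) 0%MM) by apply: (pdvd_le _ h).
  by rewrite pcoefB rmorphB pcoef1 eqxx rmorph1 => /eqP; rewrite subr_eq0 => /eqP.
rewrite pcoef_sum rmorph_sum (eq_bigr (fun=> 1)) => [|i _].
  by rewrite sumr_const card_ord (pcharf0 (charF p_prime witt)).
elim: (nat_of_ord i) => [|t IHt]; first by rewrite pcoef1 eqxx rmorph1.
by rewrite exprS pcoef0M rmorphM w1 IHt mulr1.
Qed.

(** Raising to the power [p ^ (n k)] contracts [1 + m] to [1] and fixes the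
    Teichmueller representatives. *)
Lemma zlim_pow_lambda (t : E) : t \is a GRing.unit ->
  zlim_pow (t : E0 n W) (zlim_opp (lambda p n))
    = mpsC (T (res (pcoef t 0%MM) ^+ rexp p n))^-1.
Proof.
move=> ut; set c := res _; set r := rexp p n.
have c1 : c * res (pcoef t^-1 0%MM) = 1.
  by rewrite -rmorphM -pcoef0M divrr // pcoef1 eqxx rmorph1.
have c0 : c != 0 by apply/eqP => e; move/eqP: c1; rewrite e mul0r eq_sym oner_eq0.
have uT : T c \is a GRing.unit by apply: (teich_unit p_prime witt (ltn0Sn m) cardF).
have TX k : T (c ^+ k) = T c ^+ k.
  elim: k => [|k IH]; first by rewrite !expr0 (teich1 p_prime witt (ltn0Sn m) cardF).
  by rewrite !exprS (teichM p_prime witt (ltn0Sn m) cardF) IH.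
have [rT fT] := teichP p_prime witt (ltn0Sn m) cardF c.
pose y := t^-1 * mpsC (T c) - 1 : E.
have hy : I y.
  apply: maxidealP; rewrite /y pcoefB mulrC pcoefCM pcoef1 eqxx rmorphB rmorphM rmorph1.
  by rewrite rT c1 subrr.
have tE : t^-1 = mpsC (T c)^-1 * (1 + y).
  by rewrite /y [1 + _]addrC subrK mulrCA -rmorphM mulVr // rmorph1 mulr1.
have fTn k : (T c)^-1 ^+ (p ^ (n * k)) = (T c)^-1.
  elim: k => [|k IH]; first by rewrite muln0 expn0 expr1.
  by rewrite mulnS expnD exprM -cardF exprVn fT.
apply: E0_adic_limE => k; exists k => j kj.
rewrite /= -exprz_inv -exprnP tE exprMn -!(rmorphXn mpsC) exprM fTn TX -exprVn.
suff h : ideal_pow I k ((mpsC ((T c)^-1 ^+ r) : E) * ((1 + y) ^+ (p ^ (n * j) * r) - 1)).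
  by move: h; rewrite mulrBr mulr1.
apply: ideal_powMl.
rewrite exprM subrX1 mulrC; apply: ideal_powMl.
apply: (ideal_pow_le _ (expr_ppow_1 (n * j) hy)).
by rewrite mulSn; lia.
Qed.

Hypothesis p_gt2 : (2 < p)%N.

Lemma pexpC z : pexp p (mpsC z : E0 n W) = mpsC (wexp p z).
Proof.
have eE i : exact_quo (p%:R ^+ i * (mpsC z : E) ^+ i) i`!%:R = mpsC (eterm p z i).
  have [h _] := etermP p_prime p_gt2 witt i (pdvd_0 _ z).
  have hE : i`!%:R * mpsC (eterm p z i) = p%:R ^+ i * mpsC z ^+ i :> E.
    by have := congr1 (@mpsC m W) h; rewrite !rmorphM !rmorphXn !rmorph_nat.
  apply: xget_unique => // y /=; rewrite -hE => e; apply: mpsP => a.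
  have := congr1 (fun f : E => pcoef f a) e.
  rewrite -[i`!%:R](rmorph_nat (@mpsC m W)) !pcoefCM.
  by apply: (mulrnI_witt p_prime witt (fact_gt0 i)).
apply: E0_adic_limE => k; exists k.*2 => j kj.
rewrite (eq_bigr (fun i : 'I_j => mpsC (eterm p z i))) => [|i _]; last exact: eE.
rewrite -rmorph_sum -rmorphB; apply: ideal_powC.
exact: (wexpP p_prime p_gt2 witt).
Qed.

End LubinTateRing.

(** * The stabilizer group *)

Lemma iso_lead (R : comNzRingType) (G G' : mps 2 R) f : is_fgl_iso G G' f ->
  exists v, lead f * v = 1.
Proof.
move=> [_ [f' [hf' e _]]]; exists (lead f').
rewrite -lead_comp; last exact: hom_vdeg hf'.
by rewrite e leadE -[psX]expr1 cfXn.
Qed.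

Section Stab.
Variables (p n : nat) (F : finFieldType) (H : mps 2 F).
Hypotheses (chF : p \in [pchar F]) (honda : is_honda p n H).

Lemma hom_gal (s : {rmorphism F -> F}) f : is_fgl_hom H H f ->
  is_fgl_hom H H (mps_map s f).
Proof.
move=> [f0 e]; split; first by rewrite pcoef_map f0 rmorph0.
have := congr1 (mps_map s) e.
by rewrite /= mps_map_comp1 !fadd_map !mps_map_comp1 !mps_map_mpsX (gal_honda s chF honda).
Qed.

Lemma hom_comp f g : is_fgl_hom H H f -> is_fgl_hom H H g ->
  is_fgl_hom H H (ps_comp f g).
Proof.
have [fH _ _] := honda; move=> hf hg; have f0 := hom_vdeg hf; have g0 := hom_vdeg hg.
have X0 (i : 'I_2) : vdeg 1 (mpsX i : mps 2 F) by apply: vdeg_mpsX.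
split; first by apply/vdeg1P; apply: vdeg_comp.
rewrite /= !ps_compA //; try exact: vdeg_fadd.
by case: (hg) => _ ->; rewrite (hom_fadd fH hf) //; apply: vdeg_comp.
Qed.

(** The conjugate of an automorphism is an automorphism of the conjugate law, which
    is [H] itself. *)
Lemma in_stab_mul x y : in_stab H x -> in_stab H y -> in_stab H (stab_mul x y).
Proof.
move=> [hf [f' [hf' e1 e2]]] [hg [g' [hg' e3 e4]]].
have sg := hom_gal y.2 hg; have sg' := hom_gal x.2 hg'; have {}sg := hom_gal x.2 hg.
split; first exact: hom_comp.
have f0 := hom_vdeg hf; have f0' := hom_vdeg hf'.
have g0 := hom_vdeg sg; have g0' := hom_vdeg sg'.
exists (ps_comp (mps_map x.2 g') f'); split; first exact: hom_comp.
  rewrite /stab_mul /= ps_compA //; last exact: vdeg_comp.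
  by rewrite -(ps_compA (mps_map x.2 y.1)) // -mps_map_comp1 e3 mps_map_psX psX_comp.
rewrite /stab_mul /= ps_compA //; last exact: vdeg_comp.
by rewrite -(ps_compA f') // e2 psX_comp // -mps_map_comp1 e4 mps_map_psX.
Qed.

End Stab.
(** * The crossed homomorphisms *)
Section Main.
Variables (p m : nat).
Local Notation n := m.+1.
Hypotheses (p_prime : prime p) (p_gt2 : (2 < p)%N).
Variables (F : finFieldType) (W : comUnitRingType).
Hypothesis cardF : #|F| = (p ^ n)%N.
Variable res : {rmorphism W -> F}.
Hypothesis witt : is_witt p res.
Variable frob : {rmorphism W -> W}.
Hypothesis frobP : is_frobenius_lift p res frob.
Variable galW : gal F -> {rmorphism W -> W}.
Hypothesis galWP : is_gal_action res galW.
Variable H : mps 2 F.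
Hypothesis honda : is_honda p n H.
Variable G : mps 2 (E0 n W).
Variables (phi : mps 1 F -> {rmorphism E0 n W -> E0 n W})
  (psi : mps 1 F -> mps 1 (E0 n W)).
Hypothesis phi_psiP : forall g, is_fgl_iso H H g ->
  is_deformation_of p res G g (phi g) (psi g).
Variable rho : W -> mps 1 F.
Hypothesis rhoP : is_witt_mult res H rho.
Variable a : mps 1 F -> 'I_n -> W.
Hypothesis aP : forall g, is_fgl_iso H H g -> is_coord p H rho g (a g).

Local Notation dvd := (pdvd (p%:R : W)).
Local Notation T := (teichmuller res).
Local Notation I := (@maxideal p n W).
Local Notation act := (stab_act galW phi).
Let D (x : stab F) : W := \det (coord_matrix p frob (a x.1)).
Let th (x : stab F) : W := theta p res frob a x.1.
Let ze (x : stab F) : W := zetaW p res frob a x.1.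
Let chF : p \in [pchar F]. Proof. exact: charF p_prime witt. Qed.

Lemma iso_endo g : is_fgl_iso H H g -> g = endo p H rho (a g).
Proof. exact: aP. Qed.

Lemma det_residue x : in_stab H x -> res (D x) = lead x.1 ^+ rexp p n.
Proof.
move=> hx; rewrite (res_det p_prime cardF witt frobP) [in RHS](iso_endo hx).
by rewrite (lead_endo p_prime cardF witt honda rhoP).
Qed.

Lemma det_frob_fixed x : frob (D x) = D x.
Proof. exact: (det_frob p_prime cardF witt honda rhoP frobP). Qed.

Lemma det_gal_fixed s x : galW s (D x) = D x.
Proof.
exact: (frob_fixed p_prime witt (ltn0Sn m) cardF frobP (galWP s) (det_frob_fixed x)).
Qed.

(** The coordinates of [f s(g)] are computed by the product of the matrices of
    [f] and of the conjugate of [g], whose determinants do not see [s]. *)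
Lemma det_stab_mul x y : in_stab H x -> in_stab H y -> D (stab_mul x y) = D x * D y.
Proof.
move=> hx hy; have hxy := in_stab_mul chF honda hx hy.
have e : endo p H rho (a (stab_mul x y).1)
    = ps_comp (endo p H rho (a x.1)) (endo p H rho (fun i => galW x.2 (a y.1 i))).
  rewrite -(iso_endo hxy) -(iso_endo hx) /stab_mul /= [in LHS](iso_endo hy).
  by rewrite (endo_gal p_prime cardF witt honda rhoP _ (galWP x.2)).
rewrite /D (coord_matrix_comp p_prime cardF witt honda rhoP frobP e) det_mulmx mulrC.
rewrite (coord_matrix_gal p_prime cardF witt frobP _ (galWP x.2)) det_map_mx.
by rewrite -/(D y) det_gal_fixed.
Qed.

Lemma det_continuous k x y : in_stab H x -> in_stab H y ->
  eqdeg (p ^ (n * k)) y.1 x.1 -> dvd k (D y - D x).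
Proof.
move=> hx hy e; apply: det_cong.
apply: (endo_dvdB p_prime cardF witt honda rhoP).
by rewrite -(iso_endo hx) -(iso_endo hy).
Qed.

Local Notation c x := (lead x.1 ^+ rexp p n).

Lemma lead_pow_neq0 x : in_stab H x -> c x != 0.
Proof.
move=> /iso_lead [v e]; rewrite expf_neq0 //; apply/eqP => e0.
by move/eqP: e; rewrite e0 mul0r eq_sym oner_eq0.
Qed.

Lemma teich_lead_unit x : in_stab H x -> T (c x) \is a GRing.unit.
Proof. by move=> hx; apply: (teich_unit p_prime witt (ltn0Sn m) cardF); apply: lead_pow_neq0. Qed.

Lemma lead_pow_gal (s : gal F) x : in_stab H x -> s (c x) = c x.
Proof. by move=> hx; rewrite -det_residue // -galWP det_gal_fixed. Qed.

Lemma thetaE x : th x = (T (c x))^-1 * D x. Proof. by []. Qed.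

Lemma theta_gal s x : in_stab H x -> galW s (th x) = th x.
Proof.
move=> hx; rewrite thetaE rmorphM det_gal_fixed rmorphV ?teich_lead_unit //.
by rewrite (teich_lift p_prime witt (ltn0Sn m) cardF _ (galWP s)) lead_pow_gal.
Qed.

Lemma theta_stab_mul x y : in_stab H x -> in_stab H y -> th (stab_mul x y) = th x * th y.
Proof.
move=> hx hy; rewrite !thetaE det_stab_mul //.
have -> : c (stab_mul x y) = c x * c y.
  rewrite /stab_mul /= lead_comp ?exprMn; last first.
    by apply: vdeg_map; case: hy => hy _; apply: hom_vdeg hy.
  by rewrite lead_map -rmorphXn lead_pow_gal.
rewrite (teichM p_prime witt (ltn0Sn m) cardF) invrM ?teich_lead_unit //; ring.
Qed.

Lemma theta_principal x : in_stab H x -> dvd 1 (th x - 1).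
Proof.
move=> hx; apply/(res_eqP witt); rewrite thetaE rmorphM rmorphV ?teich_lead_unit //.
rewrite (res_teich p_prime witt (ltn0Sn m) cardF) det_residue // mulVf ?rmorph1 //.
exact: lead_pow_neq0.
Qed.

Lemma theta_continuous k x y : in_stab H x -> in_stab H y ->
  eqdeg (p ^ (n * k.+1)) y.1 x.1 -> dvd k.+1 (th y - th x).
Proof.
move=> hx hy e; rewrite !thetaE.
have -> : lead y.1 = lead x.1.
  rewrite !leadE; have /eqdegP := e; apply.
  by rewrite -{1}(expn0 p) ltn_exp2l ?prime_gt1 // muln_gt0.
by rewrite -mulrBr; apply: pdvdMl; apply: det_continuous.
Qed.

Lemma zeta_log x : in_stab H x -> p%:R * ze x = plog p (th x).
Proof.
move=> hx; have [y] := plog_dvd p_prime p_gt2 witt (ltn0Sn 0) (theta_principal hx).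
rewrite expr1 => e; rewrite e /ze /zetaW -/(th x).
by rewrite (exact_quoE p_prime witt (prime_gt0 p_prime) (esym e)).
Qed.

Lemma mulp_inj (u v : W) : p%:R * u = p%:R * v -> u = v.
Proof. by move=> h; apply: (mulpI witt (k := 1)); rewrite expr1. Qed.

Lemma zeta_stab_mul x y : in_stab H x -> in_stab H y -> ze (stab_mul x y) = ze x + ze y.
Proof.
move=> hx hy; have hxy := in_stab_mul chF honda hx hy; apply: mulp_inj.
rewrite mulrDr !zeta_log // theta_stab_mul // (plogM p_prime p_gt2 witt) //; exact: theta_principal.
Qed.

Lemma zeta_gal s x : in_stab H x -> galW s (ze x) = ze x.
Proof.
move=> hx; apply: mulp_inj; rewrite -{1}(rmorph_nat (galW s)) -rmorphM zeta_log //.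
by apply: (plog_fixed p_prime p_gt2 witt); [apply: theta_principal | apply: theta_gal].
Qed.

Lemma zeta_continuous k x y : in_stab H x -> in_stab H y ->
  eqdeg (p ^ (n * k.+1)) y.1 x.1 -> dvd k (ze y - ze x).
Proof.
move=> hx hy e; apply: (pdvd_cancel witt (k := 1)).
rewrite expr1 mulrBr !zeta_log //; apply: (plog_cong p_prime p_gt2 witt) => //.
- exact: theta_principal.
- exact: theta_principal.
- exact: theta_continuous.
Qed.

Lemma wexp_zeta x : in_stab H x -> wexp p (ze x) = th x.
Proof. by move=> hx; apply: (wexp_plog p_prime p_gt2 witt); apply: theta_principal. Qed.

Lemma actC x w : in_stab H x -> act x (mpsC w) = mpsC (galW x.2 w).
Proof.
move=> hx; have [[h _] _] := phi_psiP hx.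
by rewrite /stab_act mps_mapC h.
Qed.

(** The isomorphism [psi_g] is a lift of [g] composed with a series congruent to the
    coordinate. *)
Lemma lead_psi x : in_stab H x ->
  lead (psi x.1) \is a GRing.unit /\ res (pcoef (lead (psi x.1)) 0%MM) = lead x.1.
Proof.
move=> hx; have [_ [h [f [Gh [hg [_ hiso] fiso fX ->]]]]] := phi_psiP hx.
have f0 : vdeg 1 f by case: fiso => [hf _]; apply: hom_vdeg hf.
have [v1 e1] := iso_lead hiso; have [v2 e2] := iso_lead fiso.
rewrite lead_comp //; split.
  rewrite unitrM; apply/andP; split; apply/unitrPr; [by exists v1|by exists v2].
rewrite pcoef0M rmorphM -[RHS]mulr1; congr (_ * _).
  by rewrite -[in RHS]hg.
have := fX U_(ord0)%MM; rewrite -/(lead f) -/(lead psX) => -[y [z e]].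
have -> : lead f = 1 + (p%:R * y + \sum_i mpsX i * z i).
  rewrite -e addrC (_ : lead psX = 1) ?subrK //.
  by rewrite leadE -[psX]expr1 cfXn.
rewrite pcoefD pcoef1 eqxx pcoefD pcoef0M -(rmorph_nat mpsC) pcoefC eqxx.
rewrite pcoef_sum big1 => [|i _]; last by rewrite pcoefXM mnm0E.
by rewrite addr0 rmorphD rmorph1 rmorphM rmorph_nat (pcharf0 chF) mul0r addr0.
Qed.

Lemma t0_lambda x : in_stab H x ->
  zlim_pow (lead (psi x.1)) (zlim_opp (lambda p n)) * mpsC (D x) = mpsC (th x).
Proof.
move=> hx; have [u e] := lead_psi hx.
by rewrite (zlim_pow_lambda p_prime cardF witt u) e -rmorphM.
Qed.

Lemma is_cocycle_theta (f : stab F -> E0 n W) :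
  (forall x, in_stab H x -> f x = mpsC (th x)) ->
  is_cocycle p H act (fun e => e \is a GRing.unit) *%R f.
Proof.
move=> hf; split.
- move=> x hx; rewrite hf //; apply: (rmorph_unit mpsC).
  by rewrite -[th x](subrK 1) addrC; apply: (unit_1p witt); apply: theta_principal.
- move=> k x hx; exists (p ^ (n * k.+1))%N => y hy _ e.
  rewrite !hf // -rmorphB; apply: ideal_powC; apply: (@pdvd_le _ _ k.+1) => //.
  exact: theta_continuous.
move=> x y hx hy; have hxy := in_stab_mul chF honda hx hy.
by rewrite !hf // actC // theta_gal // theta_stab_mul // rmorphM.
Qed.

Lemma exp_zeta_eq :
  is_Z1_add p H act (fun x => mpsC (ze x)) /\
  eq_H1_mul p H act (fun x => pexp p (mpsC (ze x) : E0 n W))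
    (fun x => zlim_pow (lead (psi x.1)) (zlim_opp (lambda p n)) * mpsC (D x)).
Proof.
split; first split=> //.
- move=> k x hx; exists (p ^ (n * k.+1))%N => y hy _ e.
  by rewrite -rmorphB; apply: ideal_powC; apply: zeta_continuous.
- by move=> x y hx hy; rewrite actC // zeta_gal // zeta_stab_mul // rmorphD.
have hexp x : in_stab H x -> pexp p (mpsC (ze x) : E0 n W) = mpsC (th x).
  by move=> hx; rewrite (pexpC p_prime cardF witt p_gt2) wexp_zeta.
split; [exact: is_cocycle_theta | exact: is_cocycle_theta t0_lambda|].
exists 1; split=> [|x hx]; first exact: unitr1.
by rewrite hexp // t0_lambda // -(rmorph1 mpsC) actC // !rmorph1.
Qed.

End Main.

Theorem proposition3p9 (p n : nat) (p_prime : prime p) (p_gt2 : (2 < p)%N)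
    (n_ge1 : (1 <= n)%N)
    (* F = F_(p^n), W = W(F) with reduction res, Frobenius lift and Galois action *)
    (F : finFieldType) (cardF : #|F| = (p ^ n)%N)
    (W : comUnitRingType) (res : {rmorphism W -> F}) (witt : is_witt p res)
    (frob : {rmorphism W -> W}) (frobP : is_frobenius_lift p res frob)
    (galW : gal F -> {rmorphism W -> W}) (galWP : is_gal_action res galW)
    (* the Honda formal group law H_n and the universal deformation G_n *)
    (H : mps 2 F) (honda : is_honda p n H)
    (G : mps 2 (E0 n W)) (lubin_tate : is_lubin_tate p G)
    (* the ring map phi_g and the isomorphism psi_g, for g in S_n *)
    (phi : mps 1 F -> {rmorphism E0 n W -> E0 n W})
    (psi : mps 1 F -> mps 1 (E0 n W))
    (phi_psiP : forall g, is_fgl_iso H H g ->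
       is_deformation_of p res G g (phi g) (psi g))
    (* g = a_0 + a_1 S + ... + a_(n-1) S^(n-1) in End(H_n), for g in S_n *)
    (rho : W -> mps 1 F) (rhoP : is_witt_mult res H rho)
    (a : mps 1 F -> 'I_n -> W)
    (aP : forall g, is_fgl_iso H H g -> is_coord p H rho g (a g)) :
  let act := stab_act galW phi in
  let t0 : stab F -> E0 n W := fun x => lead (psi x.1) in
  let det : stab F -> E0 n W := fun x => mpsC (detW p frob a x.1) in
  let zeta : stab F -> E0 n W := fun x => mpsC (zetaW p res frob a x.1) in
  is_Z1_add p H act zeta /\
  eq_H1_mul p H act
    (fun x => pexp p (zeta x))
    (fun x => zlim_pow (t0 x) (zlim_opp (lambda p n)) * det x).
Proof.
destruct n as [|m]; first by [].
exact: (exp_zeta_eq p_prime p_gt2 cardF witt frobP galWP honda phi_psiP rhoP aP).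
Qed.
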